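(* Let $\Omega\subset\mathbb{R}^d$ ($d\ge2$) be a bounded connected open set with smooth boundary, let $\mathbf{B}\in C^0(\overline\Omega,\mathbb{R}^{n\times d\times n})$ and $k\in\{0,\dots,n\}$. Then $\dim N(\nabla+\mathbf{B}\cdot)=k$ if and only if $\mathbf{B}$ is $k$-conservative.
   Context: $N(\nabla+\mathbf{B}\cdot)$ is the set of $\boldsymbol\mu\in L^2(\Omega,\mathbb{R}^n)$ with $\nabla\boldsymbol\mu+\mathbf{B}\cdot\boldsymbol\mu=0$ in the distributional sense, where $(\nabla\boldsymbol\mu)_{ij}=\partial_j\mu_i$ and $(\mathbf{B}\cdot\boldsymbol\mu)_{ij}=\sum_k\mathbf{B}_{ijk}\mu_k$. For $x,y\in\Omega$ let $\Gamma(x,y)=\{\boldsymbol\gamma\in C^1([0,1],\Omega):\boldsymbol\gamma(0)=x,\ \boldsymbol\gamma(1)=y\}$. For $\boldsymbol\gamma\in\Gamma(x,y)$ define the linear map $R^{\boldsymbol\gamma}_{\mathbf{B}}:\mathbb{R}^n\to\mathbb{R}^n$ by $R^{\boldsymbol\gamma}_{\mathbf{B}}(\mathbf{v})=\boldsymbol\varphi_{\mathbf{v}}(1)$, where $\boldsymbol\varphi_{\mathbf{v}}$ is the unique solution on $[0,1]$ of $\varphi_i'(t)=-\sum_{j,k}\mathbf{B}_{ijk}(\boldsymbol\gamma(t))\varphi_k(t)\gamma_j'(t)$, $\boldsymbol\varphi(0)=\mathbf{v}$. For $x\in\Omega$ let $E^x_{\mathbf{B}}=\{\mathbf{v}\in\mathbb{R}^n:\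 \forall y\in\Omega,\ \forall\boldsymbol\gamma_1,\boldsymbol\gamma_2\in\Gamma(x,y),\ R^{\boldsymbol\gamma_1}_{\mathbf{B}}(\mathbf{v})=R^{\boldsymbol\gamma_2}_{\mathbf{B}}(\mathbf{v})\}$, a vector subspace of $\mathbb{R}^n$. $\mathbf{B}$ is called $k$-conservative if $\dim E^x_{\mathbf{B}}=k$ for all $x\in\Omega$. *)

(* Defs.v *)
From HB Require Import structures.
From mathcomp Require Import all_boot all_order all_algebra.
From mathcomp Require Import all_classical all_reals all_analysis.
Set Implicit Arguments. Unset Strict Implicit. Unset Printing Implicit Defensive.
Import Order.TTheory GRing.Theory Num.Theory.
Import numFieldNormedType.Exports.
Local Open Scope classical_set_scope.
Local Open Scope ring_scope.

Section Defs.
Variable R : realType.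

Fixpoint iterD {d : nat} (vs : seq 'rV[R]_d) (f : 'rV[R]_d -> R) : 'rV[R]_d -> R :=
  match vs with
  | [::] => f
  | v :: vs' => 'D_v (iterD vs' f)
  end.

Definition smooth {d : nat} (f : 'rV[R]_d -> R) : Prop :=
  forall vs : seq 'rV[R]_d,
    continuous (iterD vs f) /\ (forall v x, derivable (iterD vs f) x v).

Definition test_fun {d : nat} (Om : set 'rV[R]_d) (phi : 'rV[R]_d -> R) : Prop :=
  smooth phi /\
  exists K : set 'rV[R]_d, compact K /\ K `<=` Om /\ (forall x, ~ K x -> phi x = 0).

Definition smooth_boundary {d : nat} (Om : set 'rV[R]_d) : Prop :=
  forall p, closure Om p -> ~ Om p ->
  exists r : R, 0 < r /\
  exists psi : 'rV[R]_d -> R, smooth psi /\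
    (forall x, ball p r x -> exists v, 'D_v psi x != 0) /\
    (forall x, ball p r x -> (Om x <-> psi x < 0)).

Definition Rd (d : nat) := g_sigma_algebraType (@open 'rV[R]_d).

Definition box {d : nat} (a b : 'rV[R]_d) : set 'rV[R]_d :=
  [set x | forall i, a ord0 i <= x ord0 i <= b ord0 i].

(* lam is the d-dimensional Lebesgue measure (on Borel sets): it gives every
   box its volume (this characterizes it uniquely) *)
Definition is_lebesgue {d : nat} (lam : {measure set (Rd d) -> \bar R}) : Prop :=
  forall a b : 'rV[R]_d, (forall i, a ord0 i <= b ord0 i) ->
    lam (box a b) = (\prod_i (b ord0 i - a ord0 i))%:E.

Definition tensor (n d : nat) := 'I_n -> 'I_d -> 'I_n -> 'rV[R]_d -> R.

Definition evec {d : nat} (j : 'I_d) : 'rV[R]_d := delta_mx ord0 j.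

(* mu in N(grad + B.) : mu in L^2(Omega, R^n) and, for all test functions phi,
   <d_j mu_i + sum_k B_ijk mu_k, phi> = 0, i.e.
   - int mu_i d_j phi + int (sum_k B_ijk mu_k) phi = 0 *)
Definition in_kernel {n d : nat} (lam : {measure set (Rd d) -> \bar R})
  (Om : set 'rV[R]_d) (B : tensor n d) (mu : 'I_n -> Rd d -> R) : Prop :=
  (forall i, measurable_fun (Om : set (Rd d)) (mu i)) /\
  (forall i, (\int[lam]_(x in (Om : set (Rd d))) ((mu i x) ^+ 2)%:E < +oo)%E) /\
  (forall phi, test_fun Om phi -> forall i j,
     (\int[lam]_(x in (Om : set (Rd d))) (- (mu i x * 'D_(evec j) phi x)
         + (\sum_k B i j k x * mu k x) * phi x)%:E = 0)%E).

Definition ae_eq {n d : nat} (lam : {measure set (Rd d) -> \bar R})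
  (Om : set 'rV[R]_d) (mu nu : 'I_n -> Rd d -> R) : Prop :=
  forall i, {ae lam, forall x : Rd d, Om x -> mu i x = nu i x}.

Definition dim_kernel_eq {n d : nat} (lam : {measure set (Rd d) -> \bar R})
  (Om : set 'rV[R]_d) (B : tensor n d) (k : nat) : Prop :=
  exists e : 'I_k -> 'I_n -> Rd d -> R,
    (forall l, in_kernel lam Om B (e l)) /\
    (forall c : 'I_k -> R,
        ae_eq lam Om (fun i x => \sum_l c l * e l i x) (fun _ _ => 0) ->
        forall l, c l = 0) /\
    (forall mu, in_kernel lam Om B mu ->
        exists c : 'I_k -> R, ae_eq lam Om mu (fun i x => \sum_l c l * e l i x)).

(* Gamma(x,y): C^1 paths [0,1] -> Omega from x to y (given as C^1 maps R -> R^d,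
   only their restriction to [0,1] matters) *)
Definition path_in {d : nat} (Om : set 'rV[R]_d) (x y : 'rV[R]_d)
  (g : R -> 'rV[R]_d) : Prop :=
  (forall t : R, derivable g t 1) /\ continuous (fun t => 'D_1 g t) /\
  (forall t : R, 0 <= t <= 1 -> Om (g t)) /\ g 0 = x /\ g 1 = y.

Definition solves_transport {n d : nat} (B : tensor n d) (g : R -> 'rV[R]_d)
  (phi : R -> 'rV[R]_n) : Prop :=
  forall t : R, 0 <= t <= 1 ->
    is_derive t 1 phi
      (\row_i (- \sum_j \sum_k B i j k (g t) * phi t ord0 k * 'D_1 g t ord0 j)).

Definition transport {n d : nat} (B : tensor n d) (g : R -> 'rV[R]_d)
  (v w : 'rV[R]_n) : Prop :=
  exists phi, solves_transport B g phi /\ phi 0 = v /\ phi 1 = w.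

Definition Ex {n d : nat} (Om : set 'rV[R]_d) (B : tensor n d) (x : 'rV[R]_d)
  (v : 'rV[R]_n) : Prop :=
  forall y, Om y -> forall g1 g2, path_in Om x y g1 -> path_in Om x y g2 ->
  forall w1 w2, transport B g1 v w1 -> transport B g2 v w2 -> w1 = w2.

Definition subspace_dim_eq {n : nat} (E : set 'rV[R]_n) (k : nat) : Prop :=
  exists A : 'M[R]_(k, n), row_free A /\ forall v, E v <-> (v <= A)%MS.

Definition k_conservative {n d : nat} (Om : set 'rV[R]_d) (B : tensor n d)
  (k : nat) : Prop :=
  forall x, Om x -> subspace_dim_eq (Ex Om B x) k.

End Defs.

(* Main.v *)
Require Import Defs.
From HB Require Import structures.
From mathcomp Require Import all_boot all_order all_algebra.
From mathcomp Require Import all_classical all_reals all_analysis.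
From mathcomp Require Import measurable_realfun ring lra.
Set Implicit Arguments. Unset Strict Implicit. Unset Printing Implicit Defensive.
Import Order.TTheory GRing.Theory Num.Theory.
Import numFieldNormedType.Exports.
Local Open Scope classical_set_scope.
Local Open Scope ring_scope.

(* Evaluation at a point of Omega identifies the kernel of [grad + B.] with [E^x_B].  A kernel
   element equals almost everywhere a continuous [u] with [d_j u_i = - sum_k B_ijk u_k], so
   that [u] is transported along every C^1 path and [u x] lies in [E^x_B]; conversely a vector of
   [E^x_B] extends by transport to such a [u], and Gronwall's inequality bounds [u] up to the
   smooth boundary, so that [u] is square integrable.

   As [B] is only continuous, the weak equation cannot be mollified directly.  In the single
   direction [e_j], however, a gauge [G_j] solving the linear equation [d_j G = G B_j] along
   lines makes [G_j mu] weakly constant in the direction [e_j].  Composing these shift invariances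
   over all directions shows that pairing [mu] with a test function does not change when the
   test function is moved by any small [h] and corrected by a continuous matrix [P(y, h)]; averaging
   over [h] represents [mu] by a continuous kernel. *)

(** * Calculus on the line and linear differential equations *)

(** The gauges of different directions are unrelated: for smooth [B] a common gauge exists only
    where the curvature vanishes, and for continuous [B] the curvature is not even defined. The
    correction P(y, h) is therefore collected along a staircase of moves parallel to the axes. It
    depends on the order of the axes, but the pairing with [mu] is preserved for every order, and
    this is all that the averaging uses. A gauge [G_j] is differentiable in the direction e_j alone,
    so the weak equation must be available for test functions that are C^1 in a single direction.
    The averaged kernel yields continuity only; the partial derivatives come from a second use of
    the gauges, on the continuous representative. Transport is linear and, by uniqueness, sends only
    0 to 0, so a transported field on the connected set Omega is determined by its value at one
    point: linear independence almost everywhere and at a point become the same. The measure [lam]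
    is known through the volumes of boxes alone; translation invariance and sigma-finiteness are
    derived from them. *)

Section OneVariable.
Variable R : realType.
Implicit Types f g : R -> R.

Lemma is_derive1_continuous f (t d : R) : is_derive t 1 f d -> {for t, continuous f}.
Proof.
by case=> /derivable1_diffP/differentiable_continuous.
Qed.

Lemma derive_within_continuous f df (a b : R) :
  (forall t : R, a <= t <= b -> is_derive t 1 f (df t)) ->
  {within `[a, b], continuous f}.
Proof.
move=> hf; apply: derivable_within_continuous => t.
by rewrite in_itv /= => /hf [].
Qed.

Lemma MVT_derive f df (a b : R) : a <= b ->
  (forall t : R, a <= t <= b -> is_derive t 1 f (df t)) ->
  exists2 c, a <= c <= b & f b - f a = df c * (b - a).
Proof.
move=> ab hf; have hf' t : t \in `]a, b[%R -> is_derive t 1 f (df t).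
  by rewrite in_itv/= => /andP[ta tb]; apply: hf; rewrite !ltW.
have [c] := MVT_segment ab hf' (derive_within_continuous hf).
by rewrite in_itv/= => cab E; exists c.
Qed.

Lemma derive_ge0_le f df (a b : R) : a <= b ->
  (forall t : R, a <= t <= b -> is_derive t 1 f (df t)) ->
  (forall t : R, a <= t <= b -> 0 <= df t) -> f a <= f b.
Proof.
move=> ab hf h0; have [c cab E] := MVT_derive ab hf.
by rewrite -subr_ge0 E mulr_ge0 ?h0 ?subr_ge0.
Qed.

Lemma derive_le_le f df g dg (a b : R) : a <= b ->
  (forall t : R, a <= t <= b -> is_derive t 1 f (df t)) ->
  (forall t : R, a <= t <= b -> is_derive t 1 g (dg t)) ->
  (forall t : R, a <= t <= b -> `|df t| <= dg t) -> `|f b - f a| <= g b - g a.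
Proof.
move=> ab hf hg hle.
have h1 : (g - f) a <= (g - f) b.
  apply: (@derive_ge0_le _ (fun t => dg t - df t)) => // t tab.
    by have := hf _ tab; have := hg _ tab => *; apply: is_deriveB.
  by rewrite subr_ge0 (le_trans (ler_norm _))// hle.
have h2 : (g + f) a <= (g + f) b.
  apply: (@derive_ge0_le _ (fun t => dg t + df t)) => // t tab.
    by have := hf _ tab; have := hg _ tab => *; apply: is_deriveD.
  by rewrite -lerBlDr sub0r (le_trans _ (hle _ tab))// -normrN ler_norm.
rewrite ler_norml; move: h1 h2; rewrite /= !fctE; lra.
Qed.

Lemma derive_zero_eq f (a b : R) : a <= b ->
  (forall t : R, a <= t <= b -> is_derive t 1 f 0) -> f b = f a.
Proof.
move=> ab hf; have [c _] := @MVT_derive f (fun=> 0) _ _ ab hf.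
by rewrite mul0r => /eqP; rewrite subr_eq0 => /eqP.
Qed.

Lemma is_derive_expM (c t : R) : is_derive t 1 (fun s => expR (c * s)) (c * expR (c * t)).
Proof.
have -> : (fun s : R => expR (c * s)) = expR \o (fun s => c * s) by [].
rewrite [c * expR _]mulrC.
apply: is_derive1_comp.
have : is_derive t (1 : R) ( *%R c \o id) (c *: (1:R)) by exact: is_deriveZ.
by rewrite /GRing.scale /= mulr1.
Qed.

(** The function (q + e/c) exp(-c t) has nonpositive derivative; the term e/c that remains at time T
    is nonnegative and is dropped. *)
Lemma gronwall (q dq : R -> R) (c e T : R) : 0 <= T -> 0 < c -> 0 <= e ->
  (forall t : R, 0 <= t <= T -> is_derive t 1 q (dq t)) ->
  (forall t : R, 0 <= t <= T -> dq t <= c * q t + e) ->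
  q T <= (q 0 + e / c) * expR (c * T).
Proof.
move=> T0 c0 e0 hq hdq.
pose w := fun t : R => - ((q t + e / c) * expR ((- c) * t)).
have : w 0 <= w T.
  apply: (@derive_ge0_le _ (fun t => - (dq t * expR ((- c) * t) + (q t + e / c) * (- c * expR (- c * t))))) => // t tT.
    have h1 := hq _ tT; have h2 := is_derive_expM (- c) t.
    apply: is_deriveN.
    have h3 : is_derive t 1 (q + cst (e / c)) (dq t + 0) by exact: is_deriveD.
    have h4 := @is_deriveM _ _ _ _ t 1 _ _ h3 h2.
    by apply: (is_derive_eq h4); rewrite /GRing.scale /= addr0 addrC mulrC.
  have E : 0 <= expR (- c * t) by exact: expR_ge0.
  rewrite oppr_ge0 mulrA -mulrDl mulr_le0_ge0//.
  have := hdq _ tT; have : e / c * c = e by rewrite mulfVK ?gt_eqF.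
  by move: (e / c) => k <-; lra.
rewrite /w mulr0 expR0 mulr1 lerN2 => h.
have := ler_wpM2r (expR_ge0 (c * T)) h.
rewrite -mulrA -expRD mulNr addNr expR0 mulr1.
by apply: le_trans; rewrite lerDl divr_ge0// ltW.
Qed.

Local Notation mu := (@lebesgue_measure R).

(** Signed and based at 0, so that integral equations can be solved on all of R, for negative times
    as well. *)
Definition primitive f (x : R) : R :=
  if 0 <= x then \int[mu]_(t in `[0, x]) f t else - \int[mu]_(t in `[x, 0]) f t.

Lemma primitive0 f : primitive f 0 = 0.
Proof. by rewrite /primitive lexx set_itv1 Rintegral_set1. Qed.

Lemma continuous_itv_integrable f (a b : R) : continuous f ->
  mu.-integrable `[a, b] (EFin \o f).
Proof.
move=> cf; apply: continuous_compact_integrable; first exact: segment_compact.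
exact: continuous_subspaceT.
Qed.

(** A base point M to the left of both 0 and x removes the case distinction on the sign of x, so
    that the fundamental theorem of calculus applies at 0 too. *)
Lemma primitive_shift f (M x : R) : continuous f -> M < 0 -> M <= x ->
  primitive f x = \int[mu]_(t in `[M, x]) f t - \int[mu]_(t in `[M, 0]) f t.
Proof.
move=> cf M0 Mx; have int a b := @continuous_itv_integrable f a b cf.
have oc a b : \int[mu]_(t in `]a, b]) f t = \int[mu]_(t in `[a, b]) f t.
  apply: Rintegral_itv_obnd_cbnd; apply: integrableS (int a b) => //.
  by apply: subset_itvr; rewrite bnd_simp.
rewrite /primitive; case: (leP 0 x) => x0.
  by rewrite Rintegral_itvB// ?oc// bnd_simp// ltW.
by rewrite -[RHS]opprB Rintegral_itvB// ?oc// bnd_simp// ltW.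
Qed.

Lemma is_derive_primitive f (x : R) : continuous f -> is_derive x 1 (primitive f) (f x).
Proof.
move=> cf; pose M : R := - `|x| - 1.
have Mx : M < x by rewrite /M; have := ler_norm (- x); rewrite normrN; lra.
have M0 : M < 0 by rewrite /M; have := normr_ge0 x; lra.
have [] := @continuous_FTC1_closed R f M x (x + 1) _ (continuous_itv_integrable _ _ cf) Mx (cf x).
  by rewrite ltrDl.
rewrite derive1E => d1 d2.
pose c := \int[mu]_(t in `[M, 0]) f t.
have h : is_derive x 1 ((fun y : R => \int[mu]_(t in `[M, y]) f t) - cst c) (f x).
  have h1 : is_derive x 1 (fun y : R => \int[mu]_(t in `[M, y]) f t) (f x) by split.
  by rewrite -[f x]subr0; apply: is_deriveB.
apply: near_eq_is_derive h.
near=> y; rewrite (@primitive_shift f M)//; apply/ltW; near: y.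
exact: lt_nbhsr.
Unshelve. all: by end_near. Qed.

(** The weight exp(L |t|) reproduces itself under integration and gains a factor 1/L: this is the
    weighted norm in which Picard iteration converges on the whole line. Negative times follow by
    reflection. *)
Lemma derive_exp_bound f df (C L : R) : 0 < L -> 0 <= C ->
  (forall s : R, is_derive s 1 f (df s)) -> f 0 = 0 ->
  (forall t : R, `|df t| <= C * (L * expR (L * `|t|))) ->
  forall t, `|f t| <= C * expR (L * `|t|).
Proof.
move=> L0 C0 fd f0 hf t.
have hd (s : R) : is_derive s 1 (fun s => C * expR (L * s)) (C * (L * expR (L * s))).
  by have := is_derive_expM L s => ?; apply: is_deriveZ.
have C1 : 0 <= C * expR (L * 0) by rewrite mulr_ge0 ?expR_ge0.
have pos g dg : (forall s : R, is_derive s 1 g (dg s)) -> g 0 = 0 ->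
   (forall s : R, 0 <= s -> `|dg s| <= C * (L * expR (L * s))) ->
   forall s : R, 0 <= s -> `|g s| <= C * expR (L * s).
  move=> hg g0 hle s s0.
  have := @derive_le_le g dg _ _ 0 s s0 (fun u _ => hg u) (fun u _ => hd u).
  rewrite g0 subr0 => h; apply: le_trans (h _) _.
    by move=> u /andP[u0 _]; exact: hle.
  by rewrite lerBlDr lerDl.
case: (leP 0 t) => t0.
  rewrite (ger0_norm t0); apply: (pos _ df) => //.
  by move=> s s0; rewrite (le_trans (hf s))// ger0_norm.
have t0' : 0 <= - t by lra.
rewrite (ltr0_norm t0) -[X in f X]opprK.
apply: (pos (fun s => f (- s)) (fun s => - df (- s))) => //.
- move=> s; have h1 := fd (- s).
  have h2 : is_derive s 1 (fun x : R => - x) (- 1) by exact: is_deriveNid.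
  have h3 := is_derive1_comp h1 h2.
  by apply: (is_derive_eq h3); rewrite mulrN mulr1.
- by rewrite oppr0 f0.
- by move=> s s0; rewrite normrN (le_trans (hf _))// normrN ger0_norm.
Qed.

Lemma geometric_cauchy (u : nat -> R) (C : R) :
  (forall N, `|u N.+1 - u N| <= C / 2 ^+ N) ->
  forall N, `|limn u - u N| <= C * 2 / 2 ^+ N.
Proof.
move=> hu.
have C0 : 0 <= C by have := hu 0%N; rewrite expr0 divr1; apply: le_trans.
(* The subtracted term makes the induction on M close: the difference is exactly the geometric sum
   from N to N + M. *)
have key N M : `|u (N + M)%N - u N| <= C * 2 / 2 ^+ N - C * 2 / 2 ^+ (N + M).
  elim: M => [|M IH]; first by rewrite addn0 !subrr normr0.
  have E : u (N + M.+1)%N - u N = (u (N + M).+1 - u (N + M)%N) + (u (N + M)%N - u N).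
    by rewrite addnS; lra.
  rewrite E (le_trans (ler_normD _ _))//.
  have := hu (N + M)%N; rewrite addnS.
  have -> : C * 2 / 2 ^+ (N + M).+1 = C / 2 ^+ (N + M).
    by rewrite exprS invfM mulrA mulfK.
  have : C * 2 / 2 ^+ (N + M) = C / 2 ^+ (N + M) * 2 by rewrite mulrAC.
  lra.
have key' N M : (N <= M)%N -> `|u M - u N| <= C * 2 / 2 ^+ N.
  move=> NM; rewrite -(subnKC NM) (le_trans (key _ _))// lerBlDr lerDl.
  by rewrite divr_ge0 ?mulr_ge0 ?exprn_ge0.
have cu : cvgn u.
  apply/cauchy_cvgP/cauchyP => e e0.
  have [N hN] : exists N, C * 2 / 2 ^+ N < e.
    have : (C * 2) *: ((2^-1) ^+ n) @[n --> \oo] --> (C * 2) *: (0 : R).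
      by apply: cvgZr; apply: cvg_expr; rewrite ger0_norm ?invr_ge0// invf_lt1// ltr1n.
    rewrite scaler0 => /cvgrPdist_lt /(_ e e0) [N _ /(_ N (leqnn N))] /=.
    rewrite sub0r normrN => h; exists N; apply: le_lt_trans h.
    by rewrite (le_trans _ (ler_norm _))// exprVn.
  exists (u N); exists N => // M /= NM.
  by rewrite -ball_normE /ball_ /= distrC (le_lt_trans (key' _ _ NM)).
move=> N; have h : (fun M => `|u M - u N|) @ \oo --> `|limn u - u N|.
  by apply: cvg_norm; apply: cvgB => //; exact: cvg_cst.
apply: (cvgr_to_le h); exists N => // M /= NM; exact: key'.
Qed.

Lemma small_geometric (x C : R) : (forall N, `|x| <= C / 2 ^+ N) -> x = 0.
Proof.
move=> h; apply/eqP; rewrite -normr_le0.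
have hc : C *: ((2^-1) ^+ n) @[n --> \oo] --> C *: (0 : R).
  by apply: cvgZr; apply: cvg_expr; rewrite ger0_norm ?invr_ge0// invf_lt1// ltr1n.
rewrite scaler0 in hc; apply: (cvgr_to_ge hc); apply: nearW => N.
by rewrite exprVn; exact: h.
Qed.

End OneVariable.

Section LambdaRules.
Context {R : realType} {V : normedModType R}.
Implicit Types (f g : V -> R) (x v : V).

Lemma is_derive_funD f g x v df dg : is_derive x v f df -> is_derive x v g dg ->
  is_derive x v (fun y => f y + g y) (df + dg).
Proof. exact: is_deriveD. Qed.

Lemma is_derive_funB f g x v df dg : is_derive x v f df -> is_derive x v g dg ->
  is_derive x v (fun y => f y - g y) (df - dg).
Proof. exact: is_deriveB. Qed.

Lemma is_derive_funN f x v df : is_derive x v f df ->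
  is_derive x v (fun y => - f y) (- df).
Proof. exact: is_deriveN. Qed.

Lemma is_derive_funM f g x v df dg : is_derive x v f df -> is_derive x v g dg ->
  is_derive x v (fun y => f y * g y) (df * g x + f x * dg).
Proof.
move=> hf hg; have h := @is_deriveM _ _ _ _ x v _ _ hf hg.
by apply: (is_derive_eq h); rewrite addrC /GRing.scale /= [g x * _]mulrC.
Qed.

Lemma is_derive_fun_cst (c : R) x v : is_derive x v (fun _ : V => c) 0.
Proof. exact: is_derive_cst. Qed.

Lemma is_derive_funsum (I : Type) (r : seq I) (P : pred I) (h : I -> V -> R) x v dh :
  (forall i, P i -> is_derive x v (h i) (dh i)) ->
  is_derive x v (fun y => \sum_(i <- r | P i) h i y) (\sum_(i <- r | P i) dh i).
Proof.
move=> hh; elim: r => [|i r IH].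
  rewrite big_nil; under eq_fun do rewrite big_nil; exact: is_derive_fun_cst.
rewrite big_cons; under eq_fun do rewrite big_cons.
by case: ifPn => // Pi; apply: is_derive_funD => //; exact: hh.
Qed.

End LambdaRules.

Lemma continuous_bigsum (R : realType) (T : topologicalType) (I : Type) (r : seq I)
    (P : pred I) (h : I -> T -> R) x :
  (forall i, P i -> {for x, continuous (h i)}) ->
  (fun y => \sum_(i <- r | P i) h i y) @ x --> \sum_(i <- r | P i) h i x.
Proof.
move=> hh; elim: r => [|i r IH].
  rewrite big_nil; under eq_fun do rewrite big_nil; exact: cvg_cst.
rewrite big_cons.
under eq_fun do rewrite big_cons.
by case: ifPn => // Pi; apply: cvgD => //; exact: hh.
Qed.

Lemma two_mul_le_sqr (R : realDomainType) (u v : R) : 2 * (u * v) <= u ^+ 2 + v ^+ 2.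
Proof. by have := sqr_ge0 (u - v); rewrite sqrrB -mulr_natl; lra. Qed.

(** * Linear systems: energy estimate and Picard iteration *)

Section LinearODE.
Variable R : realType.
Variables m n : nat.
Implicit Types (a : R -> 'M[R]_n) (X : R -> 'M[R]_(m, n)).

Definition linear_solution a X :=
  forall (t : R) i j, is_derive t 1 (fun s => X s i j) ((X t *m a t) i j).

(** For q the sum of the squared entries, 2 D_ij (D a)_ij is at most the sum over k of K (D_ik^2 +
    D_ij^2), in total 2 n K q, and 2 D_ij E_ij is at most D_ij^2 + E_ij^2. Hence the rate 2 n K + 1;
    as it is at least 1, the quotient e / c of [gronwall] is at most e. *)
Lemma lin_gronwall a (D E : R -> 'M[R]_(m, n)) (K del T : R) :
  0 <= T -> 0 <= K -> 0 <= del ->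
  (forall t : R, 0 <= t <= T -> forall i j,
     is_derive t 1 (fun s => D s i j) ((D t *m a t) i j + E t i j)) ->
  (forall t : R, 0 <= t <= T -> forall i j, `|a t i j| <= K) ->
  (forall t : R, 0 <= t <= T -> forall i j, `|E t i j| <= del) ->
  \sum_i \sum_j (D T i j) ^+ 2 <=
    (\sum_i \sum_j (D 0 i j) ^+ 2 + m%:R * (n%:R * del ^+ 2))
    * expR ((2 * n%:R * K + 1) * T).
Proof.
move=> T0 K0 d0 hD ha hE.
pose q t := \sum_i \sum_j (D t i j) ^+ 2.
pose dq t := \sum_i \sum_j (((D t *m a t) i j + E t i j) * D t i j
                 + D t i j * ((D t *m a t) i j + E t i j)).
pose e := m%:R * (n%:R * del ^+ 2).
pose c := 2 * n%:R * K + 1.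
have c1 : 1 <= c by rewrite /c lerDr !mulr_ge0.
have e0 : 0 <= e by rewrite /e !mulr_ge0 ?exprn_ge0.
have hq (t : R) : 0 <= t <= T -> is_derive t 1 q (dq t).
  move=> tT; apply: is_derive_funsum => i _; apply: is_derive_funsum => j _.
  have h := hD t tT i j.
  by under eq_fun do rewrite expr2; exact: is_derive_funM.
have hdq (t : R) : 0 <= t <= T -> dq t <= c * q t + e.
  move=> tT.
  have -> : e = \sum_(i < m) \sum_(j < n) del ^+ 2.
    by rewrite !big_const_ord !iter_addr_0 /e -[LHS]mulrC -mulr_natr; ring.
  rewrite /c mulrDl mul1r.
  have -> : 2 * n%:R * K * q t = \sum_i \sum_j \sum_k (K * (D t i k ^+ 2 + D t i j ^+ 2)).
    rewrite /q mulr_sumr; apply: eq_bigr => i _.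
    under [RHS]eq_bigr do (under eq_bigr do rewrite mulrDr; rewrite big_split/=).
    rewrite big_split/= [X in X + _]exchange_big/=.
    have -> : \sum_(j < n) \sum_(k < n) K * D t i j ^+ 2 = n%:R * K * \sum_j D t i j ^+ 2.
      rewrite mulr_sumr; apply: eq_bigr => j _.
      by rewrite sumr_const card_ord -mulr_natr; ring.
    by ring.
  rewrite /q -!big_split/= ler_sum// => i _.
  rewrite -!big_split/= ler_sum// => j _.
  have -> : ((D t *m a t) i j + E t i j) * D t i j + D t i j * ((D t *m a t) i j + E t i j)
     = (2 * (D t i j * (D t *m a t) i j)) + 2 * (D t i j * E t i j) by ring.
  rewrite -addrA lerD//.
    rewrite mxE mulr_sumr mulr_sumr ler_sum// => k _.
    have := ha t tT k j; move: (a t k j) (D t i k) (D t i j) => x y z xK.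
    have h1 : z * (y * x) <= K * (`|z| * `|y|).
      rewrite (le_trans (ler_norm _))// !normrM [`|y| * _]mulrC mulrCA ler_wpM2r ?mulr_ge0//.
    have h2 : 2 * (`|z| * `|y|) <= y ^+ 2 + z ^+ 2.
      by rewrite -[y ^+ 2]real_normK ?num_real// -[z ^+ 2]real_normK ?num_real// addrC two_mul_le_sqr.
    have := ler_wpM2l K0 h2; lra.
  have := hE t tT i j; move: (D t i j) (E t i j) => z y yd.
  have : y ^+ 2 <= del ^+ 2 by rewrite -[y ^+ 2]real_normK ?num_real// lerXn2r// nnegrE.
  have := two_mul_le_sqr z y; lra.
have := gronwall T0 (lt_le_trans ltr01 c1) e0 hq hdq.
move/le_trans; apply; rewrite ler_wpM2r ?expR_ge0// lerD2l.
by rewrite ler_pdivrMr ?(lt_le_trans ltr01 c1)// ler_peMr.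
Qed.

(** Starting from 0 instead of [X0] makes the first iterate the constant [X0], so that the geometric
    bound on successive differences holds from index 0 on. *)
Fixpoint picard a (X0 : 'M[R]_(m, n)) N : R -> 'M[R]_(m, n) :=
  if N is N'.+1 then
    fun t => X0 + \matrix_(i, j) primitive (fun s => (picard a X0 N' s *m a s) i j) t
  else fun=> 0.

Lemma continuous_mulmx_entry a X i j :
  (forall k l, continuous (fun t => a t k l)) ->
  (forall k l, continuous (fun t => X t k l)) ->
  continuous (fun t => (X t *m a t) i j).
Proof.
move=> ca cX t; under eq_fun do rewrite mxE.
by apply: continuous_bigsum => k _; apply: cvgM; [exact: cX|exact: ca].
Qed.

Lemma picard_continuous a (X0 : 'M[R]_(m, n)) : (forall k l, continuous (fun t => a t k l)) ->
  forall N i j, continuous (fun t => picard a X0 N t i j).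
Proof.
move=> ca; elim=> [|N IH] i j /=.
  by move=> t; under eq_fun do rewrite mxE; exact: cvg_cst.
move=> t; under eq_fun do rewrite !mxE.
apply: cvgD; first exact: cvg_cst.
apply: is_derive1_continuous; apply: is_derive_primitive.
exact: continuous_mulmx_entry.
Qed.

Lemma norm_mulmx_entry (A : 'M[R]_(m, n)) (M : 'M[R]_n) (K c : R) i j :
  (forall k l, `|M k l| <= K) -> (forall k, `|A i k| <= c) ->
  `|(A *m M) i j| <= n%:R * K * c.
Proof.
move=> hM hA; rewrite mxE (le_trans (ler_norm_sum _ _ _))//.
rewrite -mulrA mulr_natl -[X in _ *+ X]card_ord -sumr_const ler_sum// => k _.
by rewrite normrM mulrC ler_pM.
Qed.

Lemma linear_solution_exists a (X0 : 'M[R]_(m, n)) (K : R) :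
  (forall k l, continuous (fun t => a t k l)) ->
  (forall (t : R) k l, `|a t k l| <= K) ->
  exists X, X 0 = X0 /\ linear_solution a X.
Proof.
move=> ca aK'.
have [K1 K10 aK] : exists2 K1 : R, 0 <= K1 & forall (t : R) k l, `|a t k l| <= K1.
  by exists `|K| => // t k l; rewrite (le_trans (aK' _ _ _))// ler_norm.
pose c0 : R := \sum_i \sum_j `|X0 i j|.
have c00 : 0 <= c0 by rewrite sumr_ge0// => i _; rewrite sumr_ge0.
have hc0 i j : `|X0 i j| <= c0.
  rewrite /c0 (bigD1 i)//= (bigD1 j)//= -addrA lerDl addr_ge0// sumr_ge0// => k _.
  by rewrite sumr_ge0.
(* With this weight n K1 <= L / 2, so one Picard step halves the norm weighted by exp(L |t|) and the
   iteration converges for all times at once. *)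
pose L : R := 2 * (n%:R * K1) + 1.
have L0 : 0 < L by rewrite /L ltr_wpDl// !mulr_ge0.
have nL : n%:R * K1 <= L / 2 by rewrite /L; lra.
pose P := picard a X0.
have step i j (D : R -> 'M[R]_(m, n)) (C t : R) : 0 <= C ->
    (forall k, `|D t i k| <= C * expR (L * `|t|)) ->
    `|(D t *m a t) i j| <= C / 2 * (L * expR (L * `|t|)).
  move=> C0 hD; apply: le_trans (norm_mulmx_entry j (aK t) hD) _.
  have := ler_wpM2r (mulr_ge0 C0 (expR_ge0 (L * `|t|))) nL; lra.
have dP N (t : R) i j : is_derive t 1 (fun s => P N.+1 s i j) ((P N t *m a t) i j).
  rewrite /P /=; under eq_fun do rewrite !mxE.
  rewrite -[X in is_derive _ _ _ X]add0r.
  apply: (is_derive_funD (is_derive_fun_cst (X0 i j) t 1)).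
  apply: is_derive_primitive; apply: continuous_mulmx_entry => //.
  exact: picard_continuous.
have P0 N i j : P N.+1 0 i j = X0 i j by rewrite /P /= !mxE primitive0 addr0.
have diffP N (t : R) i j : `|P N.+1 t i j - P N t i j| <= c0 * expR (L * `|t|) / 2 ^+ N.
  elim: N t i j => [|N IH] t i j.
    have h : `|P 1%N t i j - X0 i j| <= 0 * expR (L * `|t|).
      apply: (@derive_exp_bound _ (fun s => P 1%N s i j - X0 i j) (fun=> 0)) => //.
      - move=> s; apply: (is_derive_eq (is_derive_funB (dP 0%N s i j) (is_derive_fun_cst (X0 i j) s 1))).
        by rewrite /P /= mul0mx mxE subr0.
      - by rewrite P0 subrr.
      - by move=> s; rewrite normr0 mul0r.
    move: h; rewrite mul0r normr_le0 subr_eq0 => /eqP ->.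
    rewrite /P /= mxE subr0 expr0 divr1 (le_trans (hc0 _ _))// ler_peMr// -expR0 ler_expR.
    by rewrite mulr_ge0// ltW.
  rewrite mulrAC.
  apply: (@derive_exp_bound _ (fun s => P N.+2 s i j - P N.+1 s i j)
     (fun s => ((P N.+1 s - P N s) *m a s) i j)) => //.
  - by rewrite divr_ge0// exprn_ge0.
  - by move=> s; rewrite mulmxBl !mxE; apply: (is_derive_eq (is_derive_funB (dP N.+1 s i j) (dP N s i j))); rewrite !mxE.
  - by rewrite !P0 subrr.
  - move=> s; have -> : c0 / 2 ^+ N.+1 = c0 / 2 ^+ N / 2 by rewrite exprSr invfM mulrA.
    apply: (step i j (fun s => P N.+1 s - P N s)); first by rewrite divr_ge0// exprn_ge0.
    by move=> k; rewrite mxE [X in _ + X]mxE mulrAC; exact: IH.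
pose X (t : R) : 'M[R]_(m, n) := \matrix_(i, j) limn (fun N => P N t i j).
have XP N (t : R) i j : `|X t i j - P N t i j| <= c0 * expR (L * `|t|) * 2 / 2 ^+ N.
  by rewrite mxE; apply: geometric_cauchy => M; exact: diffP.
have cX i j : continuous (fun t => X t i j).
  move=> t; apply/cvgrPdist_le => e e0.
  pose Q (s : R) := c0 * expR (L * `|s|) * 2.
  have cQ : Q s @[s --> t] --> Q t.
    apply: cvgM; last exact: cvg_cst.
    apply: cvgM; first exact: cvg_cst.
    apply: (@continuous_comp _ _ _ (fun s : R => L * `|s|) expR); last exact: continuous_expR.
    by apply: cvgM; [exact: cvg_cst|exact: norm_continuous].
  pose Q1 := Q t + 1.
  have Q0 s : 0 <= Q s by rewrite !mulr_ge0 ?expR_ge0.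
  have [N hN] : exists N, Q1 / 2 ^+ N < e / 3.
    have hc : Q1 *: ((2^-1) ^+ n) @[n --> \oo] --> Q1 *: (0 : R).
      by apply: cvgZr; apply: cvg_expr; rewrite ger0_norm ?invr_ge0// invf_lt1// ltr1n.
    rewrite scaler0 in hc; have e3 : 0 < e / 3 by rewrite divr_gt0.
    move/cvgrPdist_lt : hc => /(_ _ e3) [N _ /(_ N (leqnn N))] /=.
    rewrite sub0r normrN => h; exists N; apply: le_lt_trans h.
    by rewrite (le_trans _ (ler_norm _))// exprVn.
  have e3 : 0 < e / 3 by rewrite divr_gt0.
  have /cvgrPdist_lt/(_ _ e3) cP := @picard_continuous a X0 ca N i j t.
  have /cvgrPdist_lt/(_ _ ltr01) cQ1 := cQ.
  near=> s.
  have h1 : `|X t i j - P N t i j| < e / 3.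
    by apply: le_lt_trans hN; rewrite (le_trans (XP N t i j))// ler_wpM2r ?invr_ge0 ?exprn_ge0// /Q1 lerDl.
  have h2 : `|X s i j - P N s i j| < e / 3.
    apply: le_lt_trans hN; rewrite (le_trans (XP N s i j))// ler_wpM2r ?invr_ge0 ?exprn_ge0// /Q1.
    have : `|Q t - Q s| < 1 by near: s.
    by rewrite ltr_norml /Q => /andP[]; lra.
  have h3 : `|P N t i j - P N s i j| < e / 3 by near: s.
  have -> : X t i j - X s i j = (X t i j - P N t i j) + (P N t i j - P N s i j) - (X s i j - P N s i j) by ring.
  rewrite (le_trans (ler_normB _ _))//; have := ler_normD (X t i j - P N t i j) (P N t i j - P N s i j).
  lra.
(* [Y] is the Picard image of the limit [X] and is differentiable by construction; both lie within a
   multiple of 2^-N of the iterate [P N.+1], hence they coincide. *)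
pose Y (t : R) : 'M[R]_(m, n) := X0 + \matrix_(i, j) primitive (fun s => (X s *m a s) i j) t.
have dY (t : R) i j : is_derive t 1 (fun s => Y s i j) ((X t *m a t) i j).
  rewrite /Y; under eq_fun do rewrite !mxE.
  rewrite -[X in is_derive _ _ _ X]add0r.
  apply: (is_derive_funD (is_derive_fun_cst (X0 i j) t 1)).
  by apply: is_derive_primitive; exact: continuous_mulmx_entry.
have YP N (t : R) i j : `|Y t i j - P N.+1 t i j| <= c0 / 2 ^+ N * expR (L * `|t|).
  apply: (@derive_exp_bound _ (fun s => Y s i j - P N.+1 s i j)
     (fun s => ((X s - P N s) *m a s) i j)) => //.
  - by rewrite divr_ge0// exprn_ge0.
  - by move=> s; rewrite mulmxBl !mxE; apply: (is_derive_eq (is_derive_funB (dY s i j) (dP N s i j))); rewrite !mxE.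
  - by rewrite P0 !mxE primitive0 addr0 subrr.
  - move=> s; have -> : c0 / 2 ^+ N = (c0 * 2 / 2 ^+ N) / 2 by rewrite [c0 * 2 / _]mulrAC mulfK.
    apply: (step i j (fun s => X s - P N s)); first by rewrite divr_ge0 ?mulr_ge0// exprn_ge0.
    by move=> k; rewrite mxE [X in _ + X]mxE; have := XP N s i k; rewrite -[_ * 2 / _]mulrA mulrAC -[c0 * 2 / _]mulrA.
have XY (t : R) : Y t = X t.
  apply/matrixP => i j; apply/eqP; rewrite -subr_eq0; apply/eqP.
  apply: (@small_geometric _ _ (3 * (c0 * expR (L * `|t|)))) => N.
  have -> : Y t i j - X t i j = (Y t i j - P N.+1 t i j) - (X t i j - P N.+1 t i j) by ring.
  rewrite (le_trans (ler_normB _ _))//.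
  have h1 := YP N t i j; have h2 := XP N.+1 t i j.
  have E1 : c0 * expR (L * `|t|) * 2 / 2 ^+ N.+1 = c0 * expR (L * `|t|) / 2 ^+ N.
    by rewrite exprS invfM mulrA mulfK.
  have E2 : c0 / 2 ^+ N * expR (L * `|t|) = c0 * expR (L * `|t|) / 2 ^+ N by rewrite mulrAC.
  have : 0 <= c0 * expR (L * `|t|) / 2 ^+ N by rewrite divr_ge0 ?mulr_ge0 ?expR_ge0 ?exprn_ge0.
  move: h1 h2; rewrite E1 E2 -[3 * _ / _]mulrA; lra.
exists Y; split; last by move=> t i j; rewrite XY; exact: dY.
by apply/matrixP => i j; rewrite !mxE primitive0 addr0.
Unshelve. all: by end_near. Qed.

End LinearODE.

(** * Boxes, Borel sets and continuity *)

(** Only x is confined to [K]. The freedom of y is what later gives compactly supported functions a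
    modulus of continuity on the whole space. *)
Lemma compact_unif_continuous (R : realType) (W : normedModType R) (f : W -> R) (K : set W) :
  compact K -> continuous f -> forall e : R, 0 < e ->
  exists2 del : R, 0 < del & forall x y, K x -> `|x - y| < del -> `|f x - f y| < e.
Proof.
move=> cK cf e e0.
have /compact_near_coveringP ncK := cK.
have [|del /= del0 h] := ncK R (0^'+) (fun del x => forall y, `|x - y| < del -> `|f x - f y| < e).
- move=> x Kx.
  have e2 : 0 < e / 2 by rewrite divr_gt0.
  have /cvgrPdist_lt/(_ _ e2) /nbhs_normP [eta /= eta0 heta] := cf x.
  have eta2 : 0 < eta / 2 by rewrite divr_gt0.
  exists ([set z | `|x - z| < eta / 2], [set del | del < eta / 2]) => /=.
    split; last exact: nbhs_right_lt.
    by apply/nbhs_normP; exists (eta / 2).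
  move=> [z del] /= [xz deleta] y zy.
  have h1 : `|f x - f z| < e / 2 by apply: heta; rewrite /ball_ /= (lt_le_trans xz)//; lra.
  have h2 : `|f x - f y| < e / 2.
    apply: heta; rewrite /ball_ /= -(subrKA z) (le_lt_trans (ler_normD _ _))//; lra.
  have -> : f z - f y = (f x - f y) - (f x - f z) by ring.
  rewrite (le_lt_trans (ler_normB _ _))//; lra.
- have := h (del / 2); rewrite /ball_ /= sub0r normrN ger0_norm ?divr_ge0 ?ltW//.
  have -> : del / 2 < del by lra.
  have d2 : 0 < del / 2 by rewrite divr_gt0.
  move=> /(_ isT d2) hh; exists (del / 2) => // x y Kx; exact: hh.
Qed.

Section ContinuousCombinators.
Context {R : realType} {T : topologicalType}.
Implicit Types f g : T -> R.

Lemma cont_cst (c : R) : continuous (fun _ : T => c).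
Proof. by move=> x; exact: cvg_cst. Qed.

Lemma cont_add f g : continuous f -> continuous g -> continuous (fun x => f x + g x).
Proof. by move=> cf cg x; apply: cvgD; [exact: cf|exact: cg]. Qed.

Lemma cont_opp f : continuous f -> continuous (fun x => - f x).
Proof. by move=> cf x; apply: cvgN; exact: cf. Qed.

Lemma cont_sub f g : continuous f -> continuous g -> continuous (fun x => f x - g x).
Proof. by move=> cf cg x; apply: cvgB; [exact: cf|exact: cg]. Qed.

Lemma cont_mul f g : continuous f -> continuous g -> continuous (fun x => f x * g x).
Proof. by move=> cf cg x; apply: cvgM; [exact: cf|exact: cg]. Qed.

Lemma cont_max f g : continuous f -> continuous g -> continuous (fun x => Num.max (f x) (g x)).
Proof. by move=> cf cg x; apply: continuous_max; [exact: cf|exact: cg]. Qed.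

Lemma cont_min f g : continuous f -> continuous g -> continuous (fun x => Num.min (f x) (g x)).
Proof. by move=> cf cg x; apply: continuous_min; [exact: cf|exact: cg]. Qed.

Lemma cont_sum (J : Type) (s : seq J) (P : pred J) (h : J -> T -> R) :
  (forall i, P i -> continuous (h i)) -> continuous (fun x => \sum_(i <- s | P i) h i x).
Proof. by move=> ch x; apply: continuous_bigsum => i /ch; apply. Qed.

Lemma cont_comp (U W : topologicalType) (f : U -> T) (g : T -> W) :
  continuous f -> continuous g -> continuous (fun x => g (f x)).
Proof. by move=> cf cg x; apply: continuous_comp; [exact: cf|exact: cg]. Qed.

Lemma cont_pair (U W : topologicalType) (f : T -> U) (g : T -> W) :
  continuous f -> continuous g -> continuous (fun x => (f x, g x)).
Proof. by move=> cf cg x; apply: cvg_pair; [exact: cf|exact: cg]. Qed.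

Lemma cont_addv (W : normedModType R) (f g : T -> W) :
  continuous f -> continuous g -> continuous (fun x => f x + g x).
Proof. by move=> cf cg x; apply: cvgD; [exact: cf|exact: cg]. Qed.

Lemma cont_subv (W : normedModType R) (f g : T -> W) :
  continuous f -> continuous g -> continuous (fun x => f x - g x).
Proof. by move=> cf cg x; apply: cvgB; [exact: cf|exact: cg]. Qed.

Lemma cont_scalev (W : normedModType R) (k : T -> R) (f : T -> W) :
  continuous k -> continuous f -> continuous (fun x => k x *: f x).
Proof. by move=> ck cf x; apply: cvgZ; [exact: ck|exact: cf]. Qed.

Lemma cont_cstv (W : topologicalType) (c : W) : continuous (fun _ : T => c).
Proof. by move=> x; exact: cvg_cst. Qed.

Lemma cont_id : continuous (fun x : T => x).
Proof. by move=> x; exact: cvg_id. Qed.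

End ContinuousCombinators.

Lemma cont_eps (R : realType) (W : normedModType R) (f : W -> R) :
  (forall x (e : R), 0 < e -> exists2 del : R, 0 < del & forall y, `|x - y| < del -> `|f x - f y| <= e) ->
  continuous f.
Proof.
move=> h x; apply/cvgrPdist_le => e e0; have [del del0 hd] := h x e e0.
by apply/nbhs_normP; exists del => // y; exact: hd.
Qed.

Section RowNorm.
Context {R : realType} {d : nat}.
Implicit Types x y : 'rV[R]_d.

Lemma row_norm_le x (e : R) : 0 <= e -> (`|x| <= e) = [forall i, `|x ord0 i| <= e].
Proof.
move=> e0; rewrite [X in X <= _]/Num.norm /= mx_normrE.
apply/idP/forallP => [/bigmax_leP [_ h] i|h]; first exact: (h (ord0, i)).
by apply/bigmax_leP; split => // -[i j] _ /=; rewrite (ord1 i).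
Qed.

Lemma row_norm_lt x (e : R) : 0 < e -> (`|x| < e) = [forall i, `|x ord0 i| < e].
Proof.
move=> e0; rewrite [X in X < _]/Num.norm /= mx_normrE.
apply/idP/forallP => [/bigmax_ltP [_ h] i|h]; first exact: (h (ord0, i)).
by apply/bigmax_ltP; split => // -[i j] _ /=; rewrite (ord1 i).
Qed.

Lemma coord_le_norm x i : `|x ord0 i| <= `|x|.
Proof. by have := row_norm_le x (normr_ge0 x); rewrite lexx => /esym/forallP. Qed.

Lemma compact_closed_ball (p : 'rV[R]_d) (r : R) : compact [set x | `|x - p| <= r].
Proof.
apply: bounded_closed_compact.
  exists (`|p| + r); split; first exact: num_real.
  move=> M hM x /= hx; have := ler_normD (x - p) p; rewrite subrK; lra.
have -> : [set x | `|x - p| <= r] = (fun x => `|x - p|) @^-1` [set y | y <= r] by [].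
apply: preimage_closed; last exact: closed_le.
move=> x _; apply: continuous_comp; last exact: norm_continuous.
exact: (cvgB (@cvg_id _ _) (cvg_cst _)).
Qed.

End RowNorm.

Section Boxes.
Context {R : realType} {d : nat}.
Local Notation V := 'rV[R]_d.
Local Notation Rdd := (Rd R d).
Implicit Types (a b x : V) (U : set V).

Lemma closed_box a b : closed (box a b).
Proof.
have -> : box a b = \bigcap_i [set x | a ord0 i <= x ord0 i <= b ord0 i].
  by apply/seteqP; split => x /= h i; [move=> _; exact: h|exact: h].
apply: closed_bigI => i _.
apply: (@preimage_closed V R (fun x => x ord0 i) [set` `[a ord0 i, b ord0 i]]).
  by move=> x _; exact: coord_continuous.
exact: itv_closed.
Qed.

Lemma measurable_open U : open U -> measurable (U : set Rdd).
Proof. by move=> oU; exact: sub_sigma_algebra. Qed.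

Lemma measurable_closed U : closed U -> measurable (U : set Rdd).
Proof.
move=> cU; rewrite -[U]setCK; apply: measurableC; apply: measurable_open.
exact: closed_openC.
Qed.

Lemma measurable_box a b : measurable (box a b : set Rdd).
Proof. by apply: measurable_closed; exact: closed_box. Qed.

(** An enumeration of the boxes with rational corners, empty at indices that code no pair. It serves
    as a countable base, for the Borel sets and for statements that hold almost everywhere. *)
Definition rational_box (k : nat) : set V :=
  if unpickle k is Some (p, q) then
    box (map_mx ratr (p : 'rV[rat]_d)) (map_mx ratr (q : 'rV[rat]_d)) else set0.

Lemma rational_boxP k : rational_box k = set0 \/ exists a b, rational_box k = box a b.
Proof.
by rewrite /rational_box; case: unpickle => [[p q]|]; [right; do 2 eexists|left].
Qed.

Lemma measurable_rational_box k : measurable (rational_box k : set Rdd).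
Proof.
have [->//|[a [b ->]]] := rational_boxP k; exact: measurable_box.
Qed.

Lemma rational_box_nbhs x (e : R) : 0 < e ->
  exists k, rational_box k x /\ forall y, rational_box k y -> `|x - y| < e.
Proof.
move=> e0.
have hp i : {q : rat | ratr q \in `]x ord0 i - e / 2, x ord0 i[}.
  by apply/cid; apply: rat_in_itvoo; lra.
have hq i : {q : rat | ratr q \in `]x ord0 i, x ord0 i + e / 2[}.
  by apply/cid; apply: rat_in_itvoo; lra.
pose p : 'rV[rat]_d := \row_i sval (hp i).
pose q : 'rV[rat]_d := \row_i sval (hq i).
exists (pickle (p, q)); rewrite /rational_box pickleK; split => [i|y hy].
  rewrite !mxE; have := svalP (hp i); have := svalP (hq i); rewrite !in_itv /=; lra.
rewrite row_norm_lt//; apply/forallP => i; have := hy i; rewrite !mxE.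
have := svalP (hp i); have := svalP (hq i); rewrite !in_itv /= ltr_norml; lra.
Qed.

Lemma open_rational_boxes U : open U ->
  U = \bigcup_(k in [set k | rational_box k `<=` U]) rational_box k.
Proof.
move=> oU; apply/seteqP; split => [x Ux|x [k /= kU kx]]; last exact: kU.
have /nbhs_normP [e /= e0 he] : nbhs x U by apply: open_nbhs_nbhs.
have [k [kx hk]] := rational_box_nbhs x e0.
by exists k => //= y /hk; exact: he.
Qed.

Lemma box_setI a b a' b' :
  box a b `&` box a' b' = box (\row_i Num.max (a ord0 i) (a' ord0 i))
                              (\row_i Num.min (b ord0 i) (b' ord0 i)).
Proof.
apply/seteqP; split => x.
  by move=> [h h'] i; rewrite !mxE ge_max le_min; have /andP[-> ->] := h i; have /andP[-> ->] := h' i.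
move=> h; split => i; have := h i; rewrite !mxE ge_max le_min.
  by move=> /andP[/andP[-> _] /andP[-> _]].
by move=> /andP[/andP[_ ->] /andP[_ ->]].
Qed.

Definition boxes : set (set Rdd) := [set A | exists a b, A = box a b].

Lemma measurable_boxes : @measurable _ Rdd = <<s boxes >>.
Proof.
apply/seteqP; split; last first.
  apply: smallest_sub; first exact: sigma_algebra_measurable.
  by move=> _ [a [b ->]]; exact: measurable_box.
apply: smallest_sub; first exact: smallest_sigma_algebra.
move=> U /= oU; rewrite (open_rational_boxes oU).
pose GT : sigmaRingType boxes.-sigma := g_sigma_algebraType boxes.
apply: (@bigcup_measurable _ GT) => k _.
have [->|[a [b E]]] := rational_boxP k; first exact: (@measurable0 _ GT).
by rewrite E; apply: sub_sigma_algebra; exists a, b.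
Qed.

Lemma setI_closed_boxes : setI_closed boxes.
Proof. by move=> _ _ [a [b ->]] [a' [b' ->]]; rewrite box_setI; do 2 eexists. Qed.

Definition nat_box (k : nat) : set V := box (const_mx (- k%:R)) (const_mx k%:R).

Lemma nat_box_mem x k : `|x| <= k%:R -> nat_box k x.
Proof. by move=> xk i; rewrite !mxE -ler_norml (le_trans (coord_le_norm x i)). Qed.

Lemma bigcup_nat_box : \bigcup_k (nat_box k) = setT.
Proof.
apply/seteqP; split => // x _; exists (Num.bound `|x|) => //.
by apply: nat_box_mem; rewrite ltW// archi_boundP.
Qed.

(** Boxes are stable under intersection, generate the Borel sets, and the boxes [nat_box] of finite
    measure exhaust the space. *)
Lemma box_measure_unique (m1 m2 : {measure set Rdd -> \bar R}) :
  (forall a b, m1 (box a b) = m2 (box a b)) ->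
  (forall a b, (m1 (box a b) < +oo)%E) ->
  forall A, measurable A -> m1 A = m2 A.
Proof.
move=> m12 m1oo; apply: (@measure_unique _ _ _ boxes nat_box).
- exact: measurable_boxes.
- exact: setI_closed_boxes.
- by move=> k; do 2 eexists.
- exact: bigcup_nat_box.
- by move=> _ [a [b ->]]; exact: m12.
- by move=> k; exact: m1oo.
Qed.

Lemma measurable_cont (U : set V) (f : V -> R) : open U ->
  (forall x, U x -> {for x, continuous f}) -> measurable_fun (U : set Rdd) (f : Rdd -> R).
Proof.
move=> oU cf; apply: (measurability _ (measurable_realfun.RGenOpens.measurableE R)).
move=> _ [_ [a [b ->]] <-].
apply: measurable_open.
rewrite openE => x [Ux fx]; rewrite /interior.
apply: filterI; first by apply: open_nbhs_nbhs.
apply: (cf x Ux); apply: open_nbhs_nbhs; split => //; exact: interval_open.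
Qed.

(** Measurability refers to the product of the two Borel sigma-algebras; it holds because an open
    set of pairs is a countable union of products of rational boxes. *)
Lemma measurable_cont_pair (f : V * V -> R) : continuous f ->
  measurable_fun [set: (Rdd * Rdd)%type] (f : (Rdd * Rdd)%type -> R).
Proof.
move=> cf; apply: (measurability _ (measurable_realfun.RGenOpens.measurableE R)).
move=> _ [_ [a [b ->]] <-]; rewrite setTI.
set U := f @^-1` _.
have oU : open (U : set (V * V)%type).
  by apply: open_comp; [move=> x _; exact: cf|exact: interval_open].
have -> : U = \bigcup_k1 \bigcup_(k2 in [set k2 | rational_box k1 `*` rational_box k2 `<=` U])
   (rational_box k1 `*` rational_box k2).
  apply/seteqP; split => [x Ux|x [k1 _] [k2 /= kU kx]]; last exact: kU.
  have /nbhs_normP [e /= e0 he] : nbhs (x : V * V) U by apply: open_nbhs_nbhs.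
  have [k1 [k1x hk1]] := rational_box_nbhs x.1 e0.
  have [k2 [k2x hk2]] := rational_box_nbhs x.2 e0.
  exists k1 => //; exists k2 => //= y [/hk1 h1 /hk2 h2]; apply: he.
  by rewrite /ball_ /= /Num.norm /= gt_max h1 h2.
apply: bigcup_measurable => k1 _; apply: bigcup_measurable => k2 _.
by apply: measurableX; exact: measurable_rational_box.
Qed.

End Boxes.

(** * Integration against Lebesgue measure *)

Definition compactly_supported {R : realType} {d : nat} (f : 'rV[R]_d -> R) :=
  exists r : R, forall x, r < `|x| -> f x = 0.

Lemma compactly_supported_unif (R : realType) d (f : 'rV[R]_d -> R) :
  continuous f -> compactly_supported f -> forall e : R, 0 < e ->
  exists2 del : R, 0 < del & forall x y, `|x - y| < del -> `|f x - f y| < e.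
Proof.
move=> cf [r fr] e e0.
have [del del0 h] := compact_unif_continuous (@compact_closed_ball R d 0 (r + 1)) cf e0.
exists (Num.min del 1); first by rewrite lt_min del0 ltr01.
move=> x y; rewrite lt_min => /andP[xy1 xy2].
have [xr|xr] := leP (`|x - 0|) (r + 1); first exact: h.
rewrite subr0 in xr.
rewrite !fr ?subrr ?normr0//; last lra.
have := ler_normD (x - y) y; rewrite subrK; lra.
Qed.

Lemma compactly_supported_bounded (R : realType) d (f : 'rV[R]_d -> R) :
  continuous f -> compactly_supported f -> exists2 M : R, 0 <= M & forall x, `|f x| <= M.
Proof.
move=> cf [r fr].
have /compact_bounded [M [_ hM]] := continuous_compact (continuous_subspaceT cf) (@compact_closed_ball R d 0 r).
exists (`|M| + 1); first by rewrite addr_ge0.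
move=> x; have [xr|xr] := leP `|x| r.
  apply: (hM (`|M| + 1)); first by rewrite (le_lt_trans (ler_norm M))// ltrDl.
  by exists x => //=; rewrite subr0.
by rewrite fr// normr0 addr_ge0.
Qed.

Lemma cvg_eventually_cst (R : realType) (u : nat -> R) (l : R) (N : nat) :
  (forall n, (N <= n)%N -> u n = l) -> u @ \oo --> l.
Proof.
move=> h; apply/cvgrPdist_lt => e e0; exists N => // n /= /h ->.
by rewrite subrr normr0.
Qed.

Section SigmaFiniteMeasure.
Context (R : realType) (disp : measure_display) (T : measurableType disp).
Context (m : {measure set T -> \bar R}) (hm : sigma_finite setT m).

(** A copy of [m] that carries sigma-finiteness as a structure, the form in which Fubini's theorem
    takes it. *)
Definition sigma_measure of sigma_finite setT m : set T -> \bar R := m.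
HB.instance Definition _ := Measure.on (sigma_measure hm).
HB.instance Definition _ := Measure_isSigmaFinite.Build _ _ _ (sigma_measure hm) hm.

End SigmaFiniteMeasure.

Section LebesgueRd.
Variables (R : realType) (d : nat).
Local Notation V := 'rV[R]_d.
Local Notation Rdd := (Rd R d).
Variable lam : {measure set Rdd -> \bar R}.
Implicit Types (f g phi : V -> R).

Definition isL1 f : Prop := lam.-integrable [set: Rdd] (EFin \o (f : Rdd -> R)).
Definition intR f : R := \int[lam]_(x in [set: Rdd]) (f x).
Local Notation I := intR.
Local Notation L1 := isL1.

Lemma L1_EFin f : L1 f -> (\int[lam]_x (f x)%:E = (I f)%:E)%E.
Proof. by move=> Lf; rewrite /intR /Rintegral fineK//; exact: integrable_fin_num. Qed.

Lemma L1_measurable f : L1 f -> measurable_fun [set: Rdd] (f : Rdd -> R).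
Proof. by move=> /measurable_int /measurable_EFinP. Qed.

Lemma L1D f g : L1 f -> L1 g -> L1 (fun x => f x + g x).
Proof. by move=> Lf Lg; exact: (@integrableD _ _ _ lam setT measurableT _ _ Lf Lg). Qed.

Lemma L1Z (c : R) f : L1 f -> L1 (fun x => c * f x).
Proof. by move=> Lf; exact: (@integrableZl _ _ _ lam setT measurableT c _ Lf). Qed.

Lemma L1N f : L1 f -> L1 (fun x => - f x).
Proof. by move=> /(L1Z (-1)); under eq_fun do rewrite mulN1r. Qed.

Lemma L1B f g : L1 f -> L1 g -> L1 (fun x => f x - g x).
Proof. by move=> Lf /L1N; exact: L1D. Qed.

Lemma L1_sum (J : Type) (s : seq J) (h : J -> V -> R) :
  (forall i, L1 (h i)) -> L1 (fun x => \sum_(i <- s) h i x).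
Proof.
move=> hh; have := @integrable_sum _ _ _ lam setT measurableT J s xpredT (fun i => EFin \o h i) (fun i _ => hh i).
by apply: eq_integrable => // x _; rewrite /= sumEFin.
Qed.

Lemma L1_norm f : L1 f -> L1 (fun x => `|f x|).
Proof. by move=> Lf; exact: (integrable_norm Lf). Qed.

Lemma ID f g : L1 f -> L1 g -> I (fun x => f x + g x) = I f + I g.
Proof. by move=> Lf Lg; rewrite /intR RintegralD. Qed.

Lemma IZ (c : R) f : L1 f -> I (fun x => c * f x) = c * I f.
Proof. by move=> Lf; rewrite /intR RintegralZl. Qed.

Lemma IN f : L1 f -> I (fun x => - f x) = - I f.
Proof.
by move=> Lf; rewrite -mulN1r -IZ//; congr intR; apply/funext => x; rewrite mulN1r.
Qed.

Lemma IB f g : L1 f -> L1 g -> I (fun x => f x - g x) = I f - I g.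
Proof. by move=> Lf Lg; rewrite (ID Lf (L1N Lg)) IN. Qed.

Lemma I0 : I (fun=> 0) = 0.
Proof. by rewrite /intR /Rintegral integral0. Qed.

Lemma I_sum (J : Type) (s : seq J) (h : J -> V -> R) : (forall i, L1 (h i)) ->
  I (fun x => \sum_(i <- s) h i x) = \sum_(i <- s) I (h i).
Proof.
move=> hh; elim: s => [|i s IH].
  by rewrite big_nil; under eq_fun do rewrite big_nil; exact: I0.
rewrite big_cons -IH -ID//; last exact: L1_sum.
by congr intR; apply/funext => x; rewrite big_cons.
Qed.

Lemma I_le f g : L1 f -> L1 g -> (forall x, f x <= g x) -> I f <= I g.
Proof. by move=> Lf Lg h; apply: le_Rintegral. Qed.

Lemma I_norm_le f : L1 f -> `|I f| <= I (fun x => `|f x|).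
Proof. by move=> Lf; exact: le_normr_Rintegral. Qed.

Lemma L1_mul_bounded phi f (M : R) : measurable_fun [set: Rdd] (phi : Rdd -> R) ->
  (forall x, `|phi x| <= M) -> L1 f -> L1 (fun x => phi x * f x).
Proof.
move=> mphi hM Lf.
apply: (@integrableMr _ _ _ lam setT measurableT phi (EFin \o f)) => //.
by exists M; split; [exact: num_real|move=> M' MM' x _; apply: le_trans (hM x) _; exact: ltW].
Qed.

Lemma continuous_measurable phi : continuous phi -> measurable_fun [set: Rdd] (phi : Rdd -> R).
Proof. by move=> cphi; apply: (measurable_cont openT) => x _; exact: cphi. Qed.

Lemma I_mul_bound phi f (M : R) : continuous phi ->
  (forall x, `|phi x| <= M) -> L1 f ->
  `|I (fun x => phi x * f x)| <= M * I (fun x => `|f x|).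
Proof.
move=> /continuous_measurable mphi hM Lf.
have Lpf := L1_mul_bounded mphi hM Lf.
rewrite (le_trans (I_norm_le Lpf))// -IZ; last exact: L1_norm.
apply: I_le; [exact: L1_norm|by apply: L1Z; exact: L1_norm|].
by move=> x; rewrite normrM ler_wpM2r.
Qed.

Lemma I_dominated (phi_ : nat -> V -> R) (phi f : V -> R) (M : R) :
  L1 f -> (forall n, measurable_fun [set: Rdd] (phi_ n : Rdd -> R)) ->
  measurable_fun [set: Rdd] (phi : Rdd -> R) ->
  (forall n x, `|phi_ n x| <= M) -> (forall x, (fun n => phi_ n x) @ \oo --> phi x) ->
  (fun n => I (fun x => phi_ n x * f x)) @ \oo --> I (fun x => phi x * f x).
Proof.
move=> Lf mphi_ mphi hM hphi.
have hM' x : `|phi x| <= M.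
  have h : (fun n => `|phi_ n x|) @ \oo --> `|phi x| by apply: cvg_norm; exact: hphi.
  by apply: (cvgr_to_le h); exact: nearW.
have [|||||_ _ h] := @dominated_convergence _ _ _ lam setT measurableT
  (fun n x => (phi_ n x * f x)%:E) (fun x => (phi x * f x)%:E) (fun x => (M * `|f x|)%:E).
- by move=> n; apply/measurable_EFinP; apply: measurable_funM => //; exact: L1_measurable.
- by apply/measurable_EFinP; apply: measurable_funM => //; exact: L1_measurable.
- apply: aeW => x _; apply: cvg_EFin; first exact: nearW.
  by apply: cvgM; [exact: hphi|exact: cvg_cst].
- by apply: L1Z; exact: L1_norm.
- by apply: aeW => x n _; rewrite /= lee_fin normrM ler_wpM2r.
rewrite (L1_EFin (L1_mul_bounded mphi hM' Lf)) in h.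
have {}h : (fun n => (I (fun x => phi_ n x * f x))%:E) @ \oo --> (I (fun x => phi x * f x))%:E.
  apply: cvg_trans h; apply: near_eq_cvg; apply: nearW => n /=.
  by rewrite -(L1_EFin (L1_mul_bounded (mphi_ n) (hM n) Lf)).
by move/fine_cvgP : h => [].
Qed.

Hypothesis hlam : is_lebesgue lam.

Lemma lam_box_empty (a b : V) : ~ (forall i, a ord0 i <= b ord0 i) -> lam (box a b) = 0%E.
Proof.
move=> h; rewrite (_ : box a b = set0) ?measure0//.
apply/seteqP; split => // x hx; apply: h => i; have := hx i; lra.
Qed.

Lemma lam_box_lty (a b : V) : (lam (box a b) < +oo)%E.
Proof.
have [h|h] := pselect (forall i, a ord0 i <= b ord0 i); first by rewrite hlam// ltry.
by rewrite lam_box_empty.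
Qed.

Lemma ball_sub_box (r : R) : [set x : V | `|x| <= r] `<=` box (const_mx (- r)) (const_mx r).
Proof.
move=> x /= xr i; rewrite !mxE -ler_norml; exact: le_trans (coord_le_norm x i) xr.
Qed.

Lemma lam_bounded_lty (U : set V) (r : R) : measurable (U : set Rdd) ->
  (forall x, U x -> `|x| <= r) -> (lam U < +oo)%E.
Proof.
move=> mU hU; apply: le_lt_trans (lam_box_lty (const_mx (- r)) (const_mx r)).
apply: le_measure; rewrite ?inE//; first exact: measurable_box.
by move=> x /hU; exact: ball_sub_box.
Qed.

Lemma lam_open_gt0 (U : set V) : open U -> U !=set0 -> (0 < lam U)%E.
Proof.
move=> oU [x Ux].
have /nbhs_normP [e /= e0 he] : nbhs x U by apply: open_nbhs_nbhs.
pose a : V := x - const_mx (e / 2); pose b : V := x + const_mx (e / 2).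
have ab i : a ord0 i < b ord0 i by rewrite !mxE; lra.
have bU : box a b `<=` U.
  move=> y hy; apply: he; rewrite /ball_ /= row_norm_lt//; apply/forallP => i.
  have := hy i; rewrite !mxE ltr_norml; lra.
apply: (@lt_le_trans _ _ (lam (box a b))).
  rewrite hlam; last by move=> i; exact: ltW.
  by rewrite lte_fin prodr_gt0// => i _; rewrite subr_gt0.
by apply: le_measure; rewrite ?inE//; [exact: measurable_box|exact: measurable_open].
Qed.

Lemma L1_Cc phi : continuous phi -> compactly_supported phi -> L1 phi.
Proof.
move=> cphi sphi; have [M M0 hM] := compactly_supported_bounded cphi sphi.
have [r hr] := sphi.
pose B : set Rdd := [set x : V | `|x - 0| <= r].
have mB : measurable B.
  by apply: measurable_closed; apply: compact_closed; [exact: norm_hausdorff|exact: compact_closed_ball].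
have -> : phi = phi \_ B.
  apply/funext => x; rewrite patchE; case: ifPn => // /negP; rewrite inE /B /= subr0 => /negP.
  by rewrite -ltNge => /hr.
rewrite /isL1 -restrict_EFin; apply/(integrable_mkcond _ mB).
apply: measurable_bounded_integrable => //.
- by apply: (@lam_bounded_lty _ r) => // x; rewrite /B /= subr0.
- by apply: measurable_funS (continuous_measurable cphi).
- by exists M; split; [exact: num_real|move=> M' MM' x _; apply: le_trans (hM x) _; exact: ltW].
Qed.

Lemma measurable_shift (h : V) : measurable_fun [set: Rdd] (fun x : Rdd => (x + h : V) : Rdd).
Proof.
apply: (@measurability _ _ Rdd Rdd setT _ (@open V) erefl) => // _ [U oU <-]; rewrite setTI.
apply: measurable_open; apply: open_comp => // x _.
exact: (cvgD (@cvg_id _ _) (cvg_cst _)).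
Qed.

(** The image of [lam] under a translation gives every box the same volume as [lam], so both
    measures agree. *)
Lemma lam_shift (h : V) (A : set Rdd) : measurable A ->
  lam ((fun x : V => x + h) @^-1` A) = lam A.
Proof.
pose m0 : {measure set Rdd -> \bar R} := pushforward lam (fun x : Rdd => (x + h : V) : Rdd).
pose m1 := m0 (measurable_shift h).
have E (a b : V) : m1 (box a b) = lam (box (a - h) (b - h)).
  rewrite /m1 /= /pushforward; congr (lam _); apply/seteqP; split => x hx i; have := hx i.
    by rewrite /= !mxE; lra.
  by rewrite /= !mxE; lra.
move=> mA; apply: (@box_measure_unique _ _ m1 lam) => // a b; rewrite E.
  have [ab|ab] := pselect (forall i, a ord0 i <= b ord0 i).
    rewrite !hlam//; last by move=> i; rewrite !mxE lerD2r.
    by congr (_%:E); apply: eq_bigr => i _; rewrite !mxE; ring.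
  by rewrite !lam_box_empty// => ab'; apply: ab => i; have := ab' i; rewrite !mxE lerD2r.
exact: lam_box_lty.
Qed.

Lemma ge0_integral_shift (h : V) (f : Rdd -> \bar R) : measurable_fun setT f ->
  (forall x, 0 <= f x)%E -> (\int[lam]_x f ((x + h)%R : V) = \int[lam]_x f x)%E.
Proof.
move=> mf f0.
have := @ge0_integral_pushforward _ _ Rdd Rdd R _ (measurable_shift h) lam setT f measurableT mf (fun x _ => f0 x).
rewrite preimage_setT => <-; apply: eq_measure_integral => [|? A mA _]; first exact: measurable_shift.
by rewrite -[RHS](lam_shift h mA).
Qed.

Lemma L1_shift (h : V) f : L1 f -> L1 (fun x => f (x + h)).
Proof.
move=> Lf; have /integrableP [mf foo] := Lf; apply/integrableP; split.
  apply/measurable_EFinP; apply: (measurableT_comp (L1_measurable Lf)).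
  exact: measurable_shift.
apply: le_lt_trans foo; rewrite -(@ge0_integral_shift h (fun x => `|(f x)%:E|%E))//.
exact: measurableT_comp.
Qed.

Lemma I_shift (h : V) f : L1 f -> I (fun x => f (x + h)) = I f.
Proof.
move=> Lf; rewrite /intR /Rintegral; congr fine.
have := @integral_pushforward _ _ Rdd Rdd R _ (measurable_shift h) lam setT (EFin \o f)
  (measurable_int _ Lf) (L1_shift h Lf) measurableT.
rewrite preimage_setT => <-; apply: eq_measure_integral => [|? A mA _]; first exact: measurable_shift.
by rewrite -[RHS](lam_shift h mA).
Qed.

Lemma sigma_finite_lam : sigma_finite setT lam.
Proof.
exists (@nat_box R d); first by rewrite bigcup_nat_box.
by move=> k; split; [exact: measurable_box|exact: lam_box_lty].
Qed.

Lemma I_fubini (K : V * V -> R) f (M r : R) : continuous K ->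
  (forall y, `|K y| <= M) -> (forall y h, r < `|h| -> K (y, h) = 0) -> L1 f ->
  I (fun y => I (fun h => K (y, h)) * f y) = I (fun h => I (fun y => K (y, h) * f y)).
Proof.
move=> cK KM K0 Lf.
pose lamS : {sigma_finite_measure set Rdd -> \bar R} := sigma_measure sigma_finite_lam.
have M0 : 0 <= M by apply: le_trans (KM (0, 0)).
have cKh y : continuous (fun h => K (y, h)).
  by apply: cont_comp cK; apply: cont_pair; [exact: cont_cstv|exact: cont_id].
have cKy h : continuous (fun y => K (y, h)).
  by apply: cont_comp cK; apply: cont_pair; [exact: cont_id|exact: cont_cstv].
have LK y : L1 (fun h => K (y, h)) by apply: L1_Cc => //; exists r => h; exact: K0.
have LKf h : L1 (fun y => K (y, h) * f y).
  by apply: (@L1_mul_bounded _ _ M) => //; apply: continuous_measurable.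
(* A continuous integrable function of h alone that dominates |K(y, h)| for all y; [kap h] times |f
   y| then gives integrability on the product. *)
pose kap (h : V) := M * Num.max 0 (Num.min 1 (r + 1 - `|h|)).
have Lkap : L1 kap.
  apply: L1_Cc.
    apply: cont_mul; first exact: cont_cst.
    apply: cont_max; first exact: cont_cst.
    apply: cont_min; first exact: cont_cst.
    by apply: cont_sub; [exact: cont_cst|exact: norm_continuous].
  exists (r + 1) => h hr; rewrite /kap max_l ?mulr0//.
  by rewrite ge_min; apply/orP; right; lra.
have Kkap y h : `|K (y, h)| <= kap h.
  have [hr|hr] := leP `|h| r; last by rewrite K0// normr0 mulr_ge0// le_max lexx.
  rewrite (le_trans (KM _))// /kap ler_peMr// le_max le_min lexx /=; apply/orP; right; lra.
have mF : measurable_fun [set: (Rdd * Rdd)%type] (fun p : Rdd * Rdd => (K p * f p.1)%:E).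
  apply/measurable_EFinP; apply: measurable_funM; first exact: measurable_cont_pair.
  by apply: (measurableT_comp (L1_measurable Lf)); exact: measurable_fst.
have iF : (lamS \x lamS)%E.-integrable [set: (Rdd * Rdd)%type] (fun p : Rdd * Rdd => (K p * f p.1)%:E).
  apply/(integrable12ltyP lamS lamS mF).
  apply: (@le_lt_trans _ _ (\int[lam]_x (I kap * `|f x|)%:E)%E).
    apply: ge0_le_integral => //.
    - by move=> x _; exact: integral_ge0.
    - apply: (@measurable_fun_fubini_tonelli_F _ _ Rdd Rdd R lamS (fun p : Rdd * Rdd => `|(K p * f p.1)%:E|%E)) => //.
      exact: measurableT_comp.
    - by apply/measurable_EFinP; apply: L1_measurable; apply: L1Z; exact: L1_norm.
    - move=> y _.
      have LKf' : L1 (fun h => `|f y| * `|K (y, h)|) by apply: L1Z; exact: L1_norm.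
      under eq_integral do rewrite /= normrM mulrC.
      rewrite (L1_EFin LKf') lee_fin IZ; last exact: L1_norm.
      by rewrite mulrC ler_wpM2r//; apply: I_le => //; exact: L1_norm.
  have LL : L1 (fun x => I kap * `|f x|) by apply: L1Z; exact: L1_norm.
  by rewrite (L1_EFin LL) ltry.
have := Fubini iF => /=.
have E1 y : (\int[lam]_h (K (y, h) * f y)%:E = (I (fun h => K (y, h)) * f y)%:E)%E.
  have LKf' : L1 (fun h => f y * K (y, h)) by exact: L1Z.
  under eq_integral do rewrite mulrC.
  by rewrite (L1_EFin LKf') IZ// mulrC.
have E2 h : (\int[lam]_y (K (y, h) * f y)%:E = (I (fun y => K (y, h) * f y))%:E)%E.
  by rewrite (L1_EFin (LKf h)).
under eq_integral do rewrite E1.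
under [X in _ = X -> _]eq_integral do rewrite E2.
by move=> E; rewrite /intR /Rintegral E.
Qed.

(** Dynkin's pi-lambda argument: boxes form a pi-system, and the sets on which the integral of [g]
    vanishes form a lambda-system. That the whole space belongs to it follows by exhaustion with
    boxes. *)
Lemma I_indic_vanish g : L1 g -> (forall a b, I (fun x => \1_(box a b) x * g x) = 0) ->
  forall A : set Rdd, measurable A -> I (fun x => \1_A x * g x) = 0.
Proof.
move=> Lg h.
have b1 (A : set V) x : `|\1_A x : R| <= 1 by rewrite indicE; case: (_ \in _); rewrite ?normr1 ?normr0.
have m1 (A : set Rdd) : measurable A -> measurable_fun [set: Rdd] (\1_A : Rdd -> R) by exact: measurable_indic.
have L1i (A : set Rdd) : measurable A -> L1 (fun x => \1_A x * g x).
  by move=> mA; apply: (@L1_mul_bounded _ _ 1) => //; exact: m1.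
have hT : I (fun x => \1_(setT : set V) x * g x) = 0.
  have := @I_dominated (fun k => \1_(nat_box k)) (\1_setT) g 1 Lg.
  have -> : (fun n => I (fun x => \1_(nat_box n) x * g x)) = (fun=> 0) by apply/funext => n; exact: h.
  move=> /(_ (fun n => m1 _ (measurable_box _ _)) (m1 setT measurableT)) H; have {}H : (fun _ : nat => 0 : R) @ \oo --> I (fun x => \1_(setT : set V) x * g x); last first.
    by rewrite -(cvg_lim (@Rhausdorff R) H) lim_cst.
  apply: H => //.
  - move=> x; apply: (@cvg_eventually_cst _ _ _ (Num.bound `|x|)) => n xn; rewrite !indicE !mem_set//.
    by apply: nat_box_mem; rewrite (le_trans (ltW (archi_boundP _)))// ler_nat.
move=> A mA; have := mA; rewrite measurable_boxes; move: A {mA}.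
apply: (@dynkin_induction _ Rdd boxes (fun A => I (fun x => \1_A x * g x) = 0)
  measurable_boxes setI_closed_boxes hT).
- by move=> _ [a [b ->]]; exact: h.
- move=> S mS hS; rewrite -[RHS](subrr 0) -{1}hT -hS -IB; [|exact: L1i|exact: L1i].
  congr intR; apply/funext => x; rewrite -mulrBl; congr (_ * _).
  by rewrite !indicE in_setT in_setC; case: (_ \in _) => /=; ring.
- move=> F mF tF hF.
  have := @I_dominated (fun n x => \sum_(i < n) \1_(F i) x) (\1_(\bigcup_n F n)) g 1 Lg.
  (* By disjointness the partial sums of indicators at x are either always 0, or 0 up to the single
     index k with x in [F k] and 1 afterwards; hence they are bounded by 1 and eventually
     constant. *)
  have key (x : V) : (forall n, \sum_(i < n) (\1_(F i) x : R) = 0) /\ ~ (\bigcup_n F n) x \/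
      exists2 k, F k x & forall n, \sum_(i < n) (\1_(F i) x : R) = (k < n)%:R.
    have [[k _ Fkx]|nF] := pselect ((\bigcup_n F n) x).
      right; exists k => // n.
      have Fi i : i != k -> \1_(F i) x = 0 :> R.
        move=> ik; rewrite indicE memNset// => Fix.
        by have := tF i k Logic.I Logic.I; move=> /(_ (ex_intro _ x (conj Fix Fkx))) /eqP; exact/negP.
      case: ltnP => kn.
        rewrite (bigD1 (Ordinal kn))//= big1 ?addr0; last first.
          by move=> i /eqP ik; apply: Fi; apply/eqP => E; apply: ik; apply: val_inj.
        by rewrite indicE mem_set.
      by rewrite big1// => i _; apply: Fi; rewrite ltn_eqF// (leq_trans (ltn_ord i)).
    left; split=> // n; rewrite big1// => i _; rewrite indicE memNset// => Fix.
    by apply: nF; exists i.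
  have -> : (fun n => I (fun x => (\sum_(i < n) \1_(F i) x) * g x)) = (fun=> 0).
    apply/funext => n.
    under eq_fun do rewrite mulr_suml.
    rewrite (I_sum (index_enum _) (fun i : 'I_n => L1i _ (mF i))) big1// => i _; exact: hF.
  move=> H; have {}H : (fun _ : nat => 0 : R) @ \oo --> I (fun x => \1_(\bigcup_n F n) x * g x); last first.
    by rewrite -(cvg_lim (@Rhausdorff R) H) lim_cst.
  apply: H => //.
  - by move=> n; apply: measurable_sum => i; exact: m1.
  - by apply: m1; exact: bigcupT_measurable.
  - move=> n x; have [[-> _]|[k _ ->]] := key x; first by rewrite normr0.
    by case: ltnP => _; rewrite ?normr1 ?normr0.
  - move=> x; have [[H0 nF]|[k Fk Hk]] := key x.
      by under eq_fun do rewrite H0; rewrite indicE memNset//; exact: cvg_cst.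
    apply: (@cvg_eventually_cst _ _ _ k.+1) => n kn; rewrite Hk kn indicE mem_set//.
    by exists k.
Qed.

Lemma vanish_ae g : L1 g -> (forall a b, I (fun x => \1_(box a b) x * g x) = 0) ->
  {ae lam, forall x : Rdd, g x = 0}.
Proof.
move=> Lg h.
have := @integral_ae_eq _ Rdd R lam setT measurableT (cst 0%E) (EFin \o g) Lg (measurable_cst _).
move=> H; have {}H : ae_eq lam setT (EFin \o g) (cst 0%E).
  apply: H => E _ mE; rewrite integral0 integral_mkcond.
  have -> : ((EFin \o g) \_ E) = (fun x => (\1_E x * g x)%:E).
    apply/funext => x; rewrite patchE indicE; case: ifPn => _; [by rewrite mul1r|by rewrite mul0r].
  rewrite L1_EFin ?I_indic_vanish//.
  have mE1 : measurable_fun [set: Rdd] (\1_E : Rdd -> R) by exact: measurable_indic.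
  apply: (L1_mul_bounded (M := 1) mE1) => //.
  by move=> x; rewrite indicE; case: (_ \in _); rewrite ?normr1 ?normr0.
by apply: filterS H => x /(_ Logic.I) [].
Qed.

Lemma L1_indic (U : set V) : measurable (U : set Rdd) -> (lam U < +oo)%E -> L1 (\1_U).
Proof.
move=> mU lUoo; apply/integrableP; split; first by apply/measurable_EFinP; exact: measurable_indic.
under eq_integral do rewrite /= ger0_norm//.
by rewrite integral_indic// setIT.
Qed.

Lemma L1_restrict (D : set V) (g : V -> R) : measurable (D : set Rdd) ->
  isL1 (g \_ D) <-> lam.-integrable (D : set Rdd) (EFin \o (g : Rdd -> R)).
Proof.
move=> mD; have h := @integrable_mkcond _ Rdd R lam D (EFin \o (g : Rdd -> R)) mD.
by rewrite restrict_EFin in h; split => [|H]; [move=> H; apply/h|apply/h].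
Qed.

Lemma I_restrict (D : set V) (g : V -> R) :
  intR (g \_ D) = fine (\int[lam]_(x in (D : set Rdd)) ((g : Rdd -> R) x)%:E).
Proof.
rewrite /intR /Rintegral; congr fine.
by rewrite [RHS]integral_mkcond; apply: eq_integral => x _; rewrite /= !patchE; case: ifPn.
Qed.

Lemma I_indic (U : set V) : measurable (U : set Rdd) -> I (\1_U) = fine (lam U).
Proof.
move=> mU; rewrite /intR /Rintegral; congr fine.
by rewrite integral_indic// setIT.
Qed.

End LebesgueRd.

Global Opaque intR isL1.

(** * Directional derivatives, bump functions and mollification *)

Lemma derive_val_eq (R : realType) (V W : normedModType R) (f : V -> W) x v c :
  is_derive x v f c -> 'D_v f x = c.
Proof. by case. Qed.

Section DirectionalDerivatives.
Context {R : realType} {V : normedModType R}.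
Implicit Types (f g : V -> R) (x v : V).

(** The two difference quotients are the same function of h. This transfers one-variable results to
    lines in V. *)
Lemma is_derive_line f x v (t c : R) :
  is_derive t 1 (fun s : R => f (x + s *: v)) c <-> is_derive (x + t *: v) v f c.
Proof.
have E : (fun h : R => h^-1 *: (((fun s : R => f (x + s *: v)) \o shift t) (h *: 1) - f (x + t *: v))) =
         (fun h : R => h^-1 *: ((f \o shift (x + t *: v)) (h *: v) - f (x + t *: v))).
  apply/funext => h /=; rewrite /shift /=; congr (_ *: (f _ - _)).
  by rewrite [h *: 1]mulr1 scalerDl addrCA.
split=> -[d1 d2]; split.
- by rewrite /derivable -E.
- by rewrite -d2 /derive -E.
- by rewrite /derivable E.
- by rewrite -d2 /derive E.
Qed.

Lemma is_derive_line0 f x v (c : R) :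
  is_derive (0 : R) 1 (fun s : R => f (x + s *: v)) c <-> is_derive x v f c.
Proof. by have := is_derive_line f x v 0 c; rewrite scale0r addr0. Qed.

Lemma is_derive_quot f x v (c : R) :
  (forall e : R, 0 < e -> exists2 del : R, 0 < del & forall h : R, h != 0 -> `|h| < del ->
     `|f (h *: v + x) - f x - h * c| <= e * `|h|) -> is_derive x v f c.
Proof.
move=> H.
have C : (fun h : R => h^-1 *: ((f \o shift x) (h *: v) - f x)) @ 0^' --> c.
  apply/cvgrPdist_le => e e0; have [del del0 hd] := H e e0.
  exists del => // h /=; rewrite /ball_ /= sub0r normrN => hdel h0.
  have -> : c - h^-1 *: (f (h *: v + x) - f x) = - (h^-1 * (f (h *: v + x) - f x - h * c)).
    by rewrite /GRing.scale /= [in RHS]mulrBr mulKf//; ring.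
  rewrite normrN normrM normfV mulrC ler_pdivrMr ?normr_gt0//.
  exact: hd.
by split; [apply/cvg_ex; exists c|exact: (cvg_lim (@Rhausdorff R) C)].
Qed.

Lemma is_derive_unique f x v (c c' : R) : is_derive x v f c -> is_derive x v f c' -> c = c'.
Proof. by move=> [_ <-] [_ <-]. Qed.

Lemma line_increment f df x v (s e c : R) :
  (forall t : R, `|t| <= `|s| -> is_derive (x + t *: v) v f (df (x + t *: v))) ->
  (forall t : R, `|t| <= `|s| -> `|df (x + t *: v) - c| <= e) ->
  `|f (x + s *: v) - f x - s * c| <= `|s| * e.
Proof.
move=> hf he.
pose k := fun t : R => f (x + t *: v).
have hk (t : R) : `|t| <= `|s| -> is_derive t 1 k (df (x + t *: v)).
  by move=> ts; apply/is_derive_line; exact: hf.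
have E : f x = k 0 by rewrite /k scale0r addr0.
rewrite -/(k s) E.
have [z zs ->] : exists2 z : R, `|z| <= `|s| & k s - k 0 = df (x + z *: v) * s.
  have [s0|s0] := leP 0 s.
    have [t /andP[t0 ts]|z /andP[z0 zs] H] := MVT_derive s0 (f := k) (df := fun t => df (x + t *: v)).
      by apply: hk; rewrite !ger0_norm.
    by exists z; rewrite ?ger0_norm// H subr0.
  have [t /andP[t0 ts]|z /andP[z0 zs] H] := MVT_derive (ltW s0) (f := k) (df := fun t => df (x + t *: v)).
    by apply: hk; rewrite !ler0_norm ?lerN2// ltW.
  exists z; first by rewrite ler0_norm// ltr0_norm// lerN2.
  by rewrite -[LHS]opprB H sub0r mulrN opprK.
rewrite [s * c]mulrC -mulrBl normrM mulrC ler_wpM2l//; exact: he.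
Qed.

Lemma is_derive_near f g x v c (e : R) : 0 < e ->
  (forall y, `|x - y| < e -> f y = g y) -> is_derive x v f c -> is_derive x v g c.
Proof.
move=> e0 fg; apply: near_eq_is_derive; apply/nbhs_normP; exists e => // y; exact: fg.
Qed.

End DirectionalDerivatives.

Lemma is_derive_outside (R : realType) d (f : 'rV[R]_d -> R) df (r : R) (p v : 'rV[R]_d) :
  (forall x, is_derive x v f (df x)) -> (forall x, r < `|x - p| -> f x = 0) ->
  forall x, r < `|x - p| -> df x = 0.
Proof.
move=> hf f0 x xr; apply: (is_derive_unique (hf x)).
have h : is_derive x v (fun _ : 'rV[R]_d => 0 : R) 0 by exact: is_derive_cst.
apply: (@is_derive_near _ _ _ _ _ _ _ (`|x - p| - r) _ _ h); first by rewrite subr_gt0.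
move=> y xy; rewrite f0//.
have := ler_normD (x - y) (y - p); rewrite addrA subrK; lra.
Qed.

Lemma compactly_supported_shift (R : realType) d (f : 'rV[R]_d -> R) (p : 'rV[R]_d) (r : R) :
  (forall x, r < `|x - p| -> f x = 0) -> compactly_supported f.
Proof.
move=> h; exists (r + `|p|) => x xr; apply: h.
have := ler_normD (x - p) p; rewrite subrK; lra.
Qed.

Section ContinuousDifferentiability.
Context {R : realType} {d : nat}.
Local Notation V := 'rV[R]_d.
Implicit Types f g : V -> R.

(** Peels off the derivative taken first, whereas [iterD] exposes the one taken last; in this form
    sums and products go by induction on m. [Ck_smooth] reconciles the two. *)
Fixpoint Ck (m : nat) f : Prop :=
  continuous f /\ (forall v x, derivable f x v) /\
  (if m is m'.+1 then forall v, Ck m' ('D_v f) else True).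

Lemma Ck_continuous m f : Ck m f -> continuous f.
Proof. by case: m => [|m] []. Qed.

Lemma Ck_derivable m f v x : Ck m f -> derivable f x v.
Proof. by case: m => [|m] [_ [h _]]. Qed.

Lemma CkS m f : Ck m.+1 f -> Ck m f.
Proof.
elim: m f => [|m IH] f; first by case=> c [h _].
by move=> [c [h k]]; split => //; split => // v; apply: IH; exact: k.
Qed.

Lemma Ck_smooth f : (forall m, Ck m f) -> smooth f.
Proof.
move=> h vs; elim/last_ind: vs f h => [|vs v IH] f h.
  by split; [exact: (Ck_continuous (h 0%N))|move=> v x; apply: Ck_derivable (h 0%N)].
have -> : Defs.iterD (rcons vs v) f = Defs.iterD vs ('D_v f) by elim: vs {IH} => //= w vs ->.
by apply: IH => m; have [_ [_ /(_ v)]] := h m.+1.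
Qed.

Lemma Ck_cst m (c : R) : Ck m (fun=> c).
Proof.
elim: m c => [|m IH] c.
  by split; [exact: cont_cst|split => // v x; exact: derivable_cst].
split; first exact: cont_cst.
split; first by move=> v x; exact: derivable_cst.
move=> v; have -> : 'D_v (fun _ : V => c) = fun=> 0 by apply/funext => x; exact: derive_cst.
exact: IH.
Qed.

Lemma derive_funM f g v : (forall x, derivable f x v) -> (forall x, derivable g x v) ->
  'D_v (fun x => f x * g x) = fun x => 'D_v f x * g x + f x * 'D_v g x.
Proof.
move=> hf hg; apply/funext => x; apply: derive_val_eq.
by apply: is_derive_funM; exact: derivableP.
Qed.

Lemma CkD m f g : Ck m f -> Ck m g -> Ck m (fun x => f x + g x).
Proof.
elim: m f g => [|m IH] f g Cf Cg.
  split; first by apply: cont_add; [exact: (Ck_continuous Cf)|exact: (Ck_continuous Cg)].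
  by split => // v x; apply: derivableD; [apply: Ck_derivable Cf|apply: Ck_derivable Cg].
split; first by apply: cont_add; [exact: (Ck_continuous Cf)|exact: (Ck_continuous Cg)].
split; first by move=> v x; apply: derivableD; [apply: Ck_derivable Cf|apply: Ck_derivable Cg].
move=> v; have -> : 'D_v (fun x => f x + g x) = fun x => 'D_v f x + 'D_v g x.
  apply/funext => x; apply: derive_val_eq; apply: is_derive_funD; apply: derivableP.
    apply: Ck_derivable Cf.
  apply: Ck_derivable Cg.
by have [_ [_ Df]] := Cf; have [_ [_ Dg]] := Cg; exact: IH (Df v) (Dg v).
Qed.

Lemma CkM m f g : Ck m f -> Ck m g -> Ck m (fun x => f x * g x).
Proof.
have cM f' g' n : Ck n f' -> Ck n g' -> continuous (fun x => f' x * g' x) /\ (forall v x, derivable (fun x => f' x * g' x) x v).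
  move=> Cf Cg; split; first by apply: cont_mul; [exact: (Ck_continuous Cf)|exact: (Ck_continuous Cg)].
  by move=> v x; apply: derivableM; [apply: Ck_derivable Cf|apply: Ck_derivable Cg].
elim: m f g => [|m IH] f g Cf Cg.
  by have [c1 c2] := cM f g 0%N Cf Cg; split.
have [c1 c2] := cM f g m.+1 Cf Cg; split => //; split => // v.
rewrite derive_funM.
- have [_ [_ /(_ v) Df]] := Cf; have [_ [_ /(_ v) Dg]] := Cg.
  by apply: CkD; apply: IH => //; exact: CkS.
- by move=> x; apply: Ck_derivable Cf.
- by move=> x; apply: Ck_derivable Cg.
Qed.

Lemma Ck_prod m (J : Type) (s : seq J) (h : J -> V -> R) : (forall i, Ck m (h i)) ->
  Ck m (fun x => \prod_(i <- s) h i x).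
Proof.
move=> hh; elim: s => [|i s IH].
  by under eq_fun do rewrite big_nil; exact: Ck_cst.
by under eq_fun do rewrite big_cons; exact: CkM.
Qed.

End ContinuousDifferentiability.

(** * The flat exponential, from which bump functions are made *)

Section FlatFunction.
Variable R : realType.
Implicit Types (p : {poly R}) (t : R).

(* Products of a polynomial in 1/t with exp(-1/t), extended by 0 to t <= 0: the
   family is stable under derivation, hence consists of smooth functions. *)
Definition flat p t : R := if 0 < t then p.[t^-1] * expR (- t^-1) else 0.

(** With s = 1/t and ds/dt = - s^2, the derivative of p(s) exp(-s) in t is s^2 (p(s) - p'(s))
    exp(-s). *)
Definition flat_deriv p : {poly R} := 'X^2 * (p - p^`()).

(** Each monomial is controlled by s^i / i! <= exp s, taken at s / 2 so that half of the decay of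
    exp(-s) is left over. *)
Lemma poly_exp_bound p : exists2 C : R, 0 <= C & forall s : R, 0 <= s -> `|p.[s]| <= C * expR (s / 2).
Proof.
exists (\sum_(i < size p) `|p`_i| * (2 ^+ i * i`!%:R)).
  by rewrite sumr_ge0// => i _; rewrite !mulr_ge0// exprn_ge0.
move=> s s0; rewrite horner_coef (le_trans (ler_norm_sum _ _ _))// mulr_suml ler_sum// => i _.
rewrite normrM -mulrA ler_wpM2l// normrX ger0_norm//.
have s2 : 0 <= s / 2 by rewrite divr_ge0.
have -> : s ^+ i = 2 ^+ i * (s / 2) ^+ i by rewrite expr_div_n mulrC divfK// expf_neq0.
rewrite -mulrA ler_wpM2l ?exprn_ge0//.
case: (nat_of_ord i) => [|k].
  by rewrite expr0 fact0 mul1r (le_trans _ (expR_ge1Dx _))// lerDl.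
have h := expR_ge1Dxn k s2.
rewrite -ler_pdivrMl ?ltr0n ?fact_gt0// mulrC; apply: le_trans h.
by rewrite lerDr ler01.
Qed.

Lemma is_derive_flat p t : is_derive t 1 (flat p) (flat (flat_deriv p) t).
Proof.
have [t0|t0|t0] := ltgtP t 0.
- have h : is_derive t 1 (fun _ : R => 0 : R) 0 by exact: is_derive_cst.
  rewrite {2}/flat ltNge (ltW t0)/=.
  apply: (@is_derive_near _ _ _ _ _ _ _ (- t) _ _ h); first by rewrite oppr_gt0.
  by move=> y; rewrite ltr_norml /flat => /andP[h1 h2]; rewrite ltNge ifF//; apply/negbTE; rewrite negbK; lra.
- have tn0 : t != 0 by rewrite gt_eqF.
  have h1 : is_derive t 1 (fun y : R => y^-1) (- t ^- 2).
    have h := @is_deriveV R (fun x => x) t 1 1 tn0 (is_derive_id _ _).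
    by apply: (is_derive_eq h); rewrite /GRing.scale /= mulr1.
  have h2 : is_derive t 1 (fun y : R => p.[y^-1]) (p^`().[t^-1] * (- t ^- 2)).
    exact: (@is_derive1_comp _ (horner p) (fun y => y^-1) t _ _ (is_derive_poly _ _) h1).
  have h3 : is_derive t 1 (fun y : R => expR (- y^-1)) (expR (- t^-1) * t ^- 2).
    have h4 := is_derive_funN h1; rewrite opprK in h4.
    exact: (@is_derive1_comp _ expR (fun y => - y^-1) t _ _ (is_derive_expR _) h4).
  have h := is_derive_funM h2 h3.
  have E : p^`().[t^-1] * - t ^- 2 * expR (- t^-1) + p.[t^-1] * (expR (- t^-1) * t ^- 2) =
     flat (flat_deriv p) t.
    rewrite /flat t0 /flat_deriv hornerM hornerXn hornerD hornerN exprVn; ring.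
  rewrite E in h.
  apply: (@is_derive_near _ _ _ _ _ _ _ t _ _ h) => // y.
  by rewrite ltr_norml /flat => /andP[y1 y2]; rewrite ifT//; lra.
rewrite t0 {2}/flat ltxx.
(* The factor ['X] supplies the h by which the difference quotient divides. Half of exp(-1/h)
   absorbs the polynomial; the other half, exp(-1/(2h)) <= 2h, makes the quotient small. *)
have [C C0 hC] := poly_exp_bound ('X * p).
apply: is_derive_quot => e e0.
exists (e / (2 * C + 1)); first by rewrite divr_gt0// ltr_wpDl// mulr_ge0.
move=> h h0 he; rewrite mulr0 subr0 addr0 [h *: 1]mulr1 {2}/flat ltxx subr0 /flat.
case: ifPn => hp; last by rewrite normr0 mulr_ge0// ltW.
have hV : 0 < h^-1 by rewrite invr_gt0.
have E : p.[h^-1] = h * ('X * p).[h^-1] by rewrite hornerM hornerX mulrA mulfV// mul1r.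
rewrite E -mulrA normrM mulrC ler_wpM2r//.
rewrite normrM (ger0_norm (expR_ge0 _)).
have h1 := hC _ (ltW hV).
apply: (@le_trans _ _ (C * expR (h^-1 / 2) * expR (- h^-1))); first by rewrite ler_wpM2r// expR_ge0.
rewrite -mulrA -expRD.
have -> : h^-1 / 2 - h^-1 = - (h^-1 / 2) by lra.
have h2 : expR (- (h^-1 / 2)) <= 2 * h.
  rewrite expRN -[2 * h]invrK lef_pV2 ?posrE ?expR_gt0 ?invr_gt0 ?mulr_gt0//.
  by rewrite invfM mulrC (le_trans _ (expR_ge1Dx _))// lerDr.
apply: (@le_trans _ _ (C * (2 * h))); first by rewrite ler_wpM2l.
rewrite gtr0_norm// in he.
have : h * (2 * C + 1) < e by rewrite -ltr_pdivlMr// ltr_wpDl// mulr_ge0.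
lra.
Qed.

Lemma flat_ge0 t : 0 <= flat 1 t.
Proof. by rewrite /flat; case: ifP => // _; rewrite hornerC mul1r expR_ge0. Qed.

Lemma flat_gt0 t : 0 < t -> 0 < flat 1 t.
Proof. by move=> t0; rewrite /flat t0 hornerC mul1r expR_gt0. Qed.

Lemma flat_le0 p t : t <= 0 -> flat p t = 0.
Proof. by move=> t0; rewrite /flat ltNge t0. Qed.

Lemma Ck_flat d m p (c s : R) (i : 'I_d) : Ck m (fun x : 'rV[R]_d => flat p (c + s * x ord0 i)).
Proof.
have der q v x : is_derive x v (fun x : 'rV[R]_d => flat q (c + s * x ord0 i))
    (s * v ord0 i * flat (flat_deriv q) (c + s * x ord0 i)).
  apply/is_derive_line0.
  have h1 : is_derive (0 : R) 1 (fun t : R => c + s * (x + t *: v) ord0 i) (s * v ord0 i).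
    have -> : (fun t : R => c + s * (x + t *: v) ord0 i) =
       (fun t : R => (c + s * x ord0 i) + t * (s * v ord0 i)).
      by apply/funext => t; rewrite !mxE; ring.
    apply: (is_derive_eq (is_derive_funD (is_derive_fun_cst (c + s * x ord0 i) (0 : R) (1 : R))
       (is_derive_funM (is_derive_id (0 : R) (1 : R)) (is_derive_fun_cst (s * v ord0 i) (0 : R) (1 : R))))).
    by rewrite mulr0 addr0 add0r mul1r.
  have h2 := @is_derive1_comp _ (flat q) _ _ _ _ (is_derive_flat q _) h1.
  by apply: (is_derive_eq h2); rewrite scale0r addr0 mulrC.
have cont q : continuous (fun x : 'rV[R]_d => flat q (c + s * x ord0 i)).
  apply: (@cont_comp _ _ _ (fun x : 'rV[R]_d => c + s * x ord0 i) (flat q)).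
    apply: cont_add; first exact: cont_cst.
    by apply: cont_mul; [exact: cont_cst|exact: coord_continuous].
  by move=> t; apply: is_derive1_continuous; exact: is_derive_flat.
(* The constant k is carried along because every derivative in the direction v multiplies by s
   v_i. *)
have key (k : R) q : Ck m (fun x : 'rV[R]_d => k * flat q (c + s * x ord0 i)).
  elim: m k q => [|m IH] k q.
    split; first by apply: cont_mul; [exact: cont_cst|exact: cont].
    by split => // v x; have [] := is_derive_funM (is_derive_fun_cst k x v) (der q v x).
  split; first by apply: cont_mul; [exact: cont_cst|exact: cont].
  split; first by move=> v x; have [] := is_derive_funM (is_derive_fun_cst k x v) (der q v x).
  move=> v; have -> : 'D_v (fun x : 'rV[R]_d => k * flat q (c + s * x ord0 i)) =
     fun x => (k * (s * v ord0 i)) * flat (flat_deriv q) (c + s * x ord0 i).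
    apply/funext => x; have [_ ->] := is_derive_funM (is_derive_fun_cst k x v) (der q v x).
    by rewrite mul0r add0r mulrA.
  exact: IH.
by have := key 1 p; under eq_fun do rewrite mul1r.
Qed.

End FlatFunction.

(** * Convolution, mollification and the extension of the weak equation *)

Section Convolution.
Variables (R : realType) (d : nat).
Local Notation V := 'rV[R]_d.
Local Notation Rdd := (Rd R d).
Variable lam : {measure set Rdd -> \bar R}.
Hypothesis hlam : is_lebesgue lam.
Implicit Types (f g k phi : V -> R) (v x y z : V).
Local Notation I := (intR lam).
Local Notation L1 := (isL1 lam).

Lemma norm_sub_le_scaled (e a b s t : R) : 0 <= e -> `|s| <= e * a -> `|t| <= e * b ->
  `|s - t| <= e * (a + b + 1).
Proof.
move=> e0 sa tb; rewrite (le_trans (ler_normB _ _))// (le_trans (lerD sa tb))//.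
by rewrite -mulrDr ler_wpM2l// lerDl.
Qed.

Definition Cc f := continuous f /\ compactly_supported f.

Lemma cont_shift f y : continuous f -> continuous (fun z => f (z + y)).
Proof. by move=> cf; apply: cont_comp cf; apply: cont_addv; [exact: cont_id|exact: cont_cstv]. Qed.

Lemma Cc_bounded f : Cc f -> exists2 M : R, 0 <= M & forall x, `|f x| <= M.
Proof. by case=> cf sf; exact: compactly_supported_bounded. Qed.

Lemma L1_cont_bounded phi g (M : R) : continuous phi -> (forall x, `|phi x| <= M) -> L1 g ->
  L1 (fun z => phi z * g z).
Proof. by move=> cphi hM Lg; apply: (L1_mul_bounded (continuous_measurable cphi) hM). Qed.

Lemma L1_Cc_mul phi g : Cc phi -> L1 g -> L1 (fun z => phi z * g z).
Proof. by move=> Cphi Lg; have [M _ hM] := Cc_bounded Cphi; apply: L1_cont_bounded hM Lg; case: Cphi. Qed.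

Lemma I_mulBl phi psi g : Cc phi -> Cc psi -> L1 g ->
  I (fun z => (phi z - psi z) * g z) = I (fun z => phi z * g z) - I (fun z => psi z * g z).
Proof.
move=> h1 h2 Lg; rewrite -IB; [|exact: L1_Cc_mul|exact: L1_Cc_mul].
by congr (intR _ _); apply/funext => z; rewrite mulrBl.
Qed.

Lemma I_mulC f g : I (fun z => f z * g z) = I (fun z => g z * f z).
Proof. by congr (intR _ _); apply/funext => z; rewrite mulrC. Qed.

Lemma I_norm_ge0 g : L1 g -> 0 <= I (fun z => `|g z|).
Proof. by move=> Lg; exact: (le_trans (normr_ge0 _) (I_norm_le Lg)). Qed.

(** The sign [sg] covers both uses with one differentiation rule: -1 gives mollification by k, and 1
    gives the integral of a translate of k against g. *)
Definition convolve k g (sg : R) x : R := I (fun z => k (z + sg *: x) * g z).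

Lemma L1_conv k g y : Cc k -> L1 g -> L1 (fun z => k (z + y) * g z).
Proof.
move=> Ck Lg; have [M _ hM] := Cc_bounded Ck.
by apply: (@L1_cont_bounded _ _ M) => //; apply: cont_shift; case: Ck.
Qed.

Lemma conv_continuous k g sg : Cc k -> L1 g -> continuous (convolve k g sg).
Proof.
move=> Ck Lg; apply: cont_eps => x e e0.
pose N := I (fun z => `|g z|) + 1.
have N0 : 0 < N by rewrite ltr_wpDl// I_norm_ge0.
have eN : 0 < e / N by rewrite divr_gt0.
have [del del0 hd] := compactly_supported_unif Ck.1 Ck.2 eN.
pose s1 := `|sg| + 1.
have s10 : 0 < s1 by rewrite ltr_wpDl.
exists (del / s1); first by rewrite divr_gt0.
move=> y /= xy; rewrite -IB; [|exact: L1_conv|exact: L1_conv].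
rewrite (_ : (fun z => _) = (fun z => (k (z + sg *: x) - k (z + sg *: y)) * g z)); last first.
  by apply/funext => z; rewrite mulrBl.
apply: (@le_trans _ _ (e / N * I (fun z => `|g z|))).
  apply: I_mul_bound => //.
    by apply: cont_sub; apply: cont_shift; exact: Ck.1.
  move=> z; apply/ltW/hd; rewrite opprD addrACA subrr add0r -scalerBr normrZ.
  rewrite (@le_lt_trans _ _ (s1 * `|x - y|))//; first by rewrite ler_wpM2r// /s1 lerDl.
  by rewrite mulrC -ltr_pdivlMr.
by rewrite mulrAC ler_pdivrMr// ler_pM2l// /N lerDl.
Qed.

(** The uniform continuity of [dk] makes the difference quotients of k converge uniformly, so they
    can be integrated against the integrable g. *)
Lemma is_derive_conv k dk g sg v x : Cc k -> Cc dk -> L1 g ->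
  (forall y, is_derive y v k (dk y)) ->
  is_derive x v (convolve k g sg) (sg * convolve dk g sg x).
Proof.
move=> Ck Cdk Lg hk; apply: is_derive_quot => e e0.
pose N := I (fun z => `|g z|) + 1.
have N0 : 0 < N by rewrite ltr_wpDl// I_norm_ge0.
pose s1 := `|sg| + 1.
have s10 : 0 < s1 by rewrite ltr_wpDl.
have eN : 0 < e / (N * s1) by rewrite divr_gt0// mulr_gt0.
have [del del0 hd] := compactly_supported_unif Cdk.1 Cdk.2 eN.
pose v1 := `|v| + 1.
have v10 : 0 < v1 by rewrite ltr_wpDl.
exists (del / (s1 * v1)); first by rewrite divr_gt0// mulr_gt0.
move=> h h0 hh.
have Ldk : L1 (fun z => dk (z + sg *: x) * g z) by exact: L1_conv.
rewrite /convolve -IB; [|exact: L1_conv|exact: L1_conv].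
rewrite -[sg * I _](IZ _ Ldk) -(IZ _ (L1Z _ Ldk)) -IB; last 2 first.
- by apply: L1B; exact: L1_conv.
- by do 2 apply: L1Z.
rewrite (_ : (fun z => _) = (fun z => (k ((z + sg *: x) + (h * sg) *: v) - k (z + sg *: x)
   - (h * sg) * dk (z + sg *: x)) * g z)); last first.
  apply/funext => z; rewrite scalerDr addrA scalerA [sg * h]mulrC addrAC; ring.
apply: (@le_trans _ _ (`|h| * s1 * (e / (N * s1)) * I (fun z => `|g z|))).
  apply: I_mul_bound => //.
    apply: cont_sub; last first.
      by apply: cont_mul; [exact: cont_cst|apply: cont_shift; exact: Cdk.1].
    apply: cont_sub; last by apply: cont_shift; exact: Ck.1.
    by under eq_fun do rewrite -addrA; apply: cont_shift; exact: Ck.1.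
  move=> z; apply: (le_trans (line_increment (e := e / (N * s1)) (fun t _ => hk _) _)).
    move=> t; rewrite normrM => ht; apply/ltW/hd.
    rewrite addrAC subrr add0r normrZ.
    apply: (@le_lt_trans _ _ (`|h| * s1 * v1)).
      rewrite ler_pM// /v1 ?lerDl// (le_trans ht)// ler_wpM2l// /s1 lerDl//.
    by rewrite -mulrA -ltr_pdivlMr// mulr_gt0.
  apply: ler_wpM2r; first exact: ltW.
  by rewrite normrM ler_wpM2l// /s1 lerDl.
have -> : `|h| * s1 * (e / (N * s1)) = e * `|h| / N.
  by rewrite invfM; field; rewrite !gt_eqF.
by rewrite mulrAC ler_pdivrMr// ler_wpM2l ?mulr_ge0 ?(ltW e0)// /N lerDl.
Qed.

Lemma Cc_derive k dk v : Cc k -> continuous dk -> (forall x, is_derive x v k (dk x)) -> Cc dk.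
Proof.
move=> [ck [r hr]] cdk hk; split => //; exists r => x xr.
by apply: (is_derive_outside (p := 0) hk (r := r)) => [y|]; rewrite subr0//; exact: hr.
Qed.

Lemma smooth_derive k v x : smooth k -> is_derive x v k ('D_v k x).
Proof. by move=> sk; have [_ h] := sk [::]; apply: derivableP; exact: h. Qed.

Lemma smooth_iterD_Cc k vs : smooth k -> compactly_supported k -> Cc (Defs.iterD vs k).
Proof.
move=> sk ck; elim: vs => [|v vs IH].
  by split => //; have [] := sk [::].
have [h1 _] := sk (v :: vs); have [_ h2] := sk vs.
apply: (Cc_derive (v := v) IH h1) => x; apply: derivableP; exact: h2.
Qed.

Lemma smooth_conv k g sg : smooth k -> compactly_supported k -> L1 g -> smooth (convolve k g sg).
Proof.
move=> sk ck Lg.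
have E vs : Defs.iterD vs (convolve k g sg) = fun x => sg ^+ size vs * convolve (Defs.iterD vs k) g sg x.
  elim: vs => [|v vs IH] /=; first by apply/funext => x; rewrite expr0 mul1r.
  rewrite IH; apply/funext => x; apply: derive_val_eq.
  have H := @is_derive_conv (Defs.iterD vs k) ('D_v (Defs.iterD vs k)) g sg v x
    (smooth_iterD_Cc vs sk ck) (smooth_iterD_Cc (v :: vs) sk ck) Lg _.
  have {}H := H (fun y => derivableP ((sk vs).2 v y)).
  apply: (is_derive_eq (is_derive_funM (is_derive_fun_cst (sg ^+ size vs) x v) H)).
  by rewrite mul0r add0r exprSr mulrA.
move=> vs; split.
  rewrite E; apply: cont_mul; first exact: cont_cst.
  by apply: conv_continuous => //; exact: smooth_iterD_Cc.
move=> v x; rewrite E.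
have H := @is_derive_conv (Defs.iterD vs k) ('D_v (Defs.iterD vs k)) g sg v x
    (smooth_iterD_Cc vs sk ck) (smooth_iterD_Cc (v :: vs) sk ck) Lg _.
have {}H := H (fun y => derivableP ((sk vs).2 v y)).
by have [] := is_derive_funM (is_derive_fun_cst (sg ^+ size vs) x v) H.
Qed.

Lemma L1_Cc' f : Cc f -> L1 f.
Proof. by case=> *; exact: L1_Cc. Qed.

Lemma I_gt0 f x : Cc f -> (forall y, 0 <= f y) -> 0 < f x -> 0 < I f.
Proof.
move=> Cf f0 fx; have Lf := L1_Cc' Cf.
have [del del0 hd] := compactly_supported_unif Cf.1 Cf.2 (divr_gt0 fx (ltr0n _ 2)).
pose U : set V := [set y | `|x - y| < del].
have oU : open U.
  have -> : U = ball_ Num.norm x del by [].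
  by rewrite ball_normE; exact: ball_open.
have mU : measurable (U : set Rdd) by exact: measurable_open.
have lU : (0 < lam U)%E by apply: lam_open_gt0 => //; exists x; rewrite /U /= subrr normr0.
have lUoo : (lam U < +oo)%E.
  apply: (@lam_bounded_lty _ _ _ hlam _ (`|x| + del)) => // y /= xy.
  rewrite -[y](subKr x) (le_trans (ler_normB _ _))// lerD2l ltW//.
have LU : L1 (\1_U) by exact: L1_indic.
have Li : L1 (fun y => f x / 2 * \1_U y) by exact: L1Z.
have Ii : I (\1_U) = fine (lam U) by exact: I_indic.
apply: (@lt_le_trans _ _ (I (fun y => f x / 2 * \1_U y))).
  by rewrite IZ// Ii mulr_gt0 ?divr_gt0// fine_gt0// lU lUoo.
apply: I_le => // y; rewrite indicE; case: (boolP (y \in U)) => [|_]; last by rewrite mulr0.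
rewrite inE /U /= => /hd; rewrite mulr1 ltr_norml; lra.
Qed.

Lemma bump_exists (e : R) : 0 < e -> exists rho : V -> R,
  [/\ smooth rho, forall x, 0 <= rho x, forall x, e < `|x| -> rho x = 0 & I rho = 1].
Proof.
move=> e0.
(* The norm on row vectors is the sup norm, so a product of one-variable factors, each vanishing off
   [-e, e], vanishes outside the ball of radius e. *)
pose r0 x := \prod_(i < d) (flat 1 (e + 1 * x ord0 i) * flat 1 (e + -1 * x ord0 i)).
have r00 x : 0 <= r0 x by rewrite /r0 prodr_ge0// => i _; rewrite mulr_ge0// flat_ge0.
have r0s x : e < `|x| -> r0 x = 0.
  move=> xe; apply/eqP; rewrite /r0 prodf_seq_eq0; apply/hasP.
  have : ~~ (`|x| <= e) by rewrite -ltNge.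
  rewrite row_norm_le ?ltW// negb_forall => /existsP[i]; rewrite -ltNge => xi.
  exists i; first exact: mem_index_enum.
  rewrite mulf_eq0; have [x0|x0] := leP 0 (x ord0 i).
    by rewrite ger0_norm// in xi; rewrite [X in _ || (X == 0)]flat_le0 ?eqxx ?orbT//; lra.
  by rewrite ltr0_norm// in xi; rewrite flat_le0 ?eqxx//; lra.
have Ckr m : Ck m r0.
  by apply: Ck_prod => i; apply: CkM; exact: Ck_flat.
have Cr0 : Cc r0 by split; [exact: (Ck_continuous (Ckr 0%N))|exists e].
have I0 : 0 < I r0.
  apply: (@I_gt0 _ 0) => //; rewrite /r0 prodr_gt0// => i _.
  by rewrite mxE !mulr0 addr0 mulr_gt0// flat_gt0.
exists (fun x => (I r0)^-1 * r0 x); split.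
- by apply: Ck_smooth => m; apply: CkM => //; exact: Ck_cst.
- by move=> x; rewrite mulr_ge0// invr_ge0 ltW.
- by move=> x /r0s ->; rewrite mulr0.
- by rewrite IZ ?mulVf ?gt_eqF//; exact: L1_Cc'.
Qed.

Definition mollify (rho f : V -> R) : V -> R := convolve rho f (-1).

Section Mollify.
Variables (rho : V -> R) (e : R).
Hypotheses (srho : smooth rho) (rho0 : forall x, 0 <= rho x)
  (rhoe : forall x, e < `|x| -> rho x = 0) (Irho : I rho = 1).

Let Crho : Cc rho.
Proof. by split; [have [] := srho [::]|exists e]. Qed.

(** A translation of the integration variable moves x from the bump to f. The first form shows
    smoothness; this one shows that mollification commutes with derivatives, nearly keeps supports
    and approximates f. *)
Lemma mollifyE f : Cc f -> mollify rho f = convolve f rho 1.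
Proof.
move=> Cf; apply/funext => x; rewrite /mollify /convolve.
rewrite -(I_shift hlam x); last by apply: L1_conv => //; exact: L1_Cc'.
by congr (intR _ _); apply/funext => z; rewrite scaleN1r addrK scale1r mulrC.
Qed.

Lemma smooth_mollify f : Cc f -> smooth (mollify rho f).
Proof. by move=> Cf; apply: smooth_conv; [exact: srho|exact: Crho.2|exact: L1_Cc']. Qed.

Lemma derive_mollify f df v : Cc f -> continuous df -> (forall x, is_derive x v f (df x)) ->
  'D_v (mollify rho f) = mollify rho df.
Proof.
move=> Cf cdf hf; have Cdf := Cc_derive Cf cdf hf.
rewrite !mollifyE//; apply/funext => x; apply: derive_val_eq; rewrite -[convolve df _ _ _]mul1r.
by apply: is_derive_conv => //; exact: L1_Cc'.
Qed.

Lemma mollify_support f (p : V) (r : R) : Cc f -> (forall x, r < `|x - p| -> f x = 0) ->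
  forall x, r + e < `|x - p| -> mollify rho f x = 0.
Proof.
move=> Cf hf x xr; rewrite mollifyE// /convolve scale1r -[RHS](I0 lam); congr I.
apply/funext => z; have [ze|ze] := leP `|z| e; last by rewrite rhoe// mulr0.
rewrite hf ?mul0r//.
have := ler_normB (z + x - p) z.
have -> : z + x - p - z = x - p by rewrite addrAC [z + x]addrC addrK.
lra.
Qed.

Lemma mollify_approx f (eta : R) : Cc f ->
  (forall x y, `|x - y| <= e -> `|f x - f y| <= eta) -> forall x, `|mollify rho f x - f x| <= eta.
Proof.
move=> Cf hf x.
rewrite mollifyE// /convolve scale1r -[f x]mulr1 -Irho -(IZ _ (L1_Cc' Crho)) -IB; last 2 first.
- exact: (L1_conv x Cf (L1_Cc' Crho)).
- by apply: L1Z; exact: L1_Cc'.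
have L := L1_Cc' Crho.
have Lfr : L1 (fun z => f (z + x) * rho z - f x * rho z).
  by apply: L1B; [exact: L1_conv|exact: L1Z].
rewrite (le_trans (I_norm_le Lfr))//.
rewrite -[eta]mulr1 -Irho -IZ//; apply: I_le; [exact: L1_norm|exact: L1Z|].
move=> z; rewrite -mulrBl normrM (ger0_norm (rho0 z)).
have [ze|ze] := leP `|z| e; last by rewrite rhoe// !mulr0.
by rewrite ler_wpM2r// hf// addrK.
Qed.

End Mollify.

(* The weak equation is given for smooth test functions only; mollifying [psi] extends it to test
   functions that are C^1 in the direction [v]. *)
Lemma weak_extension (Om : set V) (f b psi dpsi : V -> R) (v p : V) (r r' : R) :
  L1 f -> L1 b ->
  (forall phi, test_fun Om phi -> I (fun x => f x * 'D_v phi x) = I (fun x => b x * phi x)) ->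
  r < r' -> (forall x, `|x - p| <= r' -> Om x) ->
  continuous psi -> continuous dpsi -> (forall x, is_derive x v psi (dpsi x)) ->
  (forall x, r < `|x - p| -> psi x = 0) ->
  I (fun x => dpsi x * f x) = I (fun x => psi x * b x).
Proof.
move=> Lf Lb hw rr' hOm cpsi cdpsi hpsi spsi.
have Cpsi : Cc psi by split => //; exact: compactly_supported_shift spsi.
have Cdpsi := Cc_derive Cpsi cdpsi hpsi.
pose N := I (fun z => `|f z|) + I (fun z => `|b z|) + 1.
have N0 : 0 < N by rewrite ltr_wpDl// addr_ge0// I_norm_ge0.
apply/eqP; rewrite -subr_eq0 -normr_le0; apply/ler_addgt0Pl => eta eta0; rewrite addr0.
have eN : 0 < eta / N by rewrite divr_gt0.
have [d1 d10 h1] := compactly_supported_unif Cpsi.1 Cpsi.2 eN.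
have [d2 d20 h2] := compactly_supported_unif Cdpsi.1 Cdpsi.2 eN.
(* Below r' - r the mollified function is still supported in Omega; below d1 and d2 both uniform
   errors are at most eta / N. *)
pose e := Num.min (r' - r) (Num.min d1 d2) / 2.
have m0 : 0 < Num.min (r' - r) (Num.min d1 d2) by rewrite !lt_min subr_gt0 rr' d10.
have e0 : 0 < e by rewrite divr_gt0.
have em : e < Num.min (r' - r) (Num.min d1 d2) by rewrite /e ltr_pdivrMr// ltr_pMr// ltr1n.
move: em; rewrite !lt_min => /and3P[er ed1 ed2].
have [rho [srho rho0 rhoe Irho]] := bump_exists e0.
pose phi := mollify rho psi.
have tphi : test_fun Om phi.
  split; first exact: (smooth_mollify srho rhoe Cpsi).
  exists [set x | `|x - p| <= r + e]; split; first exact: compact_closed_ball.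
  split; first by move=> x /= xe; apply: hOm; lra.
  move=> x /= /negP; rewrite -ltNge; exact: (mollify_support srho rhoe Cpsi spsi).
have dphi : 'D_v phi = mollify rho dpsi by exact: (derive_mollify srho rhoe Cpsi cdpsi hpsi).
have E : I (fun x => f x * mollify rho dpsi x) = I (fun x => b x * phi x).
  by rewrite -(hw _ tphi); congr (intR _ _); apply/funext => x; rewrite -dphi.
have a1 x : `|phi x - psi x| <= eta / N.
  apply: (mollify_approx srho rho0 rhoe Irho Cpsi) => y z yz; apply/ltW/h1; exact: le_lt_trans yz ed1.
have a2 x : `|mollify rho dpsi x - dpsi x| <= eta / N.
  apply: (mollify_approx srho rho0 rhoe Irho Cdpsi) => y z yz; apply/ltW/h2; exact: le_lt_trans yz ed2.
have cphi : Cc phi.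
  split; first by have [] := tphi.1 [::].
  apply: (@compactly_supported_shift _ _ _ p (r + e)) => x; exact: (mollify_support srho rhoe Cpsi spsi).
have cdphi : Cc (mollify rho dpsi).
  split; first by have [] := smooth_mollify srho rhoe Cdpsi [::].
  apply: (@compactly_supported_shift _ _ _ p (r + e)) => x.
  apply: (mollify_support srho rhoe Cdpsi); exact: is_derive_outside hpsi spsi.
have -> : I (fun x => dpsi x * f x) - I (fun x => psi x * b x) =
  I (fun x => (phi x - psi x) * b x) - I (fun x => (mollify rho dpsi x - dpsi x) * f x).
  by rewrite !I_mulBl// [I (fun x => phi x * b x)]I_mulC -E [I (fun x => f x * _)]I_mulC; ring.
have b1 := I_mul_bound (cont_sub cphi.1 Cpsi.1) a1 Lb.
have b2 := I_mul_bound (cont_sub cdphi.1 Cdpsi.1) a2 Lf.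
have -> : eta = eta / N * N by rewrite divfK// gt_eqF.
rewrite {2}/N [I (fun z => `|f z|) + _]addrC; exact: norm_sub_le_scaled (ltW eN) b1 b2.
Qed.

End Convolution.

(** * Cutoffs and the fundamental lemma *)

Section Cutoff.
Context {R : realType} {d : nat}.
Local Notation V := 'rV[R]_d.
Implicit Types (p x y : V) (r s : R).

Definition cutoff p r s x : R := Num.max 0 (Num.min 1 ((s - `|x - p|) / (s - r))).

Lemma cutoff_continuous p r s : continuous (cutoff p r s).
Proof.
apply: cont_max; first exact: cont_cst.
apply: cont_min; first exact: cont_cst.
apply: cont_mul; last exact: cont_cst.
apply: cont_sub; first exact: cont_cst.
apply: cont_comp; last exact: norm_continuous.
by apply: cont_subv; [exact: cont_id|exact: cont_cstv].
Qed.

Lemma cutoff_ge0 p r s x : 0 <= cutoff p r s x.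
Proof. by rewrite /cutoff le_max lexx. Qed.

Lemma cutoff_in p r s x : r < s -> `|x - p| <= r -> cutoff p r s x = 1.
Proof.
move=> rs xr; rewrite /cutoff min_l ?max_r//.
by rewrite ler_pdivlMr ?subr_gt0// mul1r; lra.
Qed.

Lemma cutoff_out p r s x : r < s -> s <= `|x - p| -> cutoff p r s x = 0.
Proof.
move=> rs xs; rewrite /cutoff max_l// ge_min; apply/orP; right.
by rewrite pmulr_lle0 ?invr_gt0 ?subr_gt0// subr_le0.
Qed.

Lemma cutoff_Cc p r s : r < s -> Cc (cutoff p r s).
Proof.
move=> rs; split; first exact: cutoff_continuous.
by apply: (@compactly_supported_shift _ _ _ p s) => x xs; rewrite cutoff_out// ltW.
Qed.

End Cutoff.

Lemma Cc_mull (R : realType) d (f g : 'rV[R]_d -> R) : Cc f -> continuous g -> Cc (fun x => f x * g x).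
Proof.
move=> [cf [r hr]] cg; split; first exact: cont_mul.
by exists r => x /hr ->; rewrite mul0r.
Qed.

Lemma Cc_sum (R : realType) d (J : Type) (s : seq J) (h : J -> 'rV[R]_d -> R) :
  (forall i, Cc (h i)) -> Cc (fun x => \sum_(i <- s) h i x).
Proof.
move=> hh; split; first by apply: cont_sum => i _; exact: (hh i).1.
elim: s => [|i s [r hr]]; first by exists 0 => x _; rewrite big_nil.
have [r' hr'] := (hh i).2.
exists (Num.max r r') => x; rewrite gt_max big_cons => /andP[/hr -> /hr' ->]; exact: addr0.
Qed.

Section PairCompact.
Context {R : realType} {d : nat}.
Local Notation V := 'rV[R]_d.
Variables (K : V * V -> R) (r r' : R).
Hypotheses (cK : continuous K) (K1 : forall y x, r < `|y| -> K (y, x) = 0)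
  (K2 : forall y x, r' < `|x| -> K (y, x) = 0).

Let B : set (V * V) := [set y | `|y - 0| <= r + 1] `*` [set x | `|x - 0| <= r' + 1].

Let cB : compact B.
Proof. by apply: compact_setX; exact: compact_closed_ball. Qed.

Lemma pair_bounded : exists2 M : R, 0 <= M & forall z, `|K z| <= M.
Proof.
have /compact_bounded [M [_ hM]] := continuous_compact (continuous_subspaceT cK) cB.
exists (`|M| + 1); first by rewrite addr_ge0.
move=> [y x]; have [yr|yr] := leP `|y| (r + 1); last by rewrite K1 ?normr0 ?addr_ge0//; lra.
have [xr|xr] := leP `|x| (r' + 1); last by rewrite K2 ?normr0 ?addr_ge0//; lra.
apply: (hM (`|M| + 1)); first by rewrite (le_lt_trans (ler_norm M))// ltrDl.
by exists (y, x) => //; split => /=; rewrite subr0.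
Qed.

Lemma pair_unif (e : R) : 0 < e -> exists2 del : R, 0 < del &
  forall y x x', `|x - x'| < del -> `|K (y, x) - K (y, x')| < e.
Proof.
move=> e0; have [del del0 hd] := compact_unif_continuous cB cK e0.
exists (Num.min del 1); first by rewrite lt_min del0 ltr01.
move=> y x x'; rewrite lt_min => /andP[xd x1].
have [yr|yr] := leP `|y| (r + 1); last by rewrite !K1 ?subrr ?normr0//; lra.
have [xr|xr] := leP `|x| (r' + 1); last first.
  rewrite !K2 ?subrr ?normr0//; last lra.
  have := ler_normD (x - x') x'; rewrite subrK; lra.
apply: hd; first by split => /=; rewrite subr0.
have -> : (y, x) - (y, x') = (y - y, x - x') by [].
by rewrite /Num.norm /= gt_max subrr normr0 del0.
Qed.

End PairCompact.

Section Integrals.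
Variables (R : realType) (d : nat).
Local Notation V := 'rV[R]_d.
Local Notation Rdd := (Rd R d).
Variable lam : {measure set Rdd -> \bar R}.
Hypothesis hlam : is_lebesgue lam.
Implicit Types (f g k phi : V -> R) (v x y z p : V).
Local Notation I := (intR lam).
Local Notation L1 := (isL1 lam).

(** The integral of f(z + x) over z does not depend on x, and its derivative at x = 0 is the
    integral of [df]. The constant 1 is not integrable, so [kap], equal to 1 on a neighbourhood of
    the support of f, replaces it in [convolve]. *)
Lemma I_derive0 f df v : Cc f -> continuous df -> (forall x, is_derive x v f (df x)) -> I df = 0.
Proof.
move=> Cf cdf hf; have Cdf := Cc_derive Cf cdf hf.
have [r hr] := Cf.2.
pose kap := cutoff (0 : V) (r + 1) (r + 2).
have r12 : r + 1 < r + 2 by rewrite ltrD2l ltr1n.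
have Ckap : Cc kap by exact: cutoff_Cc.
have Lkap := L1_Cc' hlam Ckap.
have E g x : (forall x, r < `|x| -> g x = 0) -> `|x| <= 1 -> convolve lam g kap 1 x = I (fun z => g (z + x)).
  move=> hg x1; congr (intR _ _); apply/funext => z; rewrite scale1r.
  have [zr|zr] := leP `|z| (r + 1).
    by rewrite /kap cutoff_in ?mulr1 ?subr0.
  rewrite hg ?mul0r//; have := ler_normB (z + x) x; rewrite addrK; lra.
have h1 := @is_derive_conv _ _ lam f df kap 1 v 0 Cf Cdf Lkap hf.
have h0 : is_derive (0 : V) v (convolve lam f kap 1) 0.
  have h : is_derive (0 : V) v (fun _ : V => I f) 0 by exact: is_derive_cst.
  apply: (@is_derive_near _ _ _ _ _ _ _ 1 _ _ h) => // y; rewrite sub0r normrN => y1.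
  by rewrite E// ?ltW// I_shift//; exact: L1_Cc'.
have := is_derive_unique h1 h0; rewrite mul1r E ?normr0//; last first.
  move=> x xr; apply: (is_derive_outside (p := 0) hf (r := r)); last by rewrite subr0.
  by move=> y; rewrite subr0; exact: hr.
by under eq_fun do rewrite addr0.
Qed.

(** For a nonempty box this is the l^1 distance to it. The formula is also continuous and positive
    off the box when the box is empty, so an intersection of boxes needs no case distinction. *)
Definition box_dist (a b x : V) : R :=
  \sum_i (Num.max 0 (a ord0 i - x ord0 i) + Num.max 0 (x ord0 i - b ord0 i)).

Lemma box_dist_ge (a b x : V) i :
  a ord0 i - box_dist a b x <= x ord0 i <= b ord0 i + box_dist a b x.
Proof.
have h j : 0 <= Num.max 0 (a ord0 j - x ord0 j) + Num.max 0 (x ord0 j - b ord0 j).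
  by rewrite addr_ge0// le_max lexx.
have H : Num.max 0 (a ord0 i - x ord0 i) + Num.max 0 (x ord0 i - b ord0 i) <= box_dist a b x.
  by rewrite /box_dist (bigD1 i)//= lerDl sumr_ge0.
have : a ord0 i - x ord0 i <= Num.max 0 (a ord0 i - x ord0 i) by rewrite le_max lexx orbT.
have : x ord0 i - b ord0 i <= Num.max 0 (x ord0 i - b ord0 i) by rewrite le_max lexx orbT.
have : 0 <= Num.max 0 (a ord0 i - x ord0 i) by rewrite le_max lexx.
have : 0 <= Num.max 0 (x ord0 i - b ord0 i) by rewrite le_max lexx.
lra.
Qed.

Lemma box_dist_ge0 (a b x : V) : 0 <= box_dist a b x.
Proof. by rewrite sumr_ge0// => i _; rewrite addr_ge0// le_max lexx. Qed.

Lemma box_dist_eq0 (a b x : V) : box a b x -> box_dist a b x = 0.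
Proof. by move=> h; rewrite /box_dist big1// => i _; rewrite !max_l ?addr0//; have := h i; lra. Qed.

Lemma box_dist_gt0 (a b x : V) : ~ box a b x -> 0 < box_dist a b x.
Proof.
move=> h; rewrite lt_neqAle box_dist_ge0 andbT; apply/eqP => E; apply: h => i.
by have := box_dist_ge a b x i; rewrite -E subr0 addr0.
Qed.

Lemma box_dist_continuous (a b : V) : continuous (box_dist a b).
Proof.
apply: cont_sum => i _; apply: cont_add; apply: cont_max; try exact: cont_cst.
  by apply: cont_sub; [exact: cont_cst|exact: coord_continuous].
by apply: cont_sub; [exact: coord_continuous|exact: cont_cst].
Qed.

Lemma closed_ball_box p r x : 0 <= r ->
  `|x - p| <= r <-> box (p - const_mx r) (p + const_mx r) x.
Proof.
move=> r0; rewrite row_norm_le//; split.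
  by move=> /forallP h i; have := h i; rewrite !mxE ler_norml; lra.
by move=> h; apply/forallP => i; have := h i; rewrite !mxE ler_norml; lra.
Qed.

(** The indicator of any box inside the closed ball of radius r is a bounded pointwise limit of
    continuous tents supported in the ball of radius r', and boxes suffice by [vanish_ae]. *)
Lemma fundamental_ae g p (r r' : R) : L1 g -> r < r' ->
  (forall phi, continuous phi -> (forall x, r' < `|x - p| -> phi x = 0) ->
    I (fun x => phi x * g x) = 0) ->
  {ae lam, forall x : Rdd, `|(x : V) - p| <= r -> g x = 0}.
Proof.
move=> Lg rr' h; have [r0|r0] := ltP r 0.
  by apply: aeW => x xr; have := normr_ge0 ((x : V) - p); lra.
pose a := p - const_mx r; pose b := p + const_mx r.
have mQ a' b' : measurable (box a' b' : set Rdd) by exact: measurable_box.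
have b1 (A : set V) x : `|\1_A x : R| <= 1.
  by rewrite indicE; case: (_ \in _); rewrite ?normr1 ?normr0.
have m1 a' b' : measurable_fun [set: Rdd] (\1_(box a' b') : Rdd -> R) by exact: measurable_indic.
pose g0 x := \1_(box a b) x * g x.
have Lg0 : L1 g0 by exact: (L1_mul_bounded (M := 1) (m1 _ _)).
have H : {ae lam, forall x : Rdd, g0 x = 0}.
  apply: vanish_ae => // a1 b1'.
  pose a2 : V := \row_i Num.max (a1 ord0 i) (a ord0 i).
  pose b2 : V := \row_i Num.min (b1' ord0 i) (b ord0 i).
  have -> : (fun x => \1_(box a1 b1') x * g0 x) = (fun x => \1_(box a2 b2) x * g x).
    by apply/funext => x; rewrite /g0 mulrA /a2 /b2 -box_setI indicI.
  (* A tent of slope at least N vanishes at distance r' - r from the box, so all [phi_ n] are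
     admissible test functions. *)
  have [N hN] : exists N : nat, (r' - r)^-1 < N%:R.
    by exists (Num.bound (r' - r)^-1); apply: archi_boundP; rewrite invr_ge0 subr_ge0 ltW.
  have N0 : (0 : R) < N%:R by apply: le_lt_trans hN; rewrite invr_ge0 subr_ge0 ltW.
  pose phi_ (n : nat) x := Num.max 0 (1 - (N + n)%:R * box_dist a2 b2 x).
  have cphi n : continuous (phi_ n).
    apply: cont_max; first exact: cont_cst.
    apply: cont_sub; first exact: cont_cst.
    by apply: cont_mul; [exact: cont_cst|exact: box_dist_continuous].
  have : (fun n => I (fun x => phi_ n x * g x)) @ \oo --> I (fun x => \1_(box a2 b2) x * g x).
    apply: (@I_dominated _ _ lam phi_ _ g 1) => //.
    - by move=> n; exact: continuous_measurable.
    - move=> n x; rewrite ger0_norm ?le_max ?lexx// ge_max ler01 /=.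
      by rewrite lerBlDr lerDl mulr_ge0// box_dist_ge0.
    - move=> x; have [xb|xb] := pselect (box a2 b2 x).
        apply: (@cvg_eventually_cst _ _ _ 0) => n _.
        by rewrite /phi_ box_dist_eq0// mulr0 subr0 indicE mem_set// max_r.
      have d0 := box_dist_gt0 xb.
      apply: (@cvg_eventually_cst _ _ _ (Num.bound (box_dist a2 b2 x)^-1)) => n hn.
      rewrite /phi_ indicE memNset// max_l// subr_le0.
      rewrite -ler_pdivrMr// mul1r (le_trans (ltW (archi_boundP _)))//; first by rewrite invr_ge0 ltW.
      by rewrite ler_nat (leq_trans hn)// leq_addl.
  have -> : (fun n => I (fun x => phi_ n x * g x)) = (fun=> 0).
    apply/funext => n; apply: h => // x xr'; rewrite /phi_ max_l// subr_le0.
    have dd : r' - r <= box_dist a2 b2 x.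
      rewrite leNgt; apply/negP => hd.
      have : `|x - p| <= r + box_dist a2 b2 x.
        rewrite row_norm_le ?addr_ge0 ?box_dist_ge0//; apply/forallP => i.
        have := box_dist_ge a2 b2 x i; rewrite !mxE ler_norml.
        have : p ord0 i - r <= Num.max (a1 ord0 i) (p ord0 i - r) by rewrite le_max lexx orbT.
        have : Num.min (b1' ord0 i) (p ord0 i + r) <= p ord0 i + r by rewrite ge_min lexx orbT.
        lra.
      lra.
    apply: (@le_trans _ _ (N%:R * (r' - r))).
      by rewrite -ler_pdivrMr ?subr_gt0// mul1r ltW.
    by rewrite ler_pM ?subr_ge0 ?(ltW rr')// ler_nat leq_addr.
  by move=> H; rewrite -(cvg_lim (@Rhausdorff R) H) lim_cst.
apply: filterS H => x H xr.
by move: H; rewrite /g0 indicE mem_set ?mul1r//; apply/closed_ball_box.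
Qed.

Lemma fundamental_pointwise q p (r : R) : continuous q -> 
  (forall phi, continuous phi -> (forall x, r < `|x - p| -> phi x = 0) ->
    I (fun x => phi x * q x) = 0) ->
  forall x, `|x - p| < r -> q x = 0.
Proof.
move=> cq h x xr.
have r0 : 0 < r by apply: le_lt_trans xr.
pose s := `|x - p|.
have sr : s < r by [].
pose phi y := cutoff p s r y * q y.
have cphi : continuous phi by apply: cont_mul => //; exact: cutoff_continuous.
have Cphi2 : Cc (fun y => phi y * q y).
  by apply: Cc_mull => //; apply: Cc_mull => //; exact: cutoff_Cc.
have E : I (fun y => phi y * q y) = 0.
  by apply: h => // y yr; rewrite /phi cutoff_out ?mul0r// ltW.
apply/eqP/negPn/negP => qx.
have : 0 < I (fun y => phi y * q y).
  apply: (@I_gt0 _ _ lam hlam _ x Cphi2).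
    by move=> y; rewrite /phi -mulrA mulr_ge0 ?cutoff_ge0// -expr2 sqr_ge0.
  by rewrite /phi cutoff_in// mul1r -expr2 exprn_even_gt0.
by rewrite E ltxx.
Qed.

End Integrals.

(** * Gauges along coordinate lines *)

Lemma finite_pos_lower (R : realType) (T : finType) (f : T -> R) : (forall i, 0 < f i) ->
  exists2 del : R, 0 < del & forall i, del <= f i.
Proof.
(* The inverse of the sum of the inverses lies below every [f i]; the summand 1 keeps it positive
   for an empty [T]. *)
move=> f0; exists ((\sum_i (f i)^-1 + 1)^-1).
  by rewrite invr_gt0 ltr_wpDl// sumr_ge0// => i _; rewrite invr_ge0 ltW.
move=> i; rewrite -[f i]invrK lef_pV2 ?posrE ?invr_gt0//; last first.
  by rewrite ltr_wpDl// sumr_ge0// => k _; rewrite invr_ge0 ltW.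
rewrite (bigD1 i)//= -addrA lerDl addr_ge0// sumr_ge0// => k _; rewrite invr_ge0 ltW//.
Qed.

Lemma sqr_div_bound (R : realFieldType) (e M S : R) : 1 <= M -> S <= M ->
  (e / M) ^+ 2 * S <= e ^+ 2.
Proof.
move=> M1 SM; have M0 : 0 < M by apply: lt_le_trans M1.
apply: (@le_trans _ _ ((e / M) ^+ 2 * M ^+ 2)); last by rewrite -exprMn divfK ?gt_eqF.
by rewrite ler_wpM2l ?sqr_ge0// (le_trans SM)// expr2 ler_peMr// ltW.
Qed.

Section LinearODEDependence.
Variable R : realType.
Variables m n : nat.
Implicit Types (a b : R -> 'M[R]_n) (X Y D E : R -> 'M[R]_(m, n)).

Lemma entry_sqr_le_sum (M : 'M[R]_(m, n)) i j : M i j ^+ 2 <= \sum_i \sum_j M i j ^+ 2.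
Proof.
rewrite (bigD1 i)//= (bigD1 j)//= -addrA lerDl addr_ge0// sumr_ge0// => k _.
  exact: sqr_ge0.
by rewrite sumr_ge0// => l _; exact: sqr_ge0.
Qed.

(** Negative times are reached by time reversal, which replaces a(t) by -a(-t) and E(t) by
    -E(-t). *)
Lemma lin_gronwall_sym a D E (K del T : R) : 0 <= K -> 0 <= del ->
  (forall (t : R) i j, is_derive t 1 (fun s => D s i j) ((D t *m a t) i j + E t i j)) ->
  (forall (t : R) i j, `|a t i j| <= K) ->
  (forall t : R, `|t| <= T -> forall i j, `|E t i j| <= del) ->
  forall t : R, `|t| <= T -> forall i j,
  (D t i j) ^+ 2 <=
    (\sum_i \sum_j (D 0 i j) ^+ 2 + m%:R * (n%:R * del ^+ 2))
    * expR ((2 * n%:R * K + 1) * T).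
Proof.
move=> K0 d0 hD ha hE t tT i j; apply: le_trans (entry_sqr_le_sum _ i j) _.
have S0 : 0 <= \sum_i \sum_j (D 0 i j) ^+ 2 + m%:R * (n%:R * del ^+ 2).
  rewrite addr_ge0 ?mulr_ge0 ?sqr_ge0// sumr_ge0// => k _.
  by rewrite sumr_ge0// => l _; exact: sqr_ge0.
have mono (s : R) : s <= T -> (\sum_i \sum_j (D 0 i j) ^+ 2 + m%:R * (n%:R * del ^+ 2))
    * expR ((2 * n%:R * K + 1) * s) <= (\sum_i \sum_j (D 0 i j) ^+ 2 + m%:R * (n%:R * del ^+ 2))
    * expR ((2 * n%:R * K + 1) * T).
  by move=> sT; rewrite ler_wpM2l// ler_expR ler_wpM2l// addr_ge0// !mulr_ge0.
have [t0|t0] := leP 0 t.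
  rewrite ger0_norm// in tT; apply: le_trans (mono _ tT).
  apply: (lin_gronwall (a := a) (E := E)) => // s /andP[s0 st].
  by apply: hE; rewrite ger0_norm// (le_trans st).
rewrite ltr0_norm// in tT; apply: le_trans (mono _ tT).
have := @lin_gronwall R m n (fun s => - a (- s)) (fun s => D (- s)) (fun s => - E (- s)) K del (- t).
rewrite opprK oppr0; apply => //.
- by rewrite oppr_ge0 ltW.
- move=> s _ k l; have h2 : is_derive s 1 (fun x : R => - x) (- 1) by exact: is_deriveNid.
  have h3 := @is_derive1_comp _ (fun s => D s k l) (fun x => - x) s _ _ (hD (- s) k l) h2.
  by apply: (is_derive_eq h3); rewrite mulmxN !mxE; ring.
- by move=> s _ k l; rewrite mxE normrN.
- move=> s /andP[s0 st] k l; rewrite mxE normrN; apply: hE.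
  by rewrite normrN ger0_norm// (le_trans st).
Qed.

Lemma linear_solution_bound a X (K T : R) : 0 <= K ->
  linear_solution a X -> (forall (t : R) i j, `|a t i j| <= K) ->
  forall t : R, `|t| <= T -> forall i j,
  `|X t i j| <= 1 + \sum_i \sum_j (X 0 i j) ^+ 2 * expR ((2 * n%:R * K + 1) * T).
Proof.
move=> K0 hX ha t tT i j.
have := @lin_gronwall_sym a X (fun=> 0) K 0 T K0 (lexx 0) _ ha _ t tT i j.
rewrite expr0n /= !mulr0 addr0 => h.
have {}h : X t i j ^+ 2 <= (\sum_i \sum_j X 0 i j ^+ 2) * expR ((2 * n%:R * K + 1) * T).
  apply: h => [s k l|s _ k l]; last by rewrite mxE normr0.
  by rewrite [X in _ + X]mxE addr0; exact: hX.
rewrite (_ : \sum_i \sum_j _ = (\sum_i \sum_j X 0 i j ^+ 2) * expR ((2 * n%:R * K + 1) * T)); last first.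
  by rewrite mulr_suml; apply: eq_bigr => k _; rewrite mulr_suml.
apply: le_trans (lerD (lexx 1) h).
have := sqr_ge0 (`|X t i j| - 1); rewrite sqrrB1 real_normK ?num_real// -mulr_natl.
have := normr_ge0 (X t i j); lra.
Qed.

(** The difference D = X - Y starts at 0 and solves D' = D a + Y (a - b), a linear equation whose
    source is at most n w C. *)
Lemma linear_solution_dep a b X Y (K C w T : R) : 0 <= K -> 0 <= C -> 0 <= w ->
  linear_solution a X -> linear_solution b Y -> X 0 = Y 0 ->
  (forall (t : R) i j, `|a t i j| <= K) ->
  (forall (t : R), `|t| <= T -> forall i j, `|Y t i j| <= C) ->
  (forall (t : R) i j, `|a t i j - b t i j| <= w) ->
  forall t : R, `|t| <= T -> forall i j,
  (X t i j - Y t i j) ^+ 2 <=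
     w ^+ 2 * (m%:R * (n%:R * (n%:R * C) ^+ 2) * expR ((2 * n%:R * K + 1) * T)).
Proof.
move=> K0 C0 w0 hX hY XY0 ha hC hab t tT i j.
have := @lin_gronwall_sym a (fun s => X s - Y s) (fun s => Y s *m (a s - b s)) K (n%:R * w * C) T K0 _ _ ha _ t tT i j.
rewrite XY0 subrr big1 ?add0r; last by move=> k _; rewrite big1// => l _; rewrite mxE expr0n.
rewrite !mxE => h; apply: le_trans (h _ _ _) _.
- by rewrite !mulr_ge0.
- move=> s k l; have h1 := is_derive_funB (hX s k l) (hY s k l).
  have -> : (fun s => (X s - Y s) k l) = (fun s => X s k l - Y s k l).
    by apply/funext => u; rewrite !mxE.
  apply: (is_derive_eq h1).
  have -> : (X s *m a s) k l - (Y s *m b s) k l = (X s *m a s - Y s *m b s) k l by rewrite !mxE.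
  have -> : forall P Q : 'M[R]_(m, n), P k l + Q k l = (P + Q) k l by move=> P Q; rewrite !mxE.
  by congr (fun_of_matrix _ k l); rewrite mulmxBl mulmxBr addrA subrK.
- move=> s sT k l; apply: norm_mulmx_entry; last by move=> u; exact: hC.
  by move=> u v; rewrite !mxE; exact: hab.
rewrite le_eqVlt; apply/orP; left; apply/eqP; ring.
Qed.

End LinearODEDependence.

Section Gauge.
Variables (R : realType) (d n : nat).
Local Notation V := 'rV[R]_d.
Implicit Types (x y : V) (j : 'I_d).

(** The j-th coordinate itself is the parameter, so the parametrisation depends on the line only and
    not on the point x chosen on it ([on_lineD]). *)
Definition on_line j x (t : R) : V := x + (t - x ord0 j) *: evec R j.

Lemma on_lineD j x (s t : R) : on_line j (x + s *: evec R j) t = on_line j x t.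
Proof.
rewrite /on_line; have -> : (x + s *: evec R j) ord0 j = x ord0 j + s.
  by rewrite !mxE !eqxx mulr1.
by rewrite -addrA -scalerDl; congr (_ + _ *: _); ring.
Qed.

Lemma on_line_id j x : on_line j x (x ord0 j) = x.
Proof. by rewrite /on_line subrr scale0r addr0. Qed.

Lemma norm_evec j : `|evec R j| <= 1 :> R.
Proof.
rewrite row_norm_le//; apply/forallP => i; rewrite mxE eqxx /=.
by case: (_ == _); rewrite ?normr1 ?normr0.
Qed.

Lemma on_line_lip j x y (t : R) : `|on_line j x t - on_line j y t| <= 2 * `|x - y|.
Proof.
rewrite /on_line opprD addrACA -scalerBl.
have -> : t - x ord0 j - (t - y ord0 j) = - (x - y) ord0 j by rewrite !mxE; ring.
rewrite (le_trans (ler_normD _ _))// mulr_natl mulr2n lerD2l normrZ normrN.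
by rewrite -[leRHS]mulr1 ler_pM// ?coord_le_norm ?norm_evec.
Qed.

Lemma on_line_continuous j x : continuous (on_line j x).
Proof.
apply: cont_addv; first exact: cont_cstv.
apply: cont_scalev; last exact: cont_cstv.
by apply: cont_sub; [exact: cont_id|exact: cont_cst].
Qed.

(** On each line in the direction e_j, G solves G' = G A with value 1 on the hyperplane x_j = 0.
    Differentiability is obtained along the line; across lines only continuity, from the continuous
    dependence on the coefficients. *)
Lemma half_gauge_exists (A : V -> 'M[R]_n) j : (forall i k, Cc (fun x => A x i k)) ->
  exists G : V -> 'M[R]_n,
  [/\ forall i k, continuous (fun x => G x i k),
      forall x i k, is_derive x (evec R j) (fun y => G y i k) ((G x *m A x) i k) &
      forall x, x ord0 j = 0 -> G x = 1%:M].
Proof.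
move=> cA.
have [K K0 hK] : exists2 K : R, 0 <= K & forall x i k, `|A x i k| <= K.
  have hM (p : 'I_n * 'I_n) : {M : R | 0 <= M & forall x, `|A x p.1 p.2| <= M}.
    by apply/cid2; exact: Cc_bounded.
  exists (\sum_p s2val (hM p)); first by rewrite sumr_ge0// => p _; case: (hM p).
  move=> x i k; rewrite (bigD1 (i, k))//= (le_trans (s2valP' (hM (i, k)) x))// lerDl.
  by rewrite sumr_ge0// => p _; case: (hM p).
pose a x (t : R) := A (on_line j x t).
have ca x i k : continuous (fun t => a x t i k).
  by apply: (@cont_comp _ _ _ (on_line j x) (fun y => A y i k)); [exact: on_line_continuous|exact: (cA i k).1].
(* The solution is chosen as a function of the coefficient path, not of x, so all points of a line
   share one solution. *)
pose ode_sol (b : R -> 'M[R]_n) : R -> 'M[R]_n :=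
  if pselect (exists X : R -> 'M[R]_n, X 0 = 1%:M /\ linear_solution b X) is left h
  then projT1 (cid h) else fun=> 0.
have solP x : ode_sol (a x) 0 = 1%:M /\ linear_solution (a x) (ode_sol (a x)).
  rewrite /ode_sol; case: pselect => [h|[]]; first exact: (projT2 (cid h)).
  by apply: (@linear_solution_exists _ _ _ _ _ K) => // t k l; exact: hK.
pose G x := ode_sol (a x) (x ord0 j).
have aD x (s : R) : a (x + s *: evec R j) = a x.
  by apply/funext => t; rewrite /a on_lineD.
exists G; split.
- move=> i k; apply: cont_eps => x e e0.
  pose T := `|x ord0 j| + 1.
  pose C := 1 + \sum_(i < n) \sum_(k < n) (ode_sol (a x) 0 i k) ^+ 2 * expR ((2 * n%:R * K + 1) * T).
  have hC t : `|t| <= T -> forall i k, `|ode_sol (a x) t i k| <= C.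
    exact: (linear_solution_bound K0 (solP x).2 (fun t i k => hK _ i k)).
  have C0 : 0 <= C.
    by rewrite addr_ge0// sumr_ge0// => u _; rewrite sumr_ge0// => v _; rewrite mulr_ge0 ?sqr_ge0 ?expR_ge0.
  pose M := n%:R * (n%:R * (n%:R * C) ^+ 2) * expR ((2 * n%:R * K + 1) * T) + 1.
  have M1 : 1 <= M by rewrite lerDr !mulr_ge0 ?sqr_ge0 ?expR_ge0.
  have M0 : 0 < M by apply: lt_le_trans M1.
  have w0 : 0 < e / 2 / M by rewrite !divr_gt0.
  have hu (p : 'I_n * 'I_n) : {del : R | 0 < del & forall x y, `|x - y| < del -> `|A x p.1 p.2 - A y p.1 p.2| < e / 2 / M}.
    by apply/cid2; apply: compactly_supported_unif => //; [exact: (cA _ _).1|exact: (cA _ _).2].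
  have [del del0 hdel] := @finite_pos_lower _ _ (fun p => s2val (hu p)) (fun p => s2valP (hu p)).
  have e2 : 0 < e / 2 by rewrite divr_gt0.
  have /cvgrPdist_le /(_ _ e2) /nbhs_normP [del2 /= del20 hdel2] :=
    is_derive1_continuous ((solP x).2 (x ord0 j) i k).
  exists (Num.min (del / 2) (Num.min del2 1)); first by rewrite !lt_min del20 ltr01 divr_gt0.
  move=> y; rewrite !lt_min => /and3P[xy1 xy2 xy3].
  have xyj : `|x ord0 j - y ord0 j| <= `|x - y|.
    by have := coord_le_norm (x - y) j; rewrite !mxE.
  have yT : `|y ord0 j| <= T.
    rewrite /T -[y ord0 j](subKr (x ord0 j)) (le_trans (ler_normB _ _))// lerD2l.
    by rewrite (le_trans xyj)// ltW.
  have h1 : (ode_sol (a y) (y ord0 j) i k - ode_sol (a x) (y ord0 j) i k) ^+ 2 <= (e / 2) ^+ 2.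
    have := @linear_solution_dep R n n (a y) (a x) _ _ K C (e / 2 / M) T K0 C0 (ltW w0) (solP y).2 (solP x).2 _ (fun t i k => hK _ i k) hC _ _ yT i k.
    move=> h; apply: le_trans (h _ _) _.
    - by rewrite (solP x).1 (solP y).1.
    - move=> t u v; apply/ltW; apply: (s2valP' (hu (u, v))).
      apply: lt_le_trans (hdel (u, v)); apply: le_lt_trans (on_line_lip _ _ _ _) _.
      by rewrite distrC mulrC -ltr_pdivlMr.
    by apply: sqr_div_bound => //; rewrite /M lerDl.
  have {}h1 : `|ode_sol (a y) (y ord0 j) i k - ode_sol (a x) (y ord0 j) i k| <= e / 2.
    by rewrite -ler_sqr ?nnegrE ?(ltW e2)// real_normK ?num_real.
  have h2 : `|ode_sol (a x) (x ord0 j) i k - ode_sol (a x) (y ord0 j) i k| <= e / 2.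
    by apply: hdel2; apply: le_lt_trans xyj xy2.
  rewrite /G -[X in `|X|](subrKA (ode_sol (a x) (y ord0 j) i k)).
  rewrite (le_trans (ler_normD _ _))// [leRHS]splitr lerD// distrC//.
- move=> x i k; apply/is_derive_line0.
  have -> : (fun s : R => G (x + s *: evec R j) i k) = (fun s => ode_sol (a x) (s + x ord0 j) i k).
    apply/funext => s; rewrite /G aD; congr (ode_sol _ _ _ _).
    by rewrite !mxE !eqxx mulr1 addrC.
  have h1 := (solP x).2 (0 + x ord0 j) i k.
  have h2 : is_derive (0 : R) 1 (fun s : R => s + x ord0 j) (1 + 0).
    exact: (is_derive_funD (is_derive_id (0 : R) (1 : R)) (is_derive_fun_cst (x ord0 j) (0 : R) (1 : R))).
  have h3 := @is_derive1_comp _ (fun t => ode_sol (a x) t i k) (fun s => s + x ord0 j) 0 _ _ h1 h2.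
  by apply: (is_derive_eq h3); rewrite addr0 mulr1 add0r /G /a on_line_id.
- by move=> x xj; rewrite /G xj (solP x).1.
Qed.

(** The inverse H is the transpose of a half gauge for the negative transpose of A. Then G H has
    derivative G A H - G A H = 0 along each line and equals 1 on the hyperplane. *)
Lemma gauge_exists (A : V -> 'M[R]_n) j : (forall i k, Cc (fun x => A x i k)) ->
  exists GH : (V -> 'M[R]_n) * (V -> 'M[R]_n),
  [/\ (forall i k, continuous (fun x => GH.1 x i k)) /\ (forall i k, continuous (fun x => GH.2 x i k)),
      forall x i k, is_derive x (evec R j) (fun y => GH.1 y i k) ((GH.1 x *m A x) i k),
      forall x i k, is_derive x (evec R j) (fun y => GH.2 y i k) (- (A x *m GH.2 x) i k) &
      forall x, GH.1 x *m GH.2 x = 1%:M].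
Proof.
move=> cA; have [G [cG dG G0]] := half_gauge_exists j cA.
have cA' i k : Cc (fun x => (- (A x)^T) i k).
  under eq_fun do rewrite !mxE.
  have [h1 [r hr]] := cA k i; split; first exact: cont_opp.
  by exists r => x /hr ->; rewrite oppr0.
have [G' [cG' dG' G0']] := half_gauge_exists j cA'.
pose H x := (G' x)^T.
have dH x i k : is_derive x (evec R j) (fun y => H y i k) (- (A x *m H x) i k).
  under eq_fun do rewrite mxE.
  apply: (is_derive_eq (dG' x k i)); rewrite mulmxN mxE; congr (- _).
  have -> : (A x *m H x) i k = (A x *m H x)^T k i by rewrite [RHS]mxE.
  by rewrite trmx_mul /H trmxK.
exists (G, H); split => //=.
  split=> // i k; have -> : (fun y => H y i k) = (fun y => G' y k i).
    by apply/funext => y; rewrite /H mxE.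
  exact: cG'.
move=> x; apply/matrixP => i k.
pose F (t : R) := (G (x + t *: evec R j) *m H (x + t *: evec R j)) i k.
have dF (t : R) : is_derive t 1 F 0.
  apply/(is_derive_line (fun y => (G y *m H y) i k)).
  set y := x + t *: evec R j.
  under eq_fun do rewrite mxE.
  have hs := @is_derive_funsum _ _ _ (index_enum 'I_n) xpredT (fun l z => G z i l * H z l k) y (evec R j) _
    (fun l _ => is_derive_funM (dG y i l) (dH y l k)).
  apply: (is_derive_eq hs).
  rewrite big_split /=.
  have -> : \sum_(l < n) (G y *m A y) i l * H y l k = (G y *m A y *m H y) i k by rewrite [RHS]mxE.
  have -> : \sum_(l < n) G y i l * - (A y *m H y) l k = - (G y *m (A y *m H y)) i k.
    by rewrite [in RHS]mxE -sumrN; apply: eq_bigr => l _; rewrite mulrN.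
  by rewrite mulmxA subrr.
have F0 : F (- x ord0 j) = (1%:M : 'M[R]_n) i k.
  rewrite /F; set y := x + _; have y0 : y ord0 j = 0 by rewrite !mxE !eqxx mulr1 addrN.
  by rewrite G0// /H G0'// trmx1 mulmx1.
have <- : F 0 = (G x *m H x) i k by rewrite /F scale0r addr0.
rewrite -F0; have [t0|t0] := leP 0 (- x ord0 j).
  by apply/esym/(derive_zero_eq t0) => t _.
by apply/(derive_zero_eq (ltW t0)) => t _.
Qed.

End Gauge.

(** * Interior regularity *)

Definition mcont (R : realType) (T : topologicalType) (a b : nat) (M : T -> 'M[R]_(a, b)) :=
  forall i k, continuous (fun x => M x i k).

Lemma mcont_mul (R : realType) (T : topologicalType) (a b c : nat)
    (M : T -> 'M[R]_(a, b)) (N : T -> 'M[R]_(b, c)) :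
  mcont M -> mcont N -> mcont (fun x => M x *m N x).
Proof.
move=> cM cN i k; under eq_fun do rewrite mxE.
by apply: cont_sum => l _; apply: cont_mul; [exact: cM|exact: cN].
Qed.

Lemma mcont_comp (R : realType) (T U : topologicalType) (a b : nat)
    (g : U -> T) (M : T -> 'M[R]_(a, b)) :
  continuous g -> mcont M -> mcont (fun x => M (g x)).
Proof. by move=> cg cM i k; apply: (cont_comp cg (cM i k)). Qed.

Lemma mcont_cst (R : realType) (T : topologicalType) (a b : nat) (M : 'M[R]_(a, b)) :
  mcont (fun _ : T => M).
Proof. by move=> i k; exact: cont_cst. Qed.

Lemma Cc_ball (R : realType) d (f : 'rV[R]_d -> R) p r : continuous f ->
  (forall x, r < `|x - p| -> f x = 0) -> Cc f.
Proof. by move=> cf hf; split => //; exact: compactly_supported_shift hf. Qed.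

Lemma subr_cancel (W : zmodType) (a b c : W) : c - b = (a - b) - (a - c).
Proof. by rewrite opprB addrCA addrAC subrr add0r. Qed.

Section SupportShift.
Variables (R : realType) (V : normedModType R).
Implicit Types (x y p : V) (a b : R).

Lemma norm_shift_gt x y a : a + `|y| < `|x| -> a < `|x + y|.
Proof. by move=> h; have := ler_normB (x + y) y; rewrite addrK; lra. Qed.

Lemma norm_shift_gt_center x y p a b : `|y| <= b -> a + b < `|x - p| -> a < `|x + y - p|.
Proof.
by move=> yb h; rewrite addrAC; apply: norm_shift_gt; rewrite (le_lt_trans _ h)// lerD2l.
Qed.

Lemma shift_support (W : zmodType) (chi : V -> W) p y (rho tau : R) : `|y| <= tau ->
  (forall x, rho < `|x - p| -> chi x = 0) -> forall x, rho + tau < `|x - p| -> chi (x + y) = 0.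
Proof. by move=> yt h x xr; apply: h; exact: norm_shift_gt_center yt xr. Qed.

End SupportShift.

Lemma norm_scale_evec (R : realType) d (j : 'I_d) (t : R) : `|t *: evec R j| <= `|t|.
Proof. by rewrite normrZ -[leRHS]mulr1 ler_wpM2l// norm_evec. Qed.

Section KernelIntegral.
Variables (R : realType) (d : nat).
Local Notation V := 'rV[R]_d.
Variable lam : {measure set (Rd R d) -> \bar R}.
Local Notation I := (intR lam).
Local Notation L1 := (isL1 lam).
Variables (K : V * V -> R) (r r' : R) (f : V -> R).
Hypotheses (cK : continuous K) (K1 : forall y x, r < `|y| -> K (y, x) = 0)
  (K2 : forall y x, r' < `|x| -> K (y, x) = 0) (Lf : L1 f).

Lemma continuous_slice x : continuous (fun y => K (y, x)).
Proof. by apply: cont_comp cK; apply: cont_pair; [exact: cont_id|exact: cont_cstv]. Qed.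

Lemma L1_kernel x : L1 (fun y => K (y, x) * f y).
Proof.
have [M _ hM] := pair_bounded cK K1 K2.
by apply: (L1_cont_bounded (@continuous_slice x) (M := M)).
Qed.

Lemma I_kernel_Cc : Cc (fun x => I (fun y => K (y, x) * f y)).
Proof.
split; last first.
  exists r' => x xr; rewrite -[RHS](I0 lam); congr (intR _ _).
  by apply/funext => y; rewrite K2// mul0r.
apply: cont_eps => x e e0.
pose N := I (fun z => `|f z|) + 1.
have N0 : 0 < N by rewrite ltr_wpDl// I_norm_ge0.
have eN : 0 < e / N by rewrite divr_gt0.
have [del del0 hd] := pair_unif cK K1 K2 eN.
exists del => // x' xx'; rewrite -IB; [|exact: L1_kernel|exact: L1_kernel].
rewrite (_ : (fun z => _) = (fun z => (K (z, x) - K (z, x')) * f z)); last first.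
  by apply/funext => z; rewrite mulrBl.
apply: (@le_trans _ _ (e / N * I (fun z => `|f z|))).
  apply: I_mul_bound => //; first by apply: cont_sub; exact: continuous_slice.
  by move=> z; apply/ltW/hd.
by rewrite mulrAC ler_pdivrMr// ler_pM2l// /N lerDl.
Qed.

End KernelIntegral.

(** * The weak equation near one point: gauged fields, shifts and the averaged kernel *)

Section LocalRegularity.
Variables (R : realType) (d n : nat).
Local Notation V := 'rV[R]_d.
Variable lam : {measure set (Rd R d) -> \bar R}.
Hypothesis hlam : is_lebesgue lam.
Local Notation I := (intR lam).
Local Notation L1 := (isL1 lam).
Variables (f : 'I_n -> V -> R) (A : 'I_d -> V -> 'M[R]_n) (p : V) (r1 : R).
Hypotheses (Lf : forall i, L1 (f i)) (cA : forall j i k, Cc (fun x => A j x i k)) (r10 : 0 < r1).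
Hypothesis Hweak : forall i j (psi dpsi : V -> R), continuous psi -> continuous dpsi ->
  (forall x, is_derive x (evec R j) psi (dpsi x)) ->
  (forall x, r1 < `|x - p| -> psi x = 0) ->
  I (fun x => dpsi x * f i x) = I (fun x => psi x * \sum_k A j x i k * f k x).

Definition gauge j := projT1 (cid (@gauge_exists R d n (A j) j (cA j))).
Definition gaugeG j := (gauge j).1.
Definition gaugeH j := (gauge j).2.

Lemma gaugeP j : [/\ mcont (gaugeG j), mcont (gaugeH j),
      forall x i k, is_derive x (evec R j) (fun y => gaugeG j y i k) ((gaugeG j x *m A j x) i k),
      forall x i k, is_derive x (evec R j) (fun y => gaugeH j y i k) (- (A j x *m gaugeH j x) i k) &
      forall x, gaugeG j x *m gaugeH j x = 1%:M].
Proof. by rewrite /gaugeG /gaugeH /gauge; case: cid => -[g h] /= [[? ?] ? ? ?]; split. Qed.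

Lemma gaugeG_cont j : mcont (gaugeG j). Proof. by have [] := gaugeP j. Qed.
Lemma gaugeH_cont j : mcont (gaugeH j). Proof. by have [] := gaugeP j. Qed.
Lemma gaugeGH j x : gaugeG j x *m gaugeH j x = 1%:M. Proof. by have [] := gaugeP j. Qed.
Lemma gaugeHG j x : gaugeH j x *m gaugeG j x = 1%:M. Proof. by apply: mulmx1C; exact: gaugeGH. Qed.

Let th := cutoff p r1 (r1 + 1).
Let cth : Cc th. Proof. by apply: cutoff_Cc; rewrite ltrDl. Qed.

(** Component l of G_j f. The cutoff [th] is 1 on the ball that supports the test functions and
    makes the product with the merely continuous G_j integrable on the whole space. *)
Definition gauged j l x := \sum_i (th x * gaugeG j x l i) * f i x.

Lemma L1_gauged j l : L1 (gauged j l).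
Proof.
by apply: L1_sum => i; apply: L1_Cc_mul => //; apply: Cc_mull => //; exact: gaugeG_cont.
Qed.

Lemma I_gauged (chi : V -> R) j l : continuous chi -> (forall x, r1 < `|x - p| -> chi x = 0) ->
  I (fun x => chi x * gauged j l x) = \sum_i I (fun x => (chi x * gaugeG j x l i) * f i x).
Proof.
move=> cchi schi; have Cchi := Cc_ball cchi schi.
rewrite -I_sum; last by move=> i; apply: L1_Cc_mul => //; apply: Cc_mull => //; exact: gaugeG_cont.
congr (intR _ _); apply/funext => x; rewrite mulr_sumr; apply: eq_bigr => i _.
have [xr|xr] := leP `|x - p| r1; last by rewrite schi// !mul0r.
by rewrite /th cutoff_in// ?ltrDl// mul1r mulrA.
Qed.

(** Test the equation for f_i with chi (G_j)_li, which has a derivative in the direction e_j as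
    [Hweak] requires. Summed over i, the term chi (G_j A_j)_li f_i coming from the derivative of G_j
    cancels the zero-order term. *)
Lemma gauge_weak (chi dchi : V -> R) j l : continuous chi -> continuous dchi ->
  (forall x, is_derive x (evec R j) chi (dchi x)) ->
  (forall x, r1 < `|x - p| -> chi x = 0) ->
  I (fun x => dchi x * gauged j l x) = 0.
Proof.
move=> cchi cdchi dchiP schi.
have Cchi := Cc_ball cchi schi.
have sdchi := is_derive_outside dchiP schi.
have Cdchi := Cc_ball cdchi sdchi.
have [_ _ dG _ _] := gaugeP j.
rewrite I_gauged//.
have cGA : mcont (fun x => gaugeG j x *m A j x).
  by apply: mcont_mul; [exact: gaugeG_cont|move=> i k; exact: (cA j i k).1].
have E i : I (fun x => (dchi x * gaugeG j x l i) * f i x) =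
  \sum_k I (fun x => (chi x * gaugeG j x l i * A j x i k) * f k x) - I (fun x => (chi x * (gaugeG j x *m A j x) l i) * f i x).
  have h : I (fun x => (dchi x * gaugeG j x l i + chi x * (gaugeG j x *m A j x) l i) * f i x) =
    I (fun x => chi x * gaugeG j x l i * \sum_k A j x i k * f k x).
    apply: (@Hweak i j).
    - by apply: cont_mul => //; exact: gaugeG_cont.
    - by apply: cont_add; apply: cont_mul => //; exact: gaugeG_cont.
    - by move=> x; exact: is_derive_funM.
    - by move=> x xr; rewrite schi// mul0r.
  have -> : \sum_k I (fun x => (chi x * gaugeG j x l i * A j x i k) * f k x) =
    I (fun x => chi x * gaugeG j x l i * \sum_k A j x i k * f k x).
    rewrite -I_sum; last first.
      by move=> k; apply: L1_Cc_mul => //; apply: Cc_mull; [apply: Cc_mull => //; exact: gaugeG_cont|exact: (cA j i k).1].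
    congr (intR _ _); apply/funext => x; rewrite mulr_sumr; by apply: eq_bigr => k _; rewrite !mulrA.
  rewrite -h -IB.
  - by congr (intR _ _); apply/funext => x; ring.
  - apply: L1_Cc_mul => //; apply: (@Cc_ball _ _ _ p r1); last first.
      by move=> x xr; rewrite schi// sdchi// !mul0r addr0.
    by apply: cont_add; apply: cont_mul => //; exact: gaugeG_cont.
  - by apply: L1_Cc_mul => //; apply: Cc_mull => //; exact: cGA.
under eq_bigr do rewrite E.
rewrite sumrB exchange_big /=; apply/eqP; rewrite subr_eq0; apply/eqP.
apply: eq_bigr => k _; rewrite -I_sum; last first.
  by move=> i; apply: L1_Cc_mul => //; apply: Cc_mull; [apply: Cc_mull => //; exact: gaugeG_cont|exact: (cA j i k).1].
congr (intR _ _); apply/funext => x; rewrite mxE mulr_sumr mulr_suml.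
by apply: eq_bigr => i _; ring.
Qed.

(** The derivative in t of the left side is the integral of the shifted derivative of chi against
    the gauged field, which vanishes as long as the shifted support stays in the ball of radius
    r1. *)
Lemma shift_smooth (chi : V -> R) j l (rho tau t : R) : smooth chi ->
  (forall x, rho < `|x - p| -> chi x = 0) -> `|t| <= tau -> rho + tau <= r1 ->
  I (fun x => chi (x + t *: evec R j) * gauged j l x) = I (fun x => chi x * gauged j l x).
Proof.
move=> schi hchi tt rt.
pose e := evec R j.
have cchi : continuous chi by have [] := schi [::].
have Cchi := Cc_ball cchi hchi.
have cdchi : continuous ('D_e chi) by have [] := schi [:: e].
have dchiP x : is_derive x e chi ('D_e chi x) by exact: smooth_derive.
have Cdchi := Cc_derive Cchi cdchi dchiP.
pose F (s : R) := convolve lam chi (gauged j l) 1 (0 + s *: e).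
have dF (s : R) : `|s| <= tau -> is_derive s 1 F 0.
  move=> st; apply/(is_derive_line (convolve lam chi (gauged j l) 1)).
  have h := @is_derive_conv _ _ lam chi ('D_e chi) (gauged j l) 1 e (0 + s *: e) Cchi Cdchi (L1_gauged j l) dchiP.
  apply: (is_derive_eq h); rewrite mul1r /convolve add0r scale1r.
  apply: (@gauge_weak (fun x => chi (x + s *: e)) (fun x => 'D_e chi (x + s *: e))).
  - exact (@cont_shift R d chi (s *: e) cchi).
  - exact (@cont_shift R d _ (s *: e) cdchi).
  - move=> x; apply/is_derive_line0.
    have /is_derive_line0 := dchiP (x + s *: e).
    by under eq_fun do rewrite addrAC.
  - move=> x xr; apply: (shift_support (rho := rho) (tau := tau) _ hchi).
      by rewrite (le_trans (norm_scale_evec _ _)).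
    exact: le_lt_trans xr.
have E (s : R) : F s = I (fun x => chi (x + s *: e) * gauged j l x).
  by rewrite /F /convolve; under eq_fun do rewrite scale1r add0r.
rewrite -/e -E; have -> : I (fun x => chi x * gauged j l x) = F 0.
  by rewrite E; under [in RHS]eq_fun do rewrite scale0r addr0.
have [t0|t0] := leP 0 t.
  apply: derive_zero_eq => // s /andP[s0 st]; apply: dF.
  by rewrite ger0_norm// (le_trans st)// (le_trans (ler_norm _)).
apply/esym/derive_zero_eq; first exact: ltW.
move=> s /andP[s0 st]; apply: dF.
by rewrite ler0_norm// (le_trans _ tt)// ltr0_norm// lerN2.
Qed.

(** Neither side involves a derivative of chi, so the identity passes to uniform limits; the strict
    inequality leaves room for the mollification radius. *)
Lemma shift_continuous (chi : V -> R) j l (rho tau t : R) : continuous chi ->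
  (forall x, rho < `|x - p| -> chi x = 0) -> `|t| <= tau -> rho + tau < r1 ->
  I (fun x => chi (x + t *: evec R j) * gauged j l x) = I (fun x => chi x * gauged j l x).
Proof.
move=> cchi schi tt rt; have Cchi := Cc_ball cchi schi.
pose g := gauged j l; have Lg : L1 g := L1_gauged j l.
pose N := I (fun z => `|g z|) + I (fun z => `|g z|) + 1.
have N0 : 0 < N by rewrite ltr_wpDl// addr_ge0// I_norm_ge0.
apply/eqP; rewrite -subr_eq0 -normr_le0; apply/ler_addgt0Pl => eta eta0; rewrite addr0.
have eN : 0 < eta / N by rewrite divr_gt0.
have [d1 d10 h1] := compactly_supported_unif Cchi.1 Cchi.2 eN.
pose m := Num.min (r1 - (rho + tau)) d1.
have m0 : 0 < m by rewrite lt_min subr_gt0 rt.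
have e0 : 0 < m / 2 by rewrite divr_gt0.
have em : m / 2 < m by rewrite ltr_pdivrMr// ltr_pMr// ltr1n.
move: (em); rewrite /m !lt_min => /andP[er ed1].
have [eps [srho rho0 rhoe Irho]] := bump_exists hlam e0.
pose phi := mollify lam eps chi.
have sphi : smooth phi by exact: (smooth_mollify hlam srho rhoe Cchi).
have hphi : forall x, rho + m / 2 < `|x - p| -> phi x = 0.
  exact: (mollify_support hlam srho rhoe Cchi schi).
have cphi : continuous phi by have [] := sphi [::].
have a1 x : `|phi x - chi x| <= eta / N.
  apply: (mollify_approx hlam srho rho0 rhoe Irho Cchi) => y z yz; apply/ltW/h1.
  exact: le_lt_trans yz ed1.
have Cphi := Cc_ball cphi hphi.
have E : I (fun x => phi (x + t *: evec R j) * g x) = I (fun x => phi x * g x).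
  apply: (@shift_smooth phi j l (rho + m / 2) tau t) => //.
  by rewrite addrAC -lerBrDl ltW.
pose te := t *: evec R j.
have Cs (k : V -> R) : Cc k -> Cc (fun x => k (x + te)).
  move=> [ck [a ha]]; split; first exact: cont_shift.
  exists (a + `|te|) => x xa; apply: ha.
  exact: norm_shift_gt.
have -> : I (fun x => chi (x + te) * g x) - I (fun x => chi x * g x) =
  I (fun x => (phi x - chi x) * g x) - I (fun x => (phi (x + te) - chi (x + te)) * g x).
  rewrite (I_mulBl Cphi Cchi Lg) (I_mulBl (Cs _ Cphi) (Cs _ Cchi) Lg) E; exact: subr_cancel.
have b1 := I_mul_bound (cont_sub cphi cchi) a1 Lg.
have b2 := I_mul_bound (cont_sub (Cs _ Cphi).1 (Cs _ Cchi).1) (fun x => a1 (x + te)) Lg.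
have -> : eta = eta / N * N by rewrite divfK ?(gt_eqF N0).
exact: norm_sub_le_scaled (ltW eN) b1 b2.
Qed.

Definition pairing (Phi : V -> 'rV[R]_n) : R := \sum_i I (fun x => Phi x ord0 i * f i x).

Lemma pairing_gauge (Psi : V -> 'rV[R]_n) j : mcont Psi ->
  (forall x, r1 < `|x - p| -> Psi x = 0) ->
  pairing (fun x => Psi x *m gaugeG j x) = \sum_l I (fun x => Psi x ord0 l * gauged j l x).
Proof.
move=> cPsi sPsi.
have sPsi' l x : r1 < `|x - p| -> Psi x ord0 l = 0 by move=> xr; rewrite sPsi// mxE.
have CPsi l : Cc (fun x => Psi x ord0 l) by apply: Cc_ball; [exact: cPsi|exact: sPsi'].
under [RHS]eq_bigr => l _ do rewrite (I_gauged j l (cPsi ord0 l) (sPsi' l)).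
rewrite exchange_big /=; apply: eq_bigr => i _.
rewrite -I_sum; last by move=> l; apply: L1_Cc_mul => //; apply: Cc_mull => //; exact: gaugeG_cont.
by congr (intR _ _); apply/funext => x; rewrite mxE mulr_suml.
Qed.

(** Write Phi = (Phi H_j) G_j and shift the components of Phi H_j against the gauged field: H_j
    moves to the new point and G_j stays at y. *)
Lemma pairing_step (Phi : V -> 'rV[R]_n) j (rho tau t : R) : mcont Phi ->
  (forall x, rho < `|x - p| -> Phi x = 0) -> `|t| <= tau -> rho + tau < r1 ->
  pairing (fun y => Phi (y + t *: evec R j) *m (gaugeH j (y + t *: evec R j) *m gaugeG j y)) = pairing Phi.
Proof.
move=> cPhi sPhi tt rt.
have tau0 : 0 <= tau by apply: le_trans tt.
pose X y := Phi y *m gaugeH j y.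
have cX : mcont X by apply: mcont_mul => //; exact: gaugeH_cont.
have sX x : rho < `|x - p| -> X x = 0 by move=> xr; rewrite /X sPhi// mul0mx.
have -> : pairing Phi = pairing (fun y => X y *m gaugeG j y).
  by congr pairing; apply/funext => y; rewrite /X -mulmxA gaugeHG mulmx1.
rewrite pairing_gauge//; last by move=> x xr; apply: sX; lra.
under [X in pairing X]eq_fun do rewrite mulmxA.
rewrite (@pairing_gauge (fun y => X (y + t *: evec R j))).
- apply: eq_bigr => l _.
  apply: (@shift_continuous (fun y => X y ord0 l) j l rho tau t) => //.
  by move=> x xr; rewrite sX// mxE.
- by apply: mcont_comp => //; apply: cont_addv; [exact: cont_id|exact: cont_cstv].
- move=> x xr; apply: (shift_support (rho := rho) (tau := tau) _ sX).
    by rewrite (le_trans (norm_scale_evec _ _)).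
  exact: lt_trans xr.
Qed.

(* The product of the gauge corrections met when moving from [z.1] to [z.1 + z.2] parallel to the
   axes, one coordinate at a time. *)
Fixpoint stairs (s : seq 'I_d) (z : V * V) : 'M[R]_n :=
  if s is j :: s' then
    stairs s' (z.1 + z.2 ord0 j *: evec R j, z.2) *m
      (gaugeH j (z.1 + z.2 ord0 j *: evec R j) *m gaugeG j z.1)
  else 1%:M.

Definition stairs_shift (s : seq 'I_d) (h : V) : V := \sum_(j <- s) h ord0 j *: evec R j.

Lemma stairs_cont s : mcont (stairs s).
Proof.
have c1 j : continuous (fun z : V * V => z.1 + z.2 ord0 j *: evec R j).
  apply: cont_addv; first by move=> z; exact: cvg_fst.
  apply: cont_scalev; last exact: cont_cstv.
  by apply: (cont_comp (f := snd) (g := fun h : V => h ord0 j)); [move=> z; exact: cvg_snd|exact: coord_continuous].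
elim: s => [|j s IH] /=; first exact: mcont_cst.
apply: mcont_mul.
  apply: (mcont_comp (g := fun z : V * V => (z.1 + z.2 ord0 j *: evec R j, z.2))) => //.
  by apply: cont_pair => // z; exact: cvg_snd.
apply: mcont_mul; first by apply: (mcont_comp (c1 j)); exact: gaugeH_cont.
by apply: (mcont_comp (g := fst)); [move=> z; exact: cvg_fst|exact: gaugeG_cont].
Qed.

(** Each move along an axis widens the support by at most tau, and [pairing_step] applies as long as
    the total stays below r1. *)
Lemma pairing_stairs (s : seq 'I_d) (Phi : V -> 'rV[R]_n) (rho tau : R) (h : V) : mcont Phi ->
  (forall x, rho < `|x - p| -> Phi x = 0) -> `|h| <= tau -> rho + (size s)%:R * tau < r1 ->
  pairing (fun y => Phi (y + stairs_shift s h) *m stairs s (y, h)) = pairing Phi.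
Proof.
move=> cPhi sPhi ht.
have tau0 : 0 <= tau by apply: le_trans ht.
have norm_shift s' : `|stairs_shift s' h| <= (size s')%:R * tau.
  elim: s' => [|j s' IH]; first by rewrite /stairs_shift big_nil normr0 mul0r.
  have E : (size s').+1%:R * tau = tau + (size s')%:R * tau :> R.
    by rewrite -addn1 natrD mulrDl mul1r addrC.
  rewrite /stairs_shift big_cons /= E (le_trans (ler_normD _ _))// lerD//.
  by rewrite (le_trans (norm_scale_evec _ _))// (le_trans (coord_le_norm _ _)).
elim: s => [|j s IH] hr.
  by congr pairing; apply/funext => y; rewrite /= mulmx1 /stairs_shift big_nil addr0.
have hr' : rho + (size s)%:R * tau + tau < r1.
  by move: hr; rewrite /= -addn1 natrD mulrDl mul1r addrA.
rewrite -IH; last by apply: le_lt_trans hr'; rewrite lerDl.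
pose X y := Phi (y + stairs_shift s h) *m stairs s (y, h).
rewrite -[RHS](@pairing_step X j (rho + (size s)%:R * tau) tau (h ord0 j)) => //.
- congr pairing; apply/funext => y /=; rewrite /X /stairs_shift big_cons mulmxA.
  by rewrite [h ord0 j *: _ + _]addrC addrA addrAC.
- apply: mcont_mul.
    by apply: mcont_comp => //; apply: cont_addv; [exact: cont_id|exact: cont_cstv].
  apply: (mcont_comp (g := fun y : V => (y, h))); last exact: stairs_cont.
  by apply: cont_pair; [exact: cont_id|exact: cont_cstv].
- move=> x xr; rewrite /X (_ : Phi _ = 0) ?mul0mx//.
  exact: (shift_support (rho := rho) (tau := (size s)%:R * tau) _ sPhi).
- by rewrite (le_trans (coord_le_norm _ _)).
Qed.

Lemma stairs_shift_enum h : stairs_shift (enum 'I_d) h = h.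
Proof. by rewrite /stairs_shift big_enum /= [RHS]row_sum_delta. Qed.

(* Averaging the identity of [pairing_stairs] over [h] against a smooth bump turns it into an
   integral operator with continuous kernel. *)
Lemma kernel_representation : exists u : 'I_n -> V -> R, exists2 rho : R, 0 < rho <= r1 / 2 &
  (forall m, Cc (u m)) /\
  forall m (phi : V -> R), continuous phi -> (forall x, rho < `|x - p| -> phi x = 0) ->
    I (fun x => phi x * f m x) = I (fun x => phi x * u m x).
Proof.
(* The d moves of length at most tau use up less than r1 / 4, so the supports stay within radius r1
   / 2. *)
pose rho := r1 / 4; pose tau := r1 / 4 / d.+1%:R.
have rho0 : 0 < rho by rewrite divr_gt0.
have tau0 : 0 < tau by rewrite !divr_gt0.
have rt : rho + (size (enum 'I_d))%:R * tau < r1.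
  rewrite size_enum_ord; have dt : d%:R * tau <= r1 / 4.
    by rewrite /tau mulrCA ler_piMr ?(ltW rho0)// ler_pdivrMr ?mul1r ?ler_nat.
  by move: dt rho0; rewrite /rho; lra.
have [eta [seta eta0 etas Ieta]] := bump_exists hlam tau0.
have ceta : continuous eta by have [] := seta [::].
have Ceta : Cc eta by split => //; exists tau.
have Leta := L1_Cc' hlam Ceta.
pose P (y h : V) := stairs (enum 'I_d) (y, h).
have cP : mcont (fun z : V * V => P z.1 z.2).
  move=> a b; have := @stairs_cont (enum 'I_d) a b.
  rewrite (_ : (fun x => stairs _ x a b) = (fun z => P z.1 z.2 a b))//.
  by apply/funext => -[].
have r2 : rho < rho + rho by rewrite ltrDl.
pose th2 := cutoff p rho (rho + rho).
have Cth2 : Cc th2 by exact: cutoff_Cc.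
(* The average of eta(h) phi(y + h) P(y, h) over h, rewritten in the variable x = y + h and stripped
   of phi(x). The cutoff [th2] is 1 on the support of phi and confines x to a ball, which makes the
   kernel compactly supported. *)
pose Ker m i (z : V * V) := th2 z.2 * (eta (z.2 - z.1) * P z.1 (z.2 - z.1) m i).
have cfst : continuous (fst : V * V -> V) by move=> z; exact: cvg_fst.
have csnd : continuous (snd : V * V -> V) by move=> z; exact: cvg_snd.
have cdiff : continuous (fun z : V * V => z.2 - z.1) by exact: cont_subv.
have cK m i : continuous (Ker m i).
  apply: cont_mul; first by apply: (cont_comp csnd); exact: Cth2.1.
  apply: cont_mul; first exact: (cont_comp cdiff).
  have cg : continuous (fun z : V * V => (z.1, z.2 - z.1)) by exact: cont_pair.
  exact: (mcont_comp cg cP).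
have K2 m i y x : `|p| + (rho + rho) < `|x| -> Ker m i (y, x) = 0.
  move=> xr; rewrite /Ker /th2 /= cutoff_out ?mul0r//.
  have := lerB_dist x p; have := xr; lra.
have K1 m i y x : `|p| + (rho + rho) + tau < `|y| -> Ker m i (y, x) = 0.
  move=> yr; have [xr|xr] := ltP (`|p| + (rho + rho)) `|x|; first exact: K2.
  rewrite /Ker /= etas ?mul0r ?mulr0//.
  have := lerB_dist y x; rewrite distrC; have := yr; lra.
pose u m x := \sum_i I (fun y => Ker m i (y, x) * f i y).
have Cu m : Cc (u m) by apply: Cc_sum => i; exact: (I_kernel_Cc (@cK m i) (@K1 m i) (@K2 m i)).
exists u, rho.
  by rewrite rho0 ler_pM2l// lef_pV2 ?posrE// ler_nat.
split=> // m phi cphi sphi.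
have Cphi := Cc_ball cphi sphi.
pose Phi (x : V) : 'rV[R]_n := phi x *: delta_mx ord0 m.
have cPhi : mcont Phi.
  move=> a b; under eq_fun do rewrite mxE.
  by apply: cont_mul => //; exact: cont_cst.
have sPhi x : rho < `|x - p| -> Phi x = 0 by move=> xr; rewrite /Phi sphi// scale0r.
have pE : pairing Phi = I (fun x => phi x * f m x).
  rewrite /pairing (bigD1 m)//= big1 ?addr0 => [|i im].
    by congr (intR _ _); apply/funext => x; rewrite !mxE !eqxx mulr1.
  rewrite -[RHS](I0 lam); congr (intR _ _); apply/funext => x.
  by rewrite !mxE (negPf im) andbF mulr0 mul0r.
(* The integrand before the substitution. Since eta has integral 1, the pairing is its own average
   against eta; Fubini's theorem then lets h be integrated first, for fixed y. *)
pose Q i (z : V * V) := eta z.2 * (phi (z.1 + z.2) * P z.1 z.2 m i).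
have cQ i : continuous (Q i).
  apply: cont_mul; first exact: (cont_comp csnd).
  apply: cont_mul; last exact: cP.
  by apply: (cont_comp (f := fun z : V * V => z.1 + z.2)) => //; exact: cont_addv.
have Q2 i y h : tau < `|h| -> Q i (y, h) = 0 by move=> ht; rewrite /Q /= etas ?mul0r.
have Q1 i y h : `|p| + rho + tau < `|y| -> Q i (y, h) = 0.
  move=> yr; have [ht|ht] := ltP tau `|h|; first exact: Q2.
  rewrite /Q /= sphi ?mul0r ?mulr0//.
  apply: (norm_shift_gt_center ht).
  have := lerB_dist y p; have := yr; lra.
have avg h : \sum_i I (fun y => Q i (y, h) * f i y) = eta h * pairing Phi.
  have [ht|ht] := ltP tau `|h|.
    rewrite etas// mul0r big1// => i _; rewrite -[RHS](I0 lam); congr (intR _ _).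
    by apply/funext => y; rewrite Q2// mul0r.
  rewrite -(pairing_stairs cPhi sPhi ht rt) stairs_shift_enum /pairing mulr_sumr.
  apply: eq_bigr => i _; rewrite -IZ; last first.
    apply: L1_Cc_mul => //; apply: (@Cc_ball _ _ _ p (rho + tau)).
      apply: mcont_mul; last first.
        apply: (mcont_comp (g := fun y : V => (y, h))); last exact: stairs_cont.
        by apply: cont_pair; [exact: cont_id|exact: cont_cstv].
      by apply: mcont_comp => //; apply: cont_addv; [exact: cont_id|exact: cont_cstv].
    by move=> x xr; rewrite (shift_support ht sPhi xr) mul0mx mxE.
  congr (intR _ _); apply/funext => y.
  rewrite /Q /Phi /P /= -scalemxAl -rowE !mxE; ring.
transitivity (\sum_i I (fun h => I (fun y => Q i (y, h) * f i y))).
  rewrite -I_sum; last by move=> i; apply: (L1_Cc' hlam); exact: (I_kernel_Cc (cQ i) (Q1 i) (Q2 i)).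
  rewrite -pE -[LHS]mulr1 -Ieta -IZ//; congr (intR _ _); apply/funext => h.
  by rewrite avg mulrC.
rewrite /u; under [in RHS]eq_fun do rewrite mulr_sumr.
rewrite I_sum; last first.
  by move=> i; apply: (L1_Cc' hlam); apply: Cc_mull => //; have [] := I_kernel_Cc (@cK m i) (@K1 m i) (@K2 m i) (Lf i).
apply: eq_bigr => i _.
pose K' (z : V * V) := phi z.2 * Ker m i z.
have cK' : continuous K' by apply: cont_mul => //; exact: (cont_comp csnd).
have K'1 y x : `|p| + (rho + rho) + tau < `|y| -> K' (y, x) = 0 by move=> h; rewrite /K' K1 ?mulr0.
have K'2 y x : `|p| + (rho + rho) < `|x| -> K' (y, x) = 0 by move=> h; rewrite /K' K2 ?mulr0.
have [M _ QM] := pair_bounded (cQ i) (Q1 i) (Q2 i).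
have [M' _ KM'] := pair_bounded cK' K'1 K'2.
rewrite -(I_fubini hlam (cQ i) QM (Q2 i) (Lf i)).
transitivity (I (fun x => I (fun y => K' (y, x) * f i y))); last first.
  congr (intR _ _); apply/funext => x; rewrite -IZ.
    by congr (intR _ _); apply/funext => y; rewrite /K' mulrA.
  exact: (L1_kernel (@cK m i) (@K1 m i) (@K2 m i)).
rewrite -(I_fubini hlam cK' KM' K'2 (Lf i)).
congr (intR _ _); apply/funext => y; congr (_ * _).
rewrite -(@I_shift _ _ _ hlam (- y) (fun h => Q i (y, h))); last first.
  apply: (L1_Cc' hlam); split; last by exists tau; exact: Q2.
  by apply: (cont_comp (f := fun h : V => (y, h))) => //; apply: cont_pair; [exact: cont_cstv|exact: cont_id].
congr (intR _ _); apply/funext => x; rewrite /Q /K' /Ker /= [y + _]addrC subrK.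
have [xr|xr] := ltP rho `|x - p|; first by rewrite sphi// !mul0r mulr0.
by rewrite /th2 cutoff_in// mul1r mulrCA.
Qed.

(** In the direction e_j the gauged field W = G_j u inherits the shift invariance pointwise, since u
    is continuous, so its derivative is 0. Then u = H_j W is differentiable in that direction
    because H_j is, with derivative - A_j H_j W = - A_j u. *)
Lemma local_regularity : exists u : 'I_n -> V -> R, exists2 r : R, 0 < r &
  [/\ forall m, Cc (u m),
   forall m, {ae lam, forall x : Rd R d, `|(x : V) - p| <= r -> f m x = u m x} &
   forall x, `|x - p| < r -> forall i j,
     is_derive x (evec R j) (u i) (- \sum_k A j x i k * u k x)].
Proof.
have [u [rho /andP[rho0 rhor] [Cu hu]]] := kernel_representation.
have Lu m := L1_Cc' hlam (Cu m).
have r20 : 0 < rho / 2 by rewrite divr_gt0.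
have r2lt : rho / 2 < rho by rewrite ltr_pdivrMr// ltr_pMr// ltr1n.
have rhor1 : rho < r1 by apply: (le_lt_trans rhor); rewrite ltr_pdivrMr// ltr_pMr// ltr1n.
exists u, (rho / 2) => //; split => //.
  move=> m; have Lfu : L1 (fun x => f m x - u m x) by exact: L1B.
  suff : {ae lam, forall x : Rd R d, `|(x : V) - p| <= rho / 2 -> f m x - u m x = 0}.
    by apply: filterS => x h /h /eqP; rewrite subr_eq0 => /eqP.
  apply: (fundamental_ae Lfu r2lt) => phi cphi sphi.
  have Cphi := Cc_ball cphi sphi.
  under eq_fun do rewrite mulrBr.
  by rewrite IB ?hu ?subrr//; exact: L1_Cc_mul.
move=> x xr i j.
pose e := evec R j.
pose W l z := \sum_i gaugeG j z l i * u i z.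
have CW l : Cc (W l).
  by apply: Cc_sum => k; under eq_fun do rewrite mulrC; apply: Cc_mull => //; exact: gaugeG_cont.
(* Test functions of radius rho / 2 shifted by at most rho / 2 stay within radius rho, where f and u
   have the same integrals. *)
have hW l (t : R) y : `|t| <= rho / 2 -> `|y - p| < rho / 2 -> W l (y - t *: e) = W l y.
  move=> tr yr.
  have cWs : continuous (fun z : V => W l (z - t *: e)).
    exact: (@cont_shift R d (W l) (- (t *: e)) (CW l).1).
  apply/eqP; rewrite -subr_eq0; apply/eqP.
  apply: (@fundamental_pointwise _ _ _ hlam (fun z : V => W l (z - t *: e) - W l z) p (rho / 2)) yr.
    by apply: cont_sub => //; exact: (CW l).1.
  move=> phi cphi sphi.
  have Cphi := Cc_ball cphi sphi.
  have gE (chi : V -> R) : continuous chi -> (forall z, rho < `|z - p| -> chi z = 0) ->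
      I (fun z => chi z * gauged j l z) = I (fun z => chi z * W l z).
    move=> cchi schi.
    have schi1 z : r1 < `|z - p| -> chi z = 0 by move=> h; apply: schi; exact: lt_trans h.
    have Cchi := Cc_ball cchi schi.
    have CcG k : Cc (fun z => chi z * gaugeG j z l k) by apply: Cc_mull => //; exact: gaugeG_cont.
    rewrite I_gauged//.
    have -> : (fun z => chi z * W l z) = (fun z => \sum_k (chi z * gaugeG j z l k) * u k z).
      by apply/funext => z; rewrite mulr_sumr; apply: eq_bigr => k _; rewrite mulrA.
    rewrite I_sum; last by move=> k; exact: L1_Cc_mul.
    apply: eq_bigr => k _; apply: hu; first exact: (CcG k).1.
    by move=> z zr; rewrite schi// mul0r.
  have cs : continuous (fun z : V => phi (z + t *: e)) by exact: (@cont_shift R d phi (t *: e) cphi).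
  have ss z : rho < `|z - p| -> phi (z + t *: e) = 0.
    move=> zr; apply: (shift_support (rho := rho / 2) (tau := rho / 2) _ sphi).
      by rewrite (le_trans (norm_scale_evec _ _)).
    by rewrite -splitr.
  have := @shift_continuous phi j l (rho / 2) (rho / 2) t cphi sphi tr.
  rewrite -splitr => /(_ rhor1).
  rewrite (gE _ cs ss) gE//; last by move=> z zr; apply: sphi; exact: lt_trans zr.
  have -> : I (fun z => phi (z + t *: e) * W l z) = I (fun z => phi z * W l (z - t *: e)).
    rewrite -[RHS](I_shift hlam (t *: e)); first by congr (intR _ _); apply/funext => z; rewrite addrK.
    by apply: (L1_Cc' hlam); exact: Cc_mull.
  move=> E; under eq_fun do rewrite mulrBr.
  rewrite IB ?E ?subrr//; first by apply: (L1_Cc' hlam); exact: Cc_mull.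
  by apply: (L1_Cc' hlam); apply: Cc_mull => //; exact: (CW l).1.
have dW l : is_derive x e (W l) 0.
  apply/is_derive_line0.
  have h0 : is_derive (0 : R) 1 (fun _ : R => W l x) 0 by exact: is_derive_fun_cst.
  apply: near_eq_is_derive h0; apply/nbhs_normP; exists (rho / 2) => // t /=.
  rewrite sub0r normrN => /ltW tr.
  by rewrite -(hW l (- t) x) ?normrN// scaleNr opprK.
have uE k y : u k y = \sum_l gaugeH j y k l * W l y.
  transitivity (\sum_m (gaugeH j y *m gaugeG j y) k m * u m y).
    rewrite gaugeHG (bigD1 k)//= mxE eqxx mul1r big1 ?addr0// => m mk.
    by rewrite mxE eq_sym (negPf mk) mul0r.
  rewrite /W; under [RHS]eq_bigr do rewrite mulr_sumr.
  rewrite exchange_big /=; apply: eq_bigr => m _; rewrite mxE mulr_suml.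
  by apply: eq_bigr => l _; rewrite mulrA.
have [_ _ _ dH _] := gaugeP j.
have -> : u i = (fun y => \sum_l gaugeH j y i l * W l y) by apply/funext => y; exact: uE.
apply: (is_derive_eq (is_derive_funsum _ (dh := fun l => - (A j x *m gaugeH j x) i l * W l x + gaugeH j x i l * 0) _)).
  by move=> l _; apply: is_derive_funM.
under eq_bigr do rewrite mulr0 addr0 mulNr mxE mulr_suml.
rewrite sumrN exchange_big /=; congr (- _); apply: eq_bigr => k _.
by rewrite uE mulr_sumr; apply: eq_bigr => l _; rewrite mulrA.
Qed.

End LocalRegularity.

Section ContinuousAt.
Variables (R : realType) (T : topologicalType).
Implicit Types (f g : T -> R) (x : T).

Lemma cont_at_mul f g x : {for x, continuous f} -> {for x, continuous g} ->
  {for x, continuous (fun y => f y * g y)}.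
Proof. by move=> cf cg; apply: cvgM. Qed.

Lemma cont_at_sub f g x : {for x, continuous f} -> {for x, continuous g} ->
  {for x, continuous (fun y => f y - g y)}.
Proof. by move=> cf cg; apply: cvgB. Qed.

Lemma cont_at_opp f x : {for x, continuous f} -> {for x, continuous (fun y => - f y)}.
Proof. by move=> cf; apply: cvgN. Qed.

Lemma cont_at_sum (I : Type) (s : seq I) (h : I -> T -> R) x : (forall i, {for x, continuous (h i)}) ->
  {for x, continuous (fun y => \sum_(i <- s) h i y)}.
Proof. by move=> ch; apply: continuous_bigsum. Qed.

Lemma cont_at_near f g x : {for x, continuous f} -> (\forall y \near x, f y = g y) ->
  {for x, continuous g}.
Proof.
move=> cf fg; rewrite /prop_for /continuous_at -(nbhs_singleton fg).
by apply: cvg_trans cf; apply: near_eq_cvg.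
Qed.

End ContinuousAt.

Lemma cont_at_eps (R : realType) (W : normedModType R) (f : W -> R) x :
  (forall e : R, 0 < e -> exists2 del : R, 0 < del & forall y, `|x - y| < del -> `|f x - f y| <= e) ->
  {for x, continuous f}.
Proof.
move=> h; apply/cvgrPdist_le => e e0; have [del del0 hd] := h e e0.
by apply/nbhs_normP; exists del => // y; exact: hd.
Qed.

Lemma cutoff_mul_Cc (R : realType) d (p : 'rV[R]_d) (r s t : R) (g : 'rV[R]_d -> R) :
  r < s -> s < t -> (forall x, `|x - p| < t -> {for x, continuous g}) ->
  Cc (fun x => cutoff p r s x * g x).
Proof.
move=> rs st cg; split; last first.
  by apply: (@compactly_supported_shift _ _ _ p s) => x xs; rewrite cutoff_out ?mul0r// ltW.
move=> x; have [xt|xt] := ltP `|x - p| t.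
  by apply: cont_at_mul; [exact: (@cutoff_continuous R d p r s x)|exact: cg].
have c0 : {for x, continuous (fun _ : 'rV[R]_d => 0 : R)} by exact: cont_cst.
apply: (cont_at_near c0).
apply/nbhs_normP; exists (t - s); first by rewrite /= subr_gt0.
move=> y /= xy; rewrite cutoff_out ?mul0r//.
by have := lerB_dist (x - p) (y - p); rewrite opprB addrA subrK; have := xy; have := xt; lra.
Qed.

(** The points of U where u and v differ form an open set, and a nonempty open set contains a box of
    positive volume. *)
Lemma continuous_ae_eq (R : realType) d (lam : {measure set (Rd R d) -> \bar R})
    (hlam : is_lebesgue lam) (u v : 'rV[R]_d -> R) (U : set 'rV[R]_d) :
  open U -> (forall x, U x -> {for x, continuous u}) -> (forall x, U x -> {for x, continuous v}) ->
  {ae lam, forall x : Rd R d, U x -> u x = v x} -> forall x, U x -> u x = v x.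
Proof.
move=> oU cu cv [N [mN N0 hN]] x Ux; apply/eqP/negP => /negP uv.
pose W := [set y | U y /\ u y - v y != 0].
have oW : open W.
  rewrite openE => y [Uy uvy]; rewrite /interior.
  have c : {for y, continuous (fun z => u z - v z)} by apply: cont_at_sub; [exact: cu|exact: cv].
  have h1 : \forall z \near y, U z by apply: open_nbhs_nbhs.
  have h2 : \forall z \near y, u z - v z != 0.
    apply: (c [set z | z != 0]); apply: open_nbhs_nbhs; split => //; exact: open_neq.
  by near=> z; split; near: z.
have W0 : W !=set0 by exists x; split => //; rewrite subr_eq0.
have := lam_open_gt0 hlam oW W0; apply/negP; rewrite -leNgt -N0.
apply: le_measure; rewrite ?inE//; first exact: measurable_open.
by move=> y [Uy uvy]; apply: hN => /(_ Uy) /eqP; rewrite -subr_eq0 (negPf uvy).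
Unshelve. all: by end_near. Qed.

(** * From local solutions to a continuous representative on Omega *)

Section KernelRegularity.
Variables (R : realType) (d n : nat).
Local Notation V := 'rV[R]_d.
Local Notation Rdd := (Rd R d).
Variable lam : {measure set Rdd -> \bar R}.
Hypothesis hlam : is_lebesgue lam.
Local Notation I := (intR lam).
Local Notation L1 := (isL1 lam).
Variables (Om : set V) (B : tensor R n d).
Hypotheses (hopen : open Om) (hbdd : bounded_set Om).
Hypothesis hB : forall i j k, {within closure Om, continuous (B i j k)}.

Lemma bounded_domain : exists2 r : R, 0 < r & forall x, Om x -> `|x| <= r.
Proof.
have [M [_ hM]] := hbdd; exists (`|M| + 1); first by rewrite ltr_wpDl.
by apply: hM; rewrite (le_lt_trans (ler_norm M))// ltrDl.
Qed.

Lemma compact_closure : compact (closure Om).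
Proof.
have [r r0 hr] := bounded_domain.
apply: (@subclosed_compact _ (closure Om) [set x | `|x - 0| <= r]).
- exact: closed_closure.
- exact: compact_closed_ball.
- have -> : [set x | `|x - 0| <= r] = closure [set x : V | `|x - 0| <= r].
    by apply/closure_id; apply: compact_closed; [exact: norm_hausdorff|exact: compact_closed_ball].
  by apply: closure_subset => x /hr; rewrite /= subr0.
Qed.

Lemma tensor_bounded : exists2 M : R, 0 < M & forall i j k x, closure Om x -> `|B i j k x| <= M.
Proof.
have h i j k : exists2 M : R, 0 <= M & forall x, closure Om x -> `|B i j k x| <= M.
  have /compact_bounded [M [_ hM]] := continuous_compact (@hB i j k) compact_closure.
  exists (`|M| + 1); first by rewrite addr_ge0.
  move=> x xO; apply: (hM (`|M| + 1)); first by rewrite (le_lt_trans (ler_norm M))// ltrDl.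
  by exists x.
have h' (a : 'I_n * 'I_d * 'I_n) : {M : R | 0 <= M /\ forall x, closure Om x -> `|B a.1.1 a.1.2 a.2 x| <= M}.
  by apply/cid; have [M M0 hM] := h a.1.1 a.1.2 a.2; exists M.
exists (1 + \sum_a proj1_sig (h' a)).
  by rewrite ltr_pwDl// sumr_ge0// => a _; case: (svalP (h' a)).
move=> i j k x xO; have [_ hM] := svalP (h' (i, j, k)); rewrite (le_trans (hM x xO))//.
rewrite (bigD1 (i, j, k))//= addrCA lerDl addr_ge0// sumr_ge0// => a _.
by case: (svalP (h' a)).
Qed.

Lemma tensor_continuous i j k x : Om x -> {for x, continuous (B i j k)}.
Proof.
move=> Ox; have h := continuous_subspaceW (@subset_closure _ Om) (@hB i j k).
by rewrite continuous_open_subspace// in h; apply: h; rewrite inE.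
Qed.

Variable mu : 'I_n -> Rdd -> R.
Hypothesis hmu : in_kernel lam Om B mu.

Definition extended (i : 'I_n) : V -> R := (mu i : V -> R) \_ Om.
Definition extended_tensor i j k : V -> R := (B i j k) \_ Om.

(** Omega is bounded, hence of finite measure, and |t| <= 1 + t^2. *)
Lemma L1_extended i : L1 (extended i).
Proof.
have [mmu [mu2 _]] := hmu.
have mO : measurable (Om : set Rdd) by exact: measurable_open.
apply/(L1_restrict _ _ mO).
have [r r0 hr] := bounded_domain.
have lO := lam_bounded_lty hlam mO hr.
have mi := mmu i.
have m2 : measurable_fun (Om : set Rdd) (fun x => ((mu i x) ^+ 2)%:E).
  by apply/measurable_EFinP; exact: measurable_funX.
apply/integrableP; split; first by apply/measurable_EFinP; exact: mi.
apply: (@le_lt_trans _ _ (\int[lam]_(x in (Om : set Rdd)) (1%:E + ((mu i x) ^+ 2)%:E))%E).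
  apply: ge0_le_integral => //.
  - by apply: measurableT_comp => //; apply/measurable_EFinP.
  - by apply: emeasurable_funD.
  - move=> x _; rewrite /= -EFinD lee_fin.
    by rewrite -[X in _ <= 1 + X]real_normK ?num_real//; have := sqr_ge0 (`|mu i x| - 1); nra.
rewrite ge0_integralD//; last by move=> x _; rewrite lee_fin sqr_ge0.
by rewrite integral_cst// mul1e lte_add_pinfty// mu2.
Qed.

Lemma measurable_extended_tensor i j k : measurable_fun [set: Rdd] (extended_tensor i j k : Rdd -> R).
Proof.
have mO : measurable (Om : set Rdd) by exact: measurable_open.
apply/(measurable_restrictT (B i j k : Rdd -> R) mO).
by apply: measurable_cont => // x; exact: tensor_continuous.
Qed.

Definition extended_rhs i j x := \sum_k extended_tensor i j k x * extended k x.

Lemma L1_extended_rhs i j : L1 (extended_rhs i j).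
Proof.
apply: L1_sum => k; have [M M0 hM] := tensor_bounded.
apply: (L1_mul_bounded (@measurable_extended_tensor i j k) (M := M)) (L1_extended k) => x.
rewrite /extended_tensor patchE; case: ifPn => [xO|_]; last by rewrite normr0 ltW.
by apply: hM; apply: subset_closure; rewrite inE in xO.
Qed.

Lemma test_fun_Cc phi : test_fun Om phi -> Cc phi.
Proof.
move=> [sphi [K [_ [KO hK]]]]; split; first by have [] := sphi [::].
have [r r0 hr] := bounded_domain; exists r => x xr; apply: hK => /KO /hr.
by rewrite leNgt xr.
Qed.

Lemma extended_weak i j phi : test_fun Om phi ->
  I (fun x => extended i x * 'D_(evec R j) phi x) = I (fun x => extended_rhs i j x * phi x).
Proof.
move=> tphi; have [sphi _] := tphi; have Cphi := test_fun_Cc tphi.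
have Cdphi : Cc ('D_(evec R j) phi).
  by apply: (Cc_derive Cphi) => [|x]; [have [] := sphi [:: evec R j]|exact: smooth_derive].
have [_ [_ /(_ phi tphi i j) /(congr1 fine)]] := hmu.
rewrite -(I_restrict lam Om (fun x => _)) /=.
have -> : (fun x : V => - (mu i x * 'D_(evec R j) phi x) + (\sum_k B i j k x * mu k x) * phi x) \_ Om =
  (fun x => phi x * extended_rhs i j x - 'D_(evec R j) phi x * extended i x).
  apply/funext => x; rewrite patchE /extended_rhs /extended_tensor /extended.
  case: ifPn => xO.
    rewrite patchE xO addrC; congr (_ - _); last exact: mulrC.
    by rewrite mulrC; congr (_ * _); apply: eq_bigr => k _; rewrite !patchE xO.
  rewrite patchE (negPf xO) big1 ?mulr0 ?subrr// => k _.
  by rewrite patchE (negPf xO) mul0r.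
rewrite IB; [|exact: L1_Cc_mul Cphi (L1_extended_rhs i j)|exact: L1_Cc_mul Cdphi (L1_extended i)].
move/eqP; rewrite subr_eq0 => /eqP E; rewrite I_mulC -E; exact: I_mulC.
Qed.

Definition local_solution p (u : 'I_n -> V -> R) (r : R) :=
  [/\ 0 < r, forall x, `|x - p| < r -> Om x, forall m, Cc (u m),
   forall m, {ae lam, forall x : Rdd, `|(x : V) - p| < r -> mu m x = u m x} &
   forall x, `|x - p| < r -> forall i j,
     is_derive x (evec R j) (u i) (- \sum_k B i j k x * u k x)].

Lemma local_solution_exists p : Om p -> exists u r, local_solution p u r.
Proof.
move=> Op; have /nbhs_normP [r0 /= r00 hr0] : nbhs p Om by exact: open_nbhs_nbhs.
have inO x : `|x - p| < r0 -> Om x by move=> h; apply: hr0; rewrite /= distrC.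
(* The coefficients are cut off between r1 and r0 / 2, inside the ball where B is continuous; they
   equal B up to radius r1, where the test functions live. *)
pose r1 := r0 / 4.
have r10 : 0 < r1 by rewrite divr_gt0.
have r12 : r1 < r0 / 2 by rewrite ltr_pM2l// ltf_pV2 ?posrE// ltr_nat.
have r20 : r0 / 2 < r0 by rewrite ltr_pdivrMr// ltr_pMr// ltr1n.
pose A j x : 'M[R]_n := \matrix_(i, k) (cutoff p r1 (r0 / 2) x * B i j k x).
have cA j i k : Cc (fun x => A j x i k).
  under eq_fun do rewrite mxE.
  by apply: cutoff_mul_Cc r20 _ => // x /inO; exact: tensor_continuous.
have AE j x i k : `|x - p| <= r1 -> A j x i k = B i j k x.
  by move=> xr; rewrite mxE cutoff_in// mul1r.
have r10' : r1 < r0 by exact: lt_trans r20.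
have inO1 x : `|x - p| <= r0 / 2 -> Om x by move=> h; apply: inO; exact: le_lt_trans r20.
have Hweak i j (psi dpsi : V -> R) : continuous psi -> continuous dpsi ->
    (forall x, is_derive x (evec R j) psi (dpsi x)) -> (forall x, r1 < `|x - p| -> psi x = 0) ->
    I (fun x => dpsi x * extended i x) = I (fun x => psi x * \sum_k A j x i k * extended k x).
  move=> cpsi cdpsi dpsiP spsi.
  rewrite (weak_extension hlam (L1_extended i) (L1_extended_rhs i j) _ r12 inO1 cpsi cdpsi dpsiP spsi); last first.
    exact: extended_weak.
  congr (intR _ _); apply/funext => x.
  have [xr|xr] := ltP r1 `|x - p|; first by rewrite spsi// !mul0r.
  congr (_ * _); apply: eq_bigr => k _; rewrite AE// /extended_tensor patchE.
  by rewrite ifT// inE; apply: inO; exact: le_lt_trans r10'.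
have [u [r r_gt0 [Cu hu du]]] := local_regularity hlam L1_extended cA r10 Hweak.
exists u, (Num.min r r1); split => //.
- by rewrite lt_min r_gt0.
- by move=> x; rewrite lt_min => /andP[_ xr]; apply: inO; exact: lt_trans r10'.
- move=> m; apply: filterS (hu m) => x h; rewrite lt_min => /andP[xr xr1].
  rewrite -h ?ltW// /extended patchE ifT// inE; apply: inO; exact: lt_trans r10'.
- move=> x; rewrite lt_min => /andP[xr xr1] i j; apply: (is_derive_eq (du x xr i j)).
  by congr (- _); apply: eq_bigr => k _; rewrite AE// ltW.
Qed.

(** Two local solutions agree on the overlap of their balls, being continuous and both equal to [mu]
    almost everywhere. Hence u(x), the value at x of the solution centred at x, coincides near every
    p with the single solution centred at p. *)
Lemma kernel_regularity : exists u : 'I_n -> V -> R,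
  [/\ forall m x, Om x -> {for x, continuous (u m)},
   forall x, Om x -> forall i j, is_derive x (evec R j) (u i) (- \sum_k B i j k x * u k x) &
   Defs.ae_eq lam Om mu u].
Proof.
have loc p : {ur : ('I_n -> V -> R) * R | Om p -> local_solution p ur.1 ur.2}.
  apply/cid; have [Op|nOp] := pselect (Om p); last by exists (fun _ _ => 0, 0).
  by have [u [r h]] := local_solution_exists Op; exists (u, r).
pose lu p := (sval (loc p)).1; pose lr p := (sval (loc p)).2.
have locP p : Om p -> local_solution p (lu p) (lr p) by exact: (svalP (loc p)).
pose u m x := lu x m x.
have ocb p (r : R) : open [set x : V | `|x - p| < r].
  have := @ball_open R V p r; rewrite -ball_normE /ball_ /=.
  by congr open; apply/seteqP; split => x /=; rewrite distrC.
have uE p m x : Om p -> `|x - p| < lr p -> u m x = lu p m x.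
  move=> Op xp; have [rp hp Cp aep _] := locP p Op.
  have Ox := hp x xp; have [rx hx Cx aex _] := locP x Ox.
  rewrite /u; apply: (@continuous_ae_eq R d lam hlam (lu x m) (lu p m) ([set y | `|y - p| < lr p] `&` [set y | `|y - x| < lr x]))%classic.
  - by apply: openI; exact: ocb.
  - by move=> y _; exact: (Cx m).1.
  - by move=> y _; exact: (Cp m).1.
  - by apply: filterS2 (aep m) (aex m) => y h1 h2 [y1 y2]; rewrite -h1// -h2.
  - by split; rewrite //= subrr normr0.
have unear p m : Om p -> \forall x \near p, lu p m x = u m x.
  move=> Op; have [rp _ _ _ _] := locP p Op.
  by apply/nbhs_normP; exists (lr p) => // y /=; rewrite distrC => yp; rewrite (uE p).
exists u; split.
- move=> m x Ox; have [_ _ Cx _ _] := locP x Ox.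
  by apply: (cont_at_near _ (unear x m Ox)); exact: (Cx m).1.
- move=> x Ox i j; have [rx _ _ _ dx] := locP x Ox.
  apply: (near_eq_is_derive (unear x i Ox)).
  have h : `|x - x| < lr x by rewrite subrr normr0.
  exact: (is_derive_eq (dx x h i j)).
- move=> m.
  (* Equality almost everywhere must survive a union over all centres p: each rational box contained
     in some local ball contributes one null set, there are countably many, and every point of Omega
     lies in such a box. *)
  pose good k p := Om p /\ forall y, rational_box k y -> `|y - p| < lr p.
  have : {ae lam, forall x : Rdd, forall k, (exists p, good k p) -> rational_box k x -> mu m x = u m x}.
    apply: ae_foralln => k; have [[p [Op hp]]|np] := pselect (exists p, good k p).
      have [_ _ _ aep _] := locP p Op; apply: filterS (aep m) => y h _ ky.
      by rewrite h ?(uE p)//; exact: hp.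
    by apply: aeW => x h; case: np.
  apply: filterS => x h Ox; have [rx _ _ _ _] := locP x Ox.
  have [k [kx hk]] := rational_box_nbhs x rx.
  by apply: (h k) => //; exists x; split => // y /hk; rewrite distrC.
Qed.

End KernelRegularity.

(** * Chain rule, paths and transport *)

Lemma is_derive_increment (R : realType) (V W : normedModType R) (f : V -> W) x v c :
  is_derive x v f c -> forall e : R, 0 < e -> exists2 del : R, 0 < del &
  forall h : R, `|h| < del -> `|f (x + h *: v) - f x - h *: c| <= e * `|h|.
Proof.
move=> [df E] e e0; move: df; rewrite /derivable => /cvg_ex[l hl].
have {}E : c = l by rewrite -E; apply: cvg_lim hl; exact: norm_hausdorff.
move/cvgrPdist_le: hl => /(_ e e0) [del /= del0 hd].
exists del => // h hdel; have [->|h0] := eqVneq h 0.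
  by rewrite scale0r addr0 subrr scale0r subrr !normr0 mulr0.
have := hd h; rewrite /ball_ /= sub0r normrN => /(_ hdel h0).
have -> : f (x + h *: v) - f x - h *: c = - (h *: (l - h^-1 *: (f (h *: v + x) - f x))).
  by rewrite scalerBr scalerA mulfV// scale1r E opprB addrC [x + _]addrC [in RHS]addrC addrC.
by rewrite normrN normrZ mulrC => H; rewrite ler_wpM2r.
Qed.

Lemma is_derive_rowP (R : realType) (m : nat) (f : R -> 'rV[R]_m) (t : R) w :
  is_derive t 1 f w <-> forall i, is_derive t 1 (fun s => f s ord0 i) (w ord0 i).
Proof.
split=> [[df E] i|h].
  have dfi := (derivable_mxP f t 1).1 df.
  by split; [exact: dfi|rewrite -E (derive_mx df) mxE].
have df : derivable f t 1 by apply/derivable_mxP => i j; rewrite ord1; case: (h j).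
split => //; rewrite (derive_mx df); apply/rowP => i; rewrite mxE; by case: (h i).
Qed.

Section ChainRule.
Variables (R : realType) (d : nat).
Local Notation V := 'rV[R]_d.
Variables (U : set V) (u : V -> R) (g : 'I_d -> V -> R).
Hypotheses (oU : open U) (du : forall y, U y -> forall j, is_derive y (evec R j) u (g j y))
  (cg : forall j y, U y -> {for y, continuous (g j)}).

Lemma norm_stairs_shift (s : seq 'I_d) (h : V) : `|stairs_shift s h| <= (size s)%:R * `|h|.
Proof.
elim: s => [|j s IH]; first by rewrite /stairs_shift big_nil normr0 mul0r.
have E : (size s).+1%:R * `|h| = `|h| + (size s)%:R * `|h| :> R.
  by rewrite -natr1 mulrDl mul1r addrC.
rewrite /stairs_shift big_cons /= E (le_trans (ler_normD _ _))// lerD//.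
by rewrite (le_trans (norm_scale_evec _ _))// coord_le_norm.
Qed.

(** Go from x to x + h along the axes: on each of the d edges the mean value theorem applies and the
    partial derivative is within e / (d + 1) of its value at x. *)
Lemma partials_increment x : U x -> forall e : R, 0 < e -> exists2 del : R, 0 < del &
  forall h, `|h| < del -> `|u (x + h) - u x - \sum_j h ord0 j * g j x| <= e * `|h|.
Proof.
move=> Ux e e0.
pose e' := e / d.+1%:R; have e'0 : 0 < e' by rewrite divr_gt0.
have : \forall y \near x, U y /\ forall j, `|g j y - g j x| <= e'.
  apply: filterI; first exact: open_nbhs_nbhs.
  apply: (@filter_forall _ _ (fun j y => `|g j y - g j x| <= e') (nbhs x) _) => j.
  by have /cvgrPdist_le/(_ e' e'0) := @cg j x Ux; apply: filterS => y; rewrite distrC.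
move=> /nbhs_normP[del /= del0 hdel].
have hy y : `|y - x| < del -> U y /\ forall j, `|g j y - g j x| <= e'.
  by move=> yx; apply: hdel; rewrite /= distrC.
exists (del / d.+1%:R); first by rewrite divr_gt0.
move=> h; rewrite ltr_pdivlMr// => hd.
have key (s : seq 'I_d) : (size s <= d)%N ->
   `|u (x + stairs_shift s h) - u x - \sum_(j <- s) h ord0 j * g j x| <= (size s)%:R * (`|h| * e').
  elim: s => [|j s IH] sd.
    by rewrite /stairs_shift !big_nil addr0 subrr subr0 normr0 mul0r.
  have E : (size s).+1%:R * (`|h| * e') = `|h| * e' + (size s)%:R * (`|h| * e') :> R.
    by rewrite -natr1 mulrDl mul1r addrC.
  pose z := x + stairs_shift s h.
  have -> : x + stairs_shift (j :: s) h = z + h ord0 j *: evec R j.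
    by rewrite /z /stairs_shift big_cons [_ *: _ + _]addrC addrA.
  rewrite big_cons /= E.
  have -> : u (z + h ord0 j *: evec R j) - u x - (h ord0 j * g j x + \sum_(j <- s) h ord0 j * g j x) =
     (u (z + h ord0 j *: evec R j) - u z - h ord0 j * g j x) +
     (u z - u x - \sum_(j <- s) h ord0 j * g j x) by ring.
  rewrite (le_trans (ler_normD _ _))// lerD//; last by apply: IH; exact: ltnW.
  have zin (t : R) : `|t| <= `|h ord0 j| -> `|z + t *: evec R j - x| < del.
    move=> th; apply: le_lt_trans hd.
    have -> : z + t *: evec R j - x = t *: evec R j + stairs_shift s h.
      by rewrite /z addrC addrA addrA addNr add0r addrC.
    rewrite (le_trans (ler_normD _ _))//.
    have -> : `|h| * d.+1%:R = `|h| + d%:R * `|h| :> R by rewrite -natr1 mulrC mulrDl mul1r addrC.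
    rewrite lerD//.
      by rewrite (le_trans (norm_scale_evec _ _))// (le_trans th)// coord_le_norm.
    by rewrite (le_trans (norm_stairs_shift _ _))// ler_wpM2r// ler_nat ltnW.
  apply: (@le_trans _ _ (`|h ord0 j| * e')); last first.
    by rewrite ler_wpM2r ?(ltW e'0)// coord_le_norm.
  apply: line_increment => t th; first by apply: du; exact: (hy _ (zin t th)).1.
  exact: (hy _ (zin t th)).2.
have := key (enum 'I_d); rewrite size_enum_ord stairs_shift_enum big_enum /= => /(_ (leqnn _)) H.
apply: (le_trans H); rewrite mulrCA [e * _]mulrC ler_wpM2l// /e' mulrCA ler_piMr ?(ltW e0)//.
by rewrite ler_pdivrMr ?mul1r ?ler_nat.
Qed.

Lemma chain_rule (gam : R -> V) (t : R) dgam : U (gam t) -> is_derive t 1 gam dgam ->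
  is_derive t 1 (fun s => u (gam s)) (\sum_j dgam ord0 j * g j (gam t)).
Proof.
move=> Ut hgam; apply: is_derive_quot => e e0.
pose C := `|dgam| + 1; have C0 : 0 < C by rewrite ltr_wpDl.
pose S := \sum_j `|g j (gam t)|; have S0 : 0 <= S by rewrite sumr_ge0.
(* The bound by 1 keeps the increment of the curve below C |h|; the other bound makes its
   linearisation error, weighted by the partial derivatives, cost at most half of e. *)
pose e2 := Num.min 1 (e / 2 / (S + 1)).
have e20 : 0 < e2 by rewrite lt_min ltr01 !divr_gt0// ltr_wpDl.
have e1 : 0 < e / 2 / C by rewrite !divr_gt0.
have [del1 del10 h1] := partials_increment Ut e1.
have [del2 del20 h2] := is_derive_increment hgam e20.
exists (Num.min del2 (del1 / C)); first by rewrite lt_min del20 divr_gt0.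
move=> h h0; rewrite lt_min => /andP[hd2 hd1]; rewrite ltr_pdivlMr// in hd1.
pose D := gam (t + h *: 1) - gam t.
have hD : `|D - h *: dgam| <= e2 * `|h| by exact: h2.
have e21 : e2 * `|h| <= `|h| by rewrite ler_piMl// ge_min lexx.
have DC : `|D| <= C * `|h|.
  have -> : D = (D - h *: dgam) + h *: dgam by rewrite subrK.
  rewrite (le_trans (ler_normD _ _))// normrZ /C mulrDl mul1r [leRHS]addrC [`|dgam| * _]mulrC lerD//.
  exact: le_trans hD e21.
have H1 := h1 D.
have E1 : gam t + D = gam (t + h *: 1) by rewrite /D addrC subrK.
rewrite E1 in H1.
have E : u (gam (h *: 1 + t)) - u (gam t) - h * \sum_j dgam ord0 j * g j (gam t) =
  (u (gam (t + h *: 1)) - u (gam t) - \sum_j D ord0 j * g j (gam t)) +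
  \sum_j (D - h *: dgam) ord0 j * g j (gam t).
  rewrite [t + _]addrC; have -> : \sum_j (D - h *: dgam) ord0 j * g j (gam t) =
    \sum_j D ord0 j * g j (gam t) - h * \sum_j dgam ord0 j * g j (gam t).
    by rewrite mulr_sumr -sumrB; apply: eq_bigr => j _; rewrite !mxE; ring.
  by rewrite addrA subrK.
rewrite E (le_trans (ler_normD _ _))// (splitr e) mulrDl lerD//.
  apply: (le_trans (H1 _)); first by rewrite (le_lt_trans DC)// mulrC.
  have -> : e / 2 * `|h| = e / 2 / C * (C * `|h|) by rewrite mulrA divfK ?gt_eqF.
  by rewrite ler_wpM2l// ltW.
rewrite (le_trans (ler_norm_sum _ _ _))//.
apply: (@le_trans _ _ (\sum_j e2 * `|h| * `|g j (gam t)|)).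
  apply: ler_sum => j _; rewrite normrM ler_wpM2r// (le_trans _ hD)//; exact: coord_le_norm.
rewrite -mulr_sumr -/S mulrAC ler_wpM2r//.
apply: (@le_trans _ _ (e / 2 / (S + 1) * S)); first by rewrite ler_wpM2r// ge_min lexx orbT.
by rewrite mulrAC ler_pdivrMr ?ltr_wpDl// ler_wpM2l ?divr_ge0 ?(ltW e0)// lerDl.
Qed.

End ChainRule.

(** * A reparametrisation of the unit interval that is flat at both ends *)

Section SmoothStep.
Variable R : realType.

Definition clamp (t : R) : R := Num.max 0 (Num.min 1 t).

Lemma clamp_continuous : continuous clamp.
Proof. by apply: cont_max; [exact: cont_cst|apply: cont_min; [exact: cont_cst|exact: cont_id]]. Qed.

Lemma clamp_in t : 0 <= clamp t <= 1.
Proof. by rewrite /clamp le_max lexx /= ge_max ler01 ge_min lexx. Qed.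

Lemma clamp_id t : 0 <= t <= 1 -> clamp t = t.
Proof. by move=> /andP[t0 t1]; rewrite /clamp min_r// max_r. Qed.

Lemma clamp_ge1 t : 1 <= t -> clamp t = 1.
Proof. by move=> t1; rewrite /clamp min_l// max_r. Qed.

Lemma clamp_le0 t : t <= 0 -> clamp t = 0.
Proof. by move=> t0; rewrite /clamp min_r ?max_l// (le_trans t0). Qed.

(** Equal to 6 t (1 - t) on [0, 1] and 0 elsewhere. Its primitive 3 t^2 - 2 t^3 rises from 0 to 1
    with zero slope at both ends, so reparametrised paths can be joined in a C^1 way. *)
Definition dstep (t : R) : R := 6 * (clamp t * (1 - clamp t)).
Definition step : R -> R := primitive dstep.

Lemma dstep_continuous : continuous dstep.
Proof.
apply: cont_mul; first exact: cont_cst.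
by apply: cont_mul; [exact: clamp_continuous|apply: cont_sub; [exact: cont_cst|exact: clamp_continuous]].
Qed.

Lemma is_derive_step (t : R) : is_derive t 1 step (dstep t).
Proof. exact: is_derive_primitive dstep_continuous. Qed.

Lemma dstep_ge0 t : 0 <= dstep t.
Proof. by have /andP[h0 h1] := clamp_in t; rewrite /dstep !mulr_ge0// subr_ge0. Qed.

Lemma dstep_ge1 t : 1 <= t -> dstep t = 0.
Proof. by move=> t1; rewrite /dstep clamp_ge1// subrr !mulr0. Qed.

Lemma dstep_le0 t : t <= 0 -> dstep t = 0.
Proof. by move=> t0; rewrite /dstep clamp_le0// mul0r mulr0. Qed.

Lemma step0 : step 0 = 0. Proof. exact: primitive0. Qed.

Lemma step_le0 (t : R) : t <= 0 -> step t = 0.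
Proof.
move=> t0; rewrite -step0; apply/esym/derive_zero_eq => // s /andP[_ s0].
by rewrite -(dstep_le0 s0); exact: is_derive_step.
Qed.

Lemma step1 : step 1 = 1.
Proof.
pose q (t : R) := step t - (3 * (t * t) - 2 * (t * (t * t))).
suff : q 1 = q 0 by rewrite /q step0; lra.
apply: derive_zero_eq => // t t01.
have h (s : R) : is_derive s 1 (fun x : R => x) 1 by exact: is_derive_id.
have h2 := is_derive_funM (h t) (h t).
have h3 := is_derive_funM (h t) h2.
have hc (c : R) : is_derive t 1 (fun _ : R => c) 0 by exact: is_derive_fun_cst.
apply: (is_derive_eq (is_derive_funB (is_derive_step t) (is_derive_funB (is_derive_funM (hc 3) h2) (is_derive_funM (hc 2) h3)))).
by rewrite /dstep clamp_id//; ring.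
Qed.

Lemma step_ge1 t : 1 <= t -> step t = 1.
Proof.
move=> t1; rewrite -[RHS]step1; apply: derive_zero_eq => // s /andP[s1 _].
by rewrite -(dstep_ge1 s1); exact: is_derive_step.
Qed.

Lemma step_in t : 0 <= step t <= 1.
Proof.
have mono (a b : R) : a <= b -> step a <= step b.
  by move=> ab; apply: (derive_ge0_le ab (df := dstep)) => s _; [exact: is_derive_step|exact: dstep_ge0].
apply/andP; split.
  by have [t0|t0] := leP t 0; [rewrite step_le0|rewrite -step0 mono// ltW].
by have [t1|t1] := leP 1 t; [rewrite step_ge1|rewrite -[leRHS]step1 mono// ltW].
Qed.

End SmoothStep.

Section RowDerivatives.
Variables (R : realType) (m : nat).
Implicit Types (f g : R -> 'rV[R]_m).

Lemma is_derive_rowD f g (t : R) a b : is_derive t 1 f a -> is_derive t 1 g b ->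
  is_derive t 1 (fun s => f s + g s) (a + b).
Proof. exact: is_deriveD. Qed.

Lemma is_derive_rowB f g (t : R) a b : is_derive t 1 f a -> is_derive t 1 g b ->
  is_derive t 1 (fun s => f s - g s) (a - b).
Proof. exact: is_deriveB. Qed.

Lemma is_derive_row_cst (c : 'rV[R]_m) (t : R) : is_derive t 1 (fun _ : R => c) 0.
Proof. exact: is_derive_cst. Qed.

Lemma is_derive_row_comp f (h : R -> R) (t c : R) a : is_derive (h t) 1 f a -> is_derive t 1 h c ->
  is_derive t 1 (fun s => f (h s)) (c *: a).
Proof.
move=> /is_derive_rowP hf hh; apply/is_derive_rowP => i.
have H := @is_derive1_comp R (fun s => f s ord0 i) h t _ _ (hf i) hh.
by apply: (is_derive_eq H); rewrite mxE mulrC.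
Qed.

Lemma is_derive_row_continuous f (t : R) a : is_derive t 1 f a -> {for t, continuous f}.
Proof. by case=> /derivable1_diffP/differentiable_continuous. Qed.

End RowDerivatives.

Lemma is_derive_affine (R : realType) (a b t : R) : is_derive t 1 (fun s : R => a * s + b) a.
Proof.
have h : is_derive t 1 (fun x : R => x) 1 by exact: is_derive_id.
have hc (c : R) : is_derive t 1 (fun _ : R => c) 0 by exact: is_derive_fun_cst.
by apply: (is_derive_eq (is_derive_funD (is_derive_funM (hc a) h) (hc b))); ring.
Qed.

Section Paths.
Variables (R : realType) (d : nat).
Local Notation V := 'rV[R]_d.
Variable Om : set V.
Hypothesis hopen : open Om.
Implicit Types (x y z : V) (g : R -> V).

Lemma path_inP x y g dg : (forall t : R, is_derive t 1 g (dg t)) -> continuous dg ->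
  (forall t : R, 0 <= t <= 1 -> Om (g t)) -> g 0 = x -> g 1 = y -> path_in Om x y g.
Proof.
move=> hg cdg gO g0 g1; split; first by move=> t; case: (hg t).
split=> //; rewrite (_ : (fun t : R => 'D_1 g t) = dg)//.
by apply/funext => t; case: (hg t).
Qed.

Lemma path_in_derive x y g (t : R) : path_in Om x y g -> is_derive t 1 g ('D_1 g t).
Proof. by case=> h _; apply: derivableP; exact: h. Qed.

(** On each half of [0, 1] one of the two summands rests at y, and subtracting y leaves the other. A
    sum instead of a case distinction is differentiable at the junction by the usual rules. *)
Definition concat y (g1 g2 : R -> V) (t : R) : V :=
  g1 (step (2 * t + 0)) + g2 (step (2 * t + - 1)) - y.

Lemma concat_le y g1 g2 t : g2 0 = y -> t <= 1 / 2 -> concat y g1 g2 t = g1 (step (2 * t + 0)).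
Proof. by move=> g2y th; rewrite /concat (@step_le0 _ (2 * t + -1)) ?g2y ?addrK//; lra. Qed.

Lemma concat_ge y g1 g2 t : g1 1 = y -> 1 / 2 <= t -> concat y g1 g2 t = g2 (step (2 * t + - 1)).
Proof. by move=> g1y th; rewrite /concat (@step_ge1 _ (2 * t + 0)) ?g1y 1?addrC ?addKr//; lra. Qed.

Lemma is_derive_step_affine (m : nat) (f : R -> 'rV[R]_m) (b t : R) a :
  is_derive (step (2 * t + b)) 1 f a ->
  is_derive t 1 (fun s => f (step (2 * s + b))) ((dstep (2 * t + b) * 2) *: a).
Proof.
move=> hf; apply: (is_derive_row_comp (h := fun s => step (2 * s + b)) hf).
exact: (@is_derive1_comp R (@step R) (fun s => 2 * s + b) t _ _ (is_derive_step _) (is_derive_affine _ _ _)).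
Qed.

Lemma is_derive_concat x y z g1 g2 (t : R) : path_in Om x y g1 -> path_in Om y z g2 ->
  is_derive t 1 (concat y g1 g2)
    ((dstep (2 * t + 0) * 2) *: 'D_1 g1 (step (2 * t + 0)) +
     (dstep (2 * t + - 1) * 2) *: 'D_1 g2 (step (2 * t + - 1))).
Proof.
move=> p1 p2.
have h1 := is_derive_step_affine (path_in_derive (step (2 * t + 0)) p1).
have h2 := is_derive_step_affine (path_in_derive (step (2 * t + - 1)) p2).
apply: (is_derive_eq (is_derive_rowB (is_derive_rowD h1 h2) (is_derive_row_cst y t))).
by rewrite subr0.
Qed.

Lemma concat_path x y z g1 g2 : path_in Om x y g1 -> path_in Om y z g2 ->
  path_in Om x z (concat y g1 g2).
Proof.
move=> p1 p2; case: (p1) => _ [cd1 [in1 [g1x g1y]]]; case: (p2) => _ [cd2 [in2 [g2y g2z]]].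
have cstep : continuous (@step R).
  by move=> t; exact: (is_derive1_continuous (is_derive_step t)).
have caff (b : R) : continuous (fun t : R => 2 * t + b).
  by apply: cont_add; [apply: cont_mul; [exact: cont_cst|exact: cont_id]|exact: cont_cst].
have cs (b : R) : continuous (fun t : R => step (2 * t + b)) by apply: cont_comp cstep.
have cds (b : R) : continuous (fun t : R => dstep (2 * t + b) * 2).
  by apply: cont_mul; [apply: cont_comp (@dstep_continuous R)|exact: cont_cst].
apply: (path_inP (fun t => is_derive_concat t p1 p2)).
- apply: cont_addv.
    by apply: cont_scalev; [exact: cds|apply: cont_comp cd1; exact: cs].
  by apply: cont_scalev; [exact: cds|apply: cont_comp cd2; exact: cs].
- move=> t _; have [th|th] := leP t (1 / 2).
    by rewrite concat_le//; apply: in1; exact: step_in.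
  by rewrite concat_ge ?(ltW th)//; apply: in2; exact: step_in.
- by rewrite concat_le ?mulr0 ?addr0 ?step0//; lra.
- by rewrite concat_ge ?step_ge1//; lra.
Qed.

Definition segment_path x y (t : R) : V := x + t *: (y - x).

Lemma is_derive_segment x y (t : R) : is_derive t 1 (segment_path x y) (y - x).
Proof.
have h : is_derive t 1 (fun x : R => x) 1 by exact: is_derive_id.
apply/is_derive_rowP => i.
have hc (c : R) : is_derive t 1 (fun _ : R => c) 0 by exact: is_derive_fun_cst.
rewrite (_ : (fun s => _) = (fun s : R => x ord0 i + s * (y - x) ord0 i)); last first.
  by apply/funext => s; rewrite !mxE.
apply: (is_derive_eq (is_derive_funD (hc _) (is_derive_funM h (hc _)))).
by rewrite add0r mul1r mulr0 addr0.
Qed.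

Lemma segment_path_in x y : (forall t : R, 0 <= t <= 1 -> Om (segment_path x y t)) ->
  path_in Om x y (segment_path x y).
Proof.
move=> sO; apply: (path_inP (is_derive_segment x y)) => //; first exact: cont_cstv.
  by rewrite /segment_path scale0r addr0.
by rewrite /segment_path scale1r addrC subrK.
Qed.

Lemma ball_segment_path p x y (r : R) : (forall z, `|z - p| < r -> Om z) ->
  `|x - p| < r -> `|y - p| < r -> path_in Om x y (segment_path x y).
Proof.
move=> hr xr yr; apply: segment_path_in => t /andP[t0 t1]; apply: hr.
have -> : segment_path x y t - p = (1 - t) *: (x - p) + t *: (y - p).
  by apply/rowP => i; rewrite !mxE; ring.
rewrite (le_lt_trans (ler_normD _ _))// !normrZ ger0_norm ?subr_ge0// ger0_norm//.
have [t00|t00] := eqVneq t 0; first by rewrite t00 subr0 mul1r mul0r addr0.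
have t0' : 0 < t by rewrite lt_def t00.
have -> : r = (1 - t) * r + t * r by ring.
by rewrite ler_ltD ?ltr_pM2l// ler_wpM2l ?subr_ge0// ltW.
Qed.

Lemma open_ball_in p : Om p -> exists2 r : R, 0 < r & forall z, `|z - p| < r -> Om z.
Proof.
move=> Op; have /nbhs_normP [r /= r0 hr] : nbhs p Om by exact: open_nbhs_nbhs.
by exists r => // z zp; apply: hr; rewrite /= distrC.
Qed.

(** The set of points reachable from x is nonempty, open and closed in Omega; segments in small
    balls give both properties. *)
Lemma path_connected : connected Om -> forall x y, Om x -> Om y -> exists g, path_in Om x y g.
Proof.
move=> conn x y Ox Oy.
pose S := [set z | Om z /\ exists g, path_in Om x z g].
have center p (r : R) : 0 < r -> `|p - p| < r by rewrite subrr normr0.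
have SE : S = Om.
  apply: conn.
  - exists x; split => //; have [r r0 hr] := open_ball_in Ox.
    exists (segment_path x x); apply: (ball_segment_path hr) => //; exact: center.
  - exists S; last by apply/seteqP; split => z; [move=> h; split => //; exact: h.1|case].
    rewrite openE => z [Oz [g hg]]; have [r r0 hr] := open_ball_in Oz.
    suff : \forall w \near z, S w by [].
    apply/nbhs_normP; exists r => // w /= zw; split; first by apply: hr; rewrite distrC.
    exists (concat z g (segment_path z w)); apply: concat_path hg _.
    by apply: (ball_segment_path hr); [exact: center|rewrite distrC].
  - exists (closure S); first exact: closed_closure.
    apply/seteqP; split => z; first by move=> h; split; [exact: h.1|exact: subset_closure].
    move=> [Oz cz]; split => //; have [r r0 hr] := open_ball_in Oz.
    have zr : \forall w \near z, `|z - w| < r.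
      by apply/nbhs_normP; exists r.
    have [w [[Ow [g hg]] /= zw]] := cz _ zr.
    exists (concat w g (segment_path w z)); apply: concat_path hg _.
    by apply: (ball_segment_path hr); [rewrite distrC|exact: center].
have : S y by rewrite SE.
by case.
Qed.

End Paths.

(** * Transport along paths *)

Section Transport.
Variables (R : realType) (d n : nat).
Local Notation V := 'rV[R]_d.
Variables (Om : set V) (B : tensor R n d).
Hypothesis hopen : open Om.
Hypothesis cB : forall i j k x, Om x -> {for x, continuous (B i j k)}.
Implicit Types (x y z : V) (g : R -> V) (phi : R -> 'rV[R]_n) (v w : 'rV[R]_n).

(** Indexed so that the transport equation for row vectors reads phi' = phi *m rate, the form of
    [linear_solution]. *)
Definition rate g (t : R) : 'M[R]_n :=
  \matrix_(k, i) - \sum_j B i j k (g t) * ('D_1 g t) ord0 j.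

Lemma mulmx_rate g (t : R) v i : (v *m rate g t) ord0 i =
  - \sum_j \sum_k B i j k (g t) * v ord0 k * 'D_1 g t ord0 j.
Proof.
rewrite mxE; under eq_bigr do rewrite mxE mulrN mulr_sumr.
by rewrite sumrN exchange_big /=; congr (- _); do 2 apply: eq_bigr => ? _; ring.
Qed.

Lemma solves_transportP g phi : solves_transport B g phi <->
  forall t : R, 0 <= t <= 1 -> forall i,
    is_derive t 1 (fun s => phi s ord0 i) ((phi t *m rate g t) ord0 i).
Proof.
split=> h t t01.
  by move=> i; have /is_derive_rowP/(_ i) := h t t01; rewrite mxE mulmx_rate.
by apply/is_derive_rowP => i; rewrite mxE -mulmx_rate; exact: h.
Qed.

(** Clamping the time keeps the path in Omega, where B is continuous, and yields coefficients
    defined on all of R. *)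
Lemma rate_continuous x y g k i : path_in Om x y g ->
  continuous (fun t => rate g (clamp t) k i).
Proof.
move=> pg; case: (pg) => dg [cdg [gO _]].
have cg : continuous g by move=> t; exact: is_derive_row_continuous (path_in_derive t pg).
under eq_fun do rewrite mxE.
apply: cont_opp; apply: cont_sum => j _; apply: cont_mul.
  move=> t; apply: (@continuous_comp _ _ _ (fun s => g (clamp s)) (B i j k)).
    exact: (cont_comp (@clamp_continuous R) cg).
  by apply: cB; apply: gO; exact: clamp_in.
by apply: (cont_comp (f := fun t => 'D_1 g (clamp t)) (g := fun h : V => h ord0 j));
  [exact: (cont_comp (@clamp_continuous R) cdg)|exact: coord_continuous].
Qed.

Lemma rate_bounded x y g : path_in Om x y g ->
  exists2 K : R, 0 <= K & forall t : R, 0 <= t <= 1 -> forall k i, `|rate g t k i| <= K.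
Proof.
move=> pg.
have h (a : 'I_n * 'I_n) : {M : R | 0 <= M /\ forall t : R, 0 <= t <= 1 -> `|rate g t a.1 a.2| <= M}.
  apply/cid; have c := @rate_continuous x y g a.1 a.2 pg.
  have /compact_bounded [M [_ hM]] := continuous_compact (continuous_subspaceT c) (@segment_compact R 0 1).
  exists (`|M| + 1); split; first by rewrite addr_ge0.
  move=> t t01; apply: (hM (`|M| + 1)); first by rewrite (le_lt_trans (ler_norm M))// ltrDl.
  by exists t; rewrite ?clamp_id//= in_itv.
exists (\sum_a proj1_sig (h a)); first by rewrite sumr_ge0// => a _; case: (svalP (h a)).
move=> t t01 k i; have [_ hM] := svalP (h (k, i)); rewrite (le_trans (hM t t01))//.
rewrite (bigD1 (k, i))//= lerDl sumr_ge0// => a _.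
by case: (svalP (h a)).
Qed.

(** [solves_transport] asks for two-sided derivatives at 0 and 1 as well; the solution on all of R
    with clamped coefficients provides them. *)
Lemma transport_solution x y g v : path_in Om x y g ->
  exists phi, solves_transport B g phi /\ phi 0 = v.
Proof.
move=> pg; have [K K0 hK] := rate_bounded pg.
have [X [X0 hX]] := @linear_solution_exists R 1 n (fun t => rate g (clamp t)) v K
  (fun k i => @rate_continuous x y g k i pg) (fun t k i => hK _ (clamp_in t) k i).
exists X; split => //; apply/solves_transportP => t t01 i.
by have := hX t ord0 i; rewrite clamp_id.
Qed.

Lemma transport_exists x y g v : path_in Om x y g -> exists w, transport B g v w.
Proof.
by move=> pg; have [phi [hphi p0]] := transport_solution v pg; exists (phi 1); exists phi.
Qed.

Lemma solution_norm_bound g phi (K T : R) : 0 <= K -> 0 <= T <= 1 ->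
  (forall t : R, 0 <= t <= 1 -> forall k i, `|rate g t k i| <= K) ->
  solves_transport B g phi ->
  \sum_i phi T ord0 i ^+ 2 <= (\sum_i phi 0 ord0 i ^+ 2) * expR (2 * n%:R * K + 1).
Proof.
move=> K0 /andP[T0 T1] hK /solves_transportP h.
have t01 (t : R) : 0 <= t <= T -> 0 <= t <= 1 by move=> /andP[t0 tT]; rewrite t0 (le_trans tT).
have := @lin_gronwall R 1 n (rate g) phi (fun=> 0) K 0 T T0 K0 (lexx 0).
rewrite !big_ord1 expr0n /= !mulr0 addr0 => H.
apply: le_trans (H _ _ _) _.
- by move=> t /t01 ht i j; rewrite ord1 [X in _ + X]mxE addr0; exact: h.
- by move=> t /t01 ht i j; exact: hK.
- by move=> t _ i j; rewrite mxE normr0.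
- rewrite ler_wpM2l ?sumr_ge0// => [i _|]; first exact: sqr_ge0.
  by rewrite ler_expR ler_piMr// addr_ge0// !mulr_ge0.
Qed.

Lemma solution_linear g phi psi (c : R) : solves_transport B g phi -> solves_transport B g psi ->
  solves_transport B g (fun t => c *: phi t + psi t).
Proof.
move=> /solves_transportP h1 /solves_transportP h2; apply/solves_transportP => t t01 i.
have hc : is_derive t 1 (fun _ : R => c) 0 by exact: is_derive_fun_cst.
rewrite (_ : (fun s => _) = (fun s => c * phi s ord0 i + psi s ord0 i)); last first.
  by apply/funext => s; rewrite !mxE.
apply: (is_derive_eq (is_derive_funD (is_derive_funM hc (h1 t t01 i)) (h2 t t01 i))).
by rewrite mul0r add0r mulmxDl -scalemxAl [in RHS]mxE [X in _ = X + _]mxE.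
Qed.

(** The difference is again a solution, and the norm bound multiplies an initial value that is 0. *)
Lemma solution_unique x y g phi psi : path_in Om x y g ->
  solves_transport B g phi -> solves_transport B g psi -> phi 0 = psi 0 ->
  forall t : R, 0 <= t <= 1 -> phi t = psi t.
Proof.
move=> pg h1 h2 E t t01; have [K K0 hK] := rate_bounded pg.
have := solution_norm_bound K0 t01 hK (solution_linear (-1) h2 h1).
rewrite [X in _ <= X * _]big1 => [|i _]; last by rewrite E scaleN1r addNr mxE expr0n.
rewrite mul0r => H; apply/rowP => i; apply/eqP; rewrite -subr_eq0 -sqrf_eq0 -[_ == 0]andbT.
have : (phi t ord0 i - psi t ord0 i) ^+ 2 <= 0.
  have -> : phi t ord0 i - psi t ord0 i = (-1 *: psi t + phi t) ord0 i by rewrite !mxE mulN1r addrC.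
  apply: le_trans H; rewrite [leRHS](bigD1 i)//=.
  by rewrite lerDl sumr_ge0// => j _; exact: sqr_ge0.
by rewrite andbT => H2; rewrite eq_le H2 sqr_ge0.
Qed.

Lemma transport_unique x y g v w w' : path_in Om x y g ->
  transport B g v w -> transport B g v w' -> w = w'.
Proof.
move=> pg [phi [h1 [p0 <-]]] [psi [h2 [q0 <-]]].
by apply: (solution_unique pg h1 h2); [rewrite p0 q0|rewrite ler01 lexx].
Qed.

Lemma transport_linear g (c : R) v v' w w' : transport B g v w -> transport B g v' w' ->
  transport B g (c *: v + v') (c *: w + w').
Proof.
move=> [phi [h1 [<- <-]]] [psi [h2 [<- <-]]].
by exists (fun t => c *: phi t + psi t); split => //; exact: solution_linear.
Qed.

Lemma transport0 g : transport B g 0 0.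
Proof.
exists (fun=> 0); split => //; apply/solves_transportP => t _ i.
by rewrite mul0mx [X in is_derive _ _ _ X]mxE; under eq_fun do rewrite mxE; exact: is_derive_fun_cst.
Qed.

(* Since [step] is flat at both ends, the sum of the two reparametrised solutions is
   differentiable across the junction. *)
Lemma transport_concat x y z g1 g2 v w w' : path_in Om x y g1 -> path_in Om y z g2 ->
  transport B g1 v w -> transport B g2 w w' -> transport B (concat y g1 g2) v w'.
Proof.
move=> p1 p2 [phi [h1 [p0 pw]]] [psi [h2 [q0 qw]]].
have g1y : g1 1 = y by case: p1 => _ [_ [_ []]].
have g2y : g2 0 = y by case: p2 => _ [_ [_ []]].
pose Phi (t : R) := phi (step (2 * t + 0)) + psi (step (2 * t + - 1)) - w.
have le12 t : t <= 1 / 2 -> Phi t = phi (step (2 * t + 0)).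
  by move=> th; rewrite /Phi (@step_le0 _ (2 * t + -1)) ?q0 ?addrK//; lra.
have ge12 t : 1 / 2 <= t -> Phi t = psi (step (2 * t + - 1)).
  by move=> th; rewrite /Phi (@step_ge1 _ (2 * t + 0)) ?pw 1?addrC ?addKr//; lra.
exists Phi; split; last first.
  split; first by rewrite le12 ?mulr0 ?addr0 ?step0//; lra.
  by rewrite ge12 ?step_ge1//; lra.
move=> t t01.
have d1 := is_derive_step_affine (h1 _ (step_in (2 * t + 0))).
have d2 := is_derive_step_affine (h2 _ (step_in (2 * t + - 1))).
apply: (is_derive_eq (is_derive_rowB (is_derive_rowD d1 d2) (is_derive_row_cst w t))).
rewrite subr0 (derive_val_eq (is_derive_concat t p1 p2)).
(* The equation is linear in the velocity of the path, so the factor from the reparametrisation of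
   phi is the one in the velocity of [concat]. *)
have pull (g : R -> V) (q : 'rV[R]_n) s (c : R) a : a = c *: 'D_1 g s ->
    c *: (\row_i (- \sum_j \sum_k B i j k (g s) * q ord0 k * 'D_1 g s ord0 j)) =
    \row_i (- \sum_j \sum_k B i j k (g s) * q ord0 k * a ord0 j).
  move=> ->; apply/rowP => i; rewrite !mxE mulrN mulr_sumr; congr (- _).
  apply: eq_bigr => j _; rewrite mulr_sumr; apply: eq_bigr => k _; rewrite mxE; ring.
have [th|th] := leP t (1 / 2).
  rewrite concat_le// le12// [dstep (2 * t - 1)]dstep_le0; last by lra.
  by rewrite mul0r !scale0r !addr0; exact: pull.
rewrite (concat_ge _ g1y (ltW th)) ge12 ?(ltW th)// [dstep (2 * t + 0)]dstep_ge1; last by lra.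
by rewrite mul0r !scale0r !add0r; exact: pull.
Qed.

Lemma transport_const x v : transport B (segment_path x x) v v.
Proof.
exists (fun=> v); split => // t t01.
apply: (is_derive_eq (is_derive_row_cst v t)); apply/rowP => i; rewrite !mxE.
rewrite big1 ?oppr0// => j _; rewrite big1// => k _.
by rewrite (derive_val_eq (is_derive_segment x x t)) subrr mxE mulr0.
Qed.

Definition parallel (u : V -> 'rV[R]_n) :=
  forall x y g, path_in Om x y g -> transport B g (u x) (u y).

(** Let u(y) be the transport of v along some chosen path from x to y. For a path from y to z, the
    concatenated path and the chosen path to z give the same result because v lies in E^x;
    comparison with the constant path gives u(x) = v. *)
Lemma parallel_extension (conn : connected Om) x v : Om x -> Ex Om B x v ->
  exists u, parallel u /\ u x = v.
Proof.
move=> Ox Ev.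
have h y : {w : 'rV[R]_n | Om y -> exists g, path_in Om x y g /\ transport B g v w}.
  apply/cid; have [Oy|nOy] := pselect (Om y); last by exists 0.
  have [g pg] := path_connected hopen conn Ox Oy.
  by have [w tw] := transport_exists v pg; exists w => _; exists g.
exists (fun y => sval (h y)); split; last first.
  have [g [pg tg]] := svalP (h x) Ox.
  have pc : path_in Om x x (segment_path x x).
    by apply: segment_path_in => t _; rewrite /segment_path subrr scaler0 addr0.
  exact: (Ev x Ox _ _ pg pc _ _ tg (transport_const x v)).
move=> y z g pg.
have Oy : Om y by case: pg => _ [_ [gO [<- _]]]; apply: gO; rewrite lexx ler01.
have Oz : Om z by case: pg => _ [_ [gO [_ <-]]]; apply: gO; rewrite lexx ler01.
have [g1 [pg1 tg1]] := svalP (h y) Oy.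
have [g2 [pg2 tg2]] := svalP (h z) Oz.
have [w tw] := transport_exists (sval (h y)) pg.
rewrite -(Ev z Oz _ _ (concat_path pg1 pg) pg2 _ _ (transport_concat pg1 pg tg1 tw) tg2).
exact: tw.
Qed.

Lemma parallel_Ex u x : Om x -> parallel u -> Ex Om B x (u x).
Proof.
move=> Ox pu y Oy g1 g2 p1 p2 w1 w2 t1 t2.
by rewrite (transport_unique p1 t1 (pu _ _ _ p1)) (transport_unique p2 t2 (pu _ _ _ p2)).
Qed.

End Transport.

(** * Transported fields *)

Section Parallel.
Variables (R : realType) (d n : nat).
Local Notation V := 'rV[R]_d.
Variables (Om : set V) (B : tensor R n d) (M : R).
Hypothesis hopen : open Om.
Hypothesis cB : forall i j k x, Om x -> {for x, continuous (B i j k)}.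
Hypotheses (M0 : 0 <= M) (hM : forall i j k x, Om x -> `|B i j k x| <= M).
Implicit Types (x y z : V) (u : V -> 'rV[R]_n).

Lemma continuous_rhs (u : 'I_n -> V -> R) i j : (forall m x, Om x -> {for x, continuous (u m)}) ->
  forall x, Om x -> {for x, continuous (fun x => - \sum_k B i j k x * u k x)}.
Proof.
move=> cu x Ox; apply: cont_at_opp; apply: cont_at_sum => k.
by apply: cont_at_mul; [exact: cB|exact: cu].
Qed.

(** The partial derivatives are continuous, so the chain rule along a C^1 path turns them into the
    transport equation. *)
Lemma partials_parallel (u : 'I_n -> V -> R) :
  (forall m x, Om x -> {for x, continuous (u m)}) ->
  (forall x, Om x -> forall i j, is_derive x (evec R j) (u i) (- \sum_k B i j k x * u k x)) ->
  parallel Om B (fun x => \row_m u m x).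
Proof.
move=> cu du x y g pg; case: (pg) => dg [cdg [gO [g0 g1]]].
exists (fun t => \row_m u m (g t)); split; last by rewrite g0 g1.
apply/solves_transportP => t t01 i.
have Ot := gO t t01.
rewrite (_ : (fun s => _) = (fun s => u i (g s))); last by apply/funext => s; rewrite mxE.
have h := chain_rule (U := Om) (u := u i) (g := fun j x => - \sum_k B i j k x * u k x)
  hopen (fun y Oy j => du y Oy i j) (fun j y Oy => @continuous_rhs u i j cu y Oy) Ot (path_in_derive t pg).
apply: (is_derive_eq h); rewrite mulmx_rate -sumrN; apply: eq_bigr => j _.
rewrite mulrN mulr_sumr; congr (- _); apply: eq_bigr => k _; rewrite mxE; ring.
Qed.

Lemma rate_segment x y (t : R) k i : rate B (segment_path x y) t k i =
  - \sum_j B i j k (segment_path x y t) * (y - x) ord0 j.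
Proof. by rewrite mxE (derive_val_eq (is_derive_segment x y t)). Qed.

Lemma rate_segment_bound x y (L : R) : `|y - x| <= L ->
  (forall t : R, 0 <= t <= 1 -> Om (segment_path x y t)) ->
  forall t : R, 0 <= t <= 1 -> forall k i, `|rate B (segment_path x y) t k i| <= d%:R * (M * L).
Proof.
move=> yx sO t t01 k i; rewrite rate_segment normrN (le_trans (ler_norm_sum _ _ _))//.
rewrite mulr_natl -[X in _ *+ X]card_ord -sumr_const ler_sum// => j _.
by rewrite normrM ler_pM// ?hM ?(le_trans (coord_le_norm _ _))//; exact: sO.
Qed.

Definition sqr_norm (v : 'rV[R]_n) : R := \sum_i v ord0 i ^+ 2.

Lemma sqr_norm_ge0 (v : 'rV[R]_n) : 0 <= sqr_norm v.
Proof. by rewrite sumr_ge0// => i _; exact: sqr_ge0. Qed.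

Lemma coord_sqr_norm (v : 'rV[R]_n) i : `|v ord0 i| <= 1 + sqr_norm v.
Proof.
have h : v ord0 i ^+ 2 <= sqr_norm v.
  by rewrite /sqr_norm (bigD1 i)//= lerDl sumr_ge0// => k _; exact: sqr_ge0.
rewrite -real_normK ?num_real// in h; apply: le_trans (lerD (lexx 1) h).
by have := sqr_ge0 (`|v ord0 i| - 1); nra.
Qed.

(** The factor by which the squared norm of a transported field can grow along a segment of sup-norm
    length at most L: there the entries of [rate] are at most d M L. *)
Definition growth (L : R) := expR (2 * n%:R * (d%:R * (M * L)) + 1).

Lemma parallel_segment_bound u x y (L : R) : parallel Om B u ->
  (forall t : R, 0 <= t <= 1 -> Om (segment_path x y t)) -> `|y - x| <= L ->
  sqr_norm (u y) <= sqr_norm (u x) * growth L.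
Proof.
move=> pu sO yx.
have L0 : 0 <= L by apply: le_trans yx.
have [phi [hphi [<- <-]]] := pu _ _ _ (segment_path_in sO).
apply: (solution_norm_bound (K := d%:R * (M * L)) _ _ _ hphi); rewrite ?mulr_ge0 ?ler01 ?lexx//.
exact: rate_segment_bound.
Qed.

Lemma parallel_increment u x y i : parallel Om B u ->
  (forall t : R, 0 <= t <= 1 -> Om (segment_path x y t)) -> `|y - x| <= 1 ->
  `|u y ord0 i - u x ord0 i| <= `|y - x| * (n%:R * (d%:R * M) * (1 + sqr_norm (u x) * growth 1)).
Proof.
move=> pu sO yx1.
have [phi [hphi [p0 p1]]] := pu _ _ _ (segment_path_in sO).
have hb (L : R) := fun h : `|y - x| <= L => rate_segment_bound h sO.
have Kb (t : R) : 0 <= t <= 1 -> sqr_norm (phi t) <= sqr_norm (u x) * growth 1.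
  move=> t01; rewrite -p0.
  by apply: (solution_norm_bound (K := d%:R * (M * 1)) _ t01 (hb 1 yx1) hphi); rewrite !mulr_ge0.
have /solves_transportP hp := hphi.
have [c c01 E] := MVT_derive ler01 (fun t t01 => hp t t01 i).
rewrite p0 p1 subr0 mulr1 in E; rewrite E.
have -> : `|y - x| * (n%:R * (d%:R * M) * (1 + sqr_norm (u x) * growth 1)) =
  n%:R * (d%:R * (M * `|y - x|)) * (1 + sqr_norm (u x) * growth 1) by ring.
apply: norm_mulmx_entry; first exact: hb c01.
by move=> k; rewrite (le_trans (coord_sqr_norm _ _))// lerD2l Kb.
Qed.

Lemma ball_segment p x y (r : R) : (forall z, `|z - p| < r -> Om z) ->
  `|x - p| < r -> `|y - p| < r -> forall t : R, 0 <= t <= 1 -> Om (segment_path x y t).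
Proof. by move=> hr xr yr; case: (ball_segment_path hr xr yr) => _ [_ []]. Qed.

Lemma parallel_continuous u x i : parallel Om B u -> Om x -> {for x, continuous (fun z => u z ord0 i)}.
Proof.
move=> pu Ox; have [r r0 hr] := open_ball_in hopen Ox.
pose C := n%:R * (d%:R * M) * (1 + sqr_norm (u x) * growth 1) + 1.
have C0 : 0 < C by rewrite ltr_wpDl// !mulr_ge0// addr_ge0// mulr_ge0 ?sqr_norm_ge0 ?expR_ge0.
apply: cont_at_eps => e e0; exists (Num.min (Num.min r 1) (e / C)).
  by rewrite !lt_min r0 ltr01 divr_gt0.
move=> y; rewrite !lt_min distrC => /andP[/andP[yr y1] ye].
have sO : forall t : R, 0 <= t <= 1 -> Om (segment_path x y t).
  by apply: (ball_segment hr) => //; rewrite subrr normr0.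
rewrite distrC (le_trans (parallel_increment i pu sO (ltW y1)))//.
rewrite ltr_pdivlMr// in ye; apply: le_trans (ltW ye); rewrite ler_wpM2l// /C lerDl//.
Qed.

(** Along a segment in the direction e_j the field is itself a solution of the transport equation,
    from which its derivative at x is read off. *)
Lemma parallel_derive u x i j : parallel Om B u -> Om x ->
  is_derive x (evec R j) (fun z => u z ord0 i) (- \sum_k B i j k x * u x ord0 k).
Proof.
move=> pu Ox; have [r r0 hr] := open_ball_in hopen Ox.
pose e := evec R j.
pose s := r / 2; have s0 : 0 < s by rewrite divr_gt0.
have sr : s < r by rewrite ltr_pdivrMr// ltr_pMr// ltr1n.
have nse : `|s *: e| < r.
  by rewrite (le_lt_trans (norm_scale_evec _ _))// ger0_norm// ltW.
(* The point x is the midpoint, at time 1/2, because phi is known to agree with u along the segment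
   only for times in [0, 1]. *)
pose a := x - s *: e; pose b := x + s *: e.
have sO : forall t : R, 0 <= t <= 1 -> Om (segment_path a b t).
  apply: (ball_segment hr); first by rewrite /a addrAC subrr add0r normrN.
  by rewrite /b addrAC subrr add0r.
have [phi [hphi [p0 p1]]] := pu _ _ _ (segment_path_in sO).
(* The rescaled restriction of phi to [0, t] is the transport along the initial piece of the
   segment, so uniqueness identifies its end value with u. *)
have phiE (t : R) : 0 <= t <= 1 -> phi t = u (segment_path a b t).
  move=> /andP[t0 t1].
  have sOt (s' : R) : 0 <= s' <= 1 -> Om (segment_path a (segment_path a b t) s').
    move=> /andP[s0' s1].
    rewrite (_ : segment_path a _ s' = segment_path a b (s' * t)).
      by apply: sO; rewrite mulr_ge0//= mulr_ile1.
    by apply/rowP => k; rewrite !mxE; ring.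
  have pt := segment_path_in sOt.
  apply: (transport_unique cB pt) (pu _ _ _ pt).
  exists (fun s' => phi (t * s' + 0)); split; last by rewrite mulr0 mulr1 !addr0.
  move=> s' s01.
  have ts01 : 0 <= t * s' + 0 <= 1.
    by move/andP: s01 => [h1 h2]; rewrite addr0 mulr_ge0//= mulr_ile1.
  have E : segment_path a (segment_path a b t) s' = segment_path a b (t * s' + 0).
    by apply/rowP => k; rewrite !mxE; ring.
  apply: (is_derive_eq (is_derive_row_comp (h := fun s' => t * s' + 0) (hphi _ ts01) (is_derive_affine t 0 s'))).
  rewrite (derive_val_eq (is_derive_segment a b _)) (derive_val_eq (is_derive_segment _ _ s')) E.
  apply/rowP => k; rewrite !mxE mulrN mulr_sumr; congr (- _); apply: eq_bigr => l _.
  rewrite mulr_sumr; apply: eq_bigr => m _; rewrite !mxE; ring.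
have s20 : 2 * s != 0 by rewrite mulf_neq0 ?gt_eqF.
pose h (t : R) := (2 * s)^-1 * t + 2^-1.
have segh (t : R) : segment_path a b (h t) = x + t *: e.
  apply/rowP => k; rewrite !mxE /h; move: (_ %:R : R) => q; field; rewrite gt_eqF//.
have h0 : h 0 = 2^-1 by rewrite /h mulr0 add0r.
have hin (t : R) : `|t| < s -> 0 <= h t <= 1.
  move=> ts; have H : `|(2 * s)^-1 * t| <= 2^-1.
    by rewrite invfM -mulrA normrM ger0_norm ?invr_ge0// ler_piMr ?invr_ge0// normrM normfV
       (gtr0_norm s0) mulrC ler_pdivrMr// mul1r ltW.
  move: H; rewrite ler_norml /h => /andP[H1 H2]; apply/andP; split; lra.
have h01 : 0 <= h 0 <= 1 by apply: hin; rewrite normr0.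
have dphi := is_derive_row_comp (h := h) (hphi _ h01) (is_derive_affine _ _ 0).
apply/is_derive_line0.
have dphi_i := (is_derive_rowP _ _ _).1 dphi i.
have N : \forall t \near (0 : R), phi (h t) ord0 i = u (x + t *: e) ord0 i.
  apply/nbhs_normP; exists s => // t /=; rewrite sub0r normrN => /hin ht.
  by rewrite phiE// segh.
apply: (near_eq_is_derive N).
apply: (is_derive_eq dphi_i).
rewrite (derive_val_eq (is_derive_segment a b _)) segh scale0r addr0 !mxE mulrN; congr (- _).
rewrite (bigD1 j)//= [X in _ + X]big1 ?addr0 => [|l lj]; last first.
  by apply: big1 => k _; rewrite !mxE eqxx (negPf lj) /=; ring.
rewrite mulr_sumr; apply: eq_bigr => k _.
rewrite phiE// segh scale0r addr0 !mxE !eqxx /=.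
by field; rewrite gt_eqF.
Qed.

End Parallel.

Lemma is_derive_opp_dir (R : realType) (V : normedModType R) (f : V -> R) x v c :
  is_derive x v f c -> is_derive x (- v) f (- c).
Proof.
move=> h; apply/is_derive_line0.
rewrite (_ : (fun s : R => f (x + s *: - v)) = (fun s : R => f (x + (- s) *: v))); last first.
  by apply/funext => s; rewrite scalerN scaleNr.
have hf : is_derive (- 0 : R) 1 (fun s : R => f (x + s *: v)) c by rewrite oppr0; apply/is_derive_line0.
have hn : is_derive (0 : R) 1 (fun x : R => - x) (- 1) by exact: is_deriveNid.
apply: (is_derive_eq (@is_derive1_comp R (fun s => f (x + s *: v)) (fun x => - x) 0 _ _ hf hn)).
by rewrite mulrN mulr1.
Qed.

(** * Bounds for transported fields up to the boundary *)

Section Boundedness.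
Variables (R : realType) (d n : nat).
Local Notation V := 'rV[R]_d.
Variables (Om : set V) (B : tensor R n d).
Hypotheses (hopen : open Om) (hbdd : bounded_set Om) (hsmooth : smooth_boundary Om).
Hypothesis hB : forall i j k, {within closure Om, continuous (B i j k)}.

(* Near a boundary point the defining function decreases along a fixed direction, so a segment of
   fixed length in that direction leads from every nearby point of Omega to the vicinity of one
   fixed point of Omega. *)
Lemma boundary_descent p : closure Om p -> ~ Om p ->
  exists (psi dpsi : V -> R) (v : V) (r c : R), [/\ 0 < r /\ 0 < c, continuous psi,
    forall x, is_derive x v psi (dpsi x),
    forall x, `|x - p| < r -> dpsi x <= - c &
    forall x, `|x - p| < r -> (Om x <-> psi x < 0)].
Proof.
move=> cp np; have [r [r0 [psi [spsi [hv hO]]]]] := hsmooth cp np.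
have inball (x : V) : `|x - p| < r -> ball p r x.
  by move=> h; rewrite -ball_normE /ball_ /= distrC.
have [v0 v0P] := hv p (ballxx p r0).
have [v [dpsi [dP cd d0]]] : exists v dpsi, [/\ forall x, is_derive x v psi (dpsi x),
    continuous dpsi & dpsi p < 0].
  have [v0n|v0p] := ltP ('D_v0 psi p) 0.
    by exists v0, ('D_v0 psi); split => //; [move=> x; exact: smooth_derive|have [] := spsi [:: v0]].
  exists (- v0), (fun x => - 'D_v0 psi x); split.
  - by move=> x; apply: is_derive_opp_dir; exact: smooth_derive.
  - by apply: cont_opp; have [] := spsi [:: v0].
  - by rewrite oppr_lt0 lt_def v0P.
(* Half of the slope at p: by continuity the slope in the direction v stays below its negative near
   p. *)
have c0 : 0 < - dpsi p / 2 by rewrite divr_gt0// oppr_gt0.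
have /cvgrPdist_le/(_ _ c0) := cd p.
move=> /nbhs_normP[r1 /= r10 hr1].
exists psi, dpsi, v, (Num.min r r1), (- dpsi p / 2); split => //.
- by rewrite lt_min r0 r10.
- by have [] := spsi [::].
- move=> x; rewrite lt_min => /andP[_ xr]; have := hr1 x; rewrite /= distrC => /(_ xr).
  rewrite ler_norml => /andP[h _]; move: h; lra.
- by move=> x; rewrite lt_min => /andP[xr _]; apply: hO; exact: inball.
Qed.

Variables (M : R) (u : V -> 'rV[R]_n).
Hypotheses (M0 : 0 <= M) (hM : forall i j k x, Om x -> `|B i j k x| <= M).
Hypothesis pu : parallel Om B u.

(** At a boundary point the bound is carried from the fixed interior point q to z = y + tau v, which
    is close to q, and from z back to y along a segment in Omega of length tau |v|. *)
Lemma parallel_locally_bounded p : closure Om p ->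
  exists2 r : R, 0 < r & exists C : R, forall y, Om y -> `|y - p| < r -> sqr_norm (u y) <= C.
Proof.
have bound x y (L : R) := @parallel_segment_bound R d n Om B M M0 hM u x y L pu.
have bball q (r : R) : (forall z, `|z - q| < r -> Om z) ->
    forall y, `|y - q| < r -> sqr_norm (u y) <= sqr_norm (u q) * growth d n M r.
  move=> hr y yr; apply: bound; last exact: ltW.
  by apply: (ball_segment hr) => //; rewrite subrr normr0 (le_lt_trans _ yr).
move=> cp; have [Op|np] := pselect (Om p).
  have [r r0 hr] := open_ball_in hopen Op.
  by exists r => //; exists (sqr_norm (u p) * growth d n M r) => y _; exact: bball.
have [psi [dpsi [v [r [c [[r0 c0] cpsi dP hd hO]]]]]] := boundary_descent cp np.
(* If psi were positive at p it would be positive near p, while points of Omega, where psi is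
   negative, accumulate at p. *)
have psip : psi p <= 0.
  rewrite leNgt; apply/negP => pp.
  have h1 : \forall x \near p, 0 < psi x.
    by apply: (cpsi p [set z | 0 < z]); apply: open_nbhs_nbhs; split => //; exact: open_gt.
  have h2 : \forall x \near p, `|p - x| < r by apply/nbhs_normP; exists r.
  have [x [Ox [/= x1 x2]]] := cp _ (filterI h1 h2).
  by move: x1; rewrite ltNge ltW//; apply/(hO x) => //; rewrite distrC.
have desc y (t : R) : 0 <= t -> (forall s : R, 0 <= s <= t -> `|y + s *: v - p| < r) ->
    psi (y + t *: v) <= psi y - c * t.
  move=> t0 hs.
  have hk (s : R) : is_derive s 1 (fun s : R => psi (y + s *: v)) (dpsi (y + s *: v)).
    by apply/is_derive_line.
  have [s st E] := MVT_derive t0 (fun s _ => hk s).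
  move: E; rewrite scale0r addr0 subr0 => E.
  have -> : psi (y + t *: v) = psi y + dpsi (y + s *: v) * t by rewrite -E [RHS]addrC subrK.
  rewrite lerD2l -mulNr ler_wpM2r//; apply: hd; exact: hs.
(* Moves by at most tau v from the ball of radius r / 2 stay in the ball of radius r; the summand 1
   allows for v = 0 in the division. *)
pose tau := r / 2 / (`|v| + 1).
have v10 : 0 < `|v| + 1 by rewrite ltr_wpDl.
have tau0 : 0 < tau by rewrite !divr_gt0.
have r20 : 0 < r / 2 by rewrite divr_gt0.
have tv : tau * `|v| <= r / 2.
  by rewrite /tau mulrAC ler_pdivrMr// ler_wpM2l ?(ltW r20)// lerDl.
have inr y (s : R) : `|y - p| < r / 2 -> 0 <= s <= tau -> `|y + s *: v - p| < r.
  move=> yp /andP[s0 st]; rewrite addrAC (le_lt_trans (ler_normD _ _))// (splitr r) ltr_leD//.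
  by rewrite normrZ ger0_norm// (le_trans _ tv)// ler_wpM2r.
have pp : `|p - p| < r / 2 by rewrite subrr normr0.
pose q := p + tau *: v.
have Oq : Om q.
  apply/(hO q); first by apply: inr => //; rewrite lexx ltW.
  have /le_lt_trans := desc p tau (ltW tau0) (fun s hs => inr p s pp hs); apply.
  by rewrite (le_lt_trans (lerD psip (lexx _)))// add0r oppr_lt0 mulr_gt0.
have [del del0 hdel] := open_ball_in hopen Oq.
exists (Num.min del (r / 2)); first by rewrite lt_min del0.
exists (sqr_norm (u q) * growth d n M del * growth d n M (tau * `|v|)) => y Oy.
rewrite lt_min => /andP[y1 y2].
pose z := y + tau *: v.
have zq : `|z - q| < del by rewrite /z /q opprD addrACA subrr addr0.
have := bball q del hdel z zq => hz.
apply: le_trans (_ : sqr_norm (u z) * growth d n M (tau * `|v|) <= _); last first.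
  by rewrite ler_wpM2r// expR_ge0.
apply: bound; last by rewrite /z opprD addrA subrr add0r normrN normrZ ger0_norm// ltW.
move=> t /andP[t0 t1].
have E : segment_path z y t = y + ((1 - t) * tau) *: v.
  by apply/rowP => i; rewrite !mxE; ring.
have s0 : 0 <= (1 - t) * tau by rewrite mulr_ge0 ?subr_ge0// ltW.
have st : (1 - t) * tau <= tau by rewrite ler_piMl ?(ltW tau0)// gerBl.
rewrite E; apply/hO; first by apply: inr => //; rewrite s0.
apply: le_lt_trans (desc y _ s0 _) _.
  by move=> s /andP[h1 h2]; apply: inr => //; rewrite h1 (le_trans h2).
have yr : `|y - p| < r by rewrite (lt_trans y2)// ltr_pdivrMr// ltr_pMr// ltr1n.
have /(hO y yr) := Oy; apply: le_lt_trans.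
by rewrite gerBl mulr_ge0// ltW.
Qed.

Lemma parallel_bounded : exists2 C : R, 0 <= C & forall y, Om y -> sqr_norm (u y) <= C.
Proof.
have cl := (compact_near_coveringP (closure Om)).1 (compact_closure hbdd).
(* A local bound remains valid for every larger constant, so compactness of the closure, applied
   along the filter at infinity, produces one constant for all of Omega. *)
have : \forall C \near +oo%R, closure Om `<=` (fun y => Om y -> sqr_norm (u y) <= C).
  apply: cl => p cp; have [r r0 [C hC]] := parallel_locally_bounded cp.
  exists ([set y | `|p - y| < r], [set C' : R | C < C']) => /=.
    have h : \forall y \near p, `|p - y| < r by apply/nbhs_normP; exists r.
    by split; [exact: h|exact: (nbhs_pinfty_gt (num_real C))].
  by move=> [y C'] [/= yp CC'] Oy; rewrite (le_trans (hC y Oy _)) 1?distrC// ltW.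
move=> [C [_ hC]].
exists (Num.max 0 (C + 1)); first by rewrite le_max lexx.
move=> y Oy; apply: le_trans (_ : C + 1 <= _); last by rewrite le_max lexx orbT.
by apply: (hC (C + 1)) => //; [rewrite ltrDl|exact: subset_closure].
Qed.

End Boundedness.

(** * Transported fields solve the weak equation *)

Section ParallelKernel.
Variables (R : realType) (d n : nat).
Local Notation V := 'rV[R]_d.
Local Notation Rdd := (Rd R d).
Variable lam : {measure set Rdd -> \bar R}.
Hypothesis hlam : is_lebesgue lam.
Local Notation I := (intR lam).
Variables (Om : set V) (B : tensor R n d).
Hypotheses (hopen : open Om) (hbdd : bounded_set Om) (hsmooth : smooth_boundary Om).
Hypothesis hB : forall i j k, {within closure Om, continuous (B i j k)}.

(** Only continuity of f inside Omega is given; a point outside Omega has the open complement of K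
    as a neighbourhood, and there the product vanishes. *)
Lemma restrict_mul_Cc (f phi : V -> R) (K : set V) : (forall x, Om x -> {for x, continuous f}) ->
  continuous phi -> compact K -> K `<=` Om -> (forall x, ~ K x -> phi x = 0) ->
  Cc (fun x => (f \_ Om) x * phi x).
Proof.
move=> cf cphi cK KO hK; split; last first.
  have [r _ hr] := bounded_domain hbdd.
  exists r => x xr; rewrite hK ?mulr0// => /KO /hr; by rewrite leNgt xr.
move=> x; have [Ox|nOx] := pselect (Om x).
  have h : {for x, continuous (fun y => f y * phi y)}.
    by apply: cont_at_mul; [exact: cf|exact: cphi].
  apply: (cont_at_near h); have : \forall y \near x, Om y by exact: open_nbhs_nbhs.
  by apply: filterS => y Oy; rewrite patchE ifT// inE.
have c0 : {for x, continuous (fun _ : V => 0 : R)} by exact: cont_cst.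
apply: (cont_at_near c0).
have oK : open (~` K).
  by apply: closed_openC; apply: compact_closed cK; exact: norm_hausdorff.
have : \forall y \near x, (~` K) y by apply: open_nbhs_nbhs; split => // /KO.
by apply: filterS => y nK; rewrite hK// mulr0.
Qed.

Lemma derive_zero_outside (phi : V -> R) (K : set V) v : smooth phi -> compact K ->
  (forall x, ~ K x -> phi x = 0) -> forall x, ~ K x -> 'D_v phi x = 0.
Proof.
move=> sphi cK hK x nK.
have oK : open (~` K).
  by apply: closed_openC; apply: compact_closed cK; exact: norm_hausdorff.
have N : \forall y \near x, 0 = phi y.
  have : \forall y \near x, (~` K) y by apply: open_nbhs_nbhs.
  by apply: filterS => y nKy; rewrite hK.
have h0 : is_derive x v (fun _ : V => 0 : R) 0 by exact: is_derive_fun_cst.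
by apply: is_derive_unique (near_eq_is_derive N h0); exact: smooth_derive.
Qed.

(** The product of u_i and phi, extended by 0, has a continuous compactly supported derivative in
    the direction e_j, so that derivative has integral 0; it is minus the integrand of the weak
    equation. Square integrability comes from boundedness on a set of finite measure. *)
Lemma parallel_in_kernel (u : V -> 'rV[R]_n) : parallel Om B u ->
  in_kernel lam Om B (fun i x => u x ord0 i).
Proof.
move=> pu.
have [M M0 hM'] := tensor_bounded hbdd hB.
have hM i j k x : Om x -> `|B i j k x| <= M by move=> Ox; apply: hM'; exact: subset_closure.
have cB := tensor_continuous hopen hB.
have cu i x : Om x -> {for x, continuous (fun z => u z ord0 i)}.
  exact: (parallel_continuous hopen (ltW M0) hM pu).
have du i j x : Om x -> is_derive x (evec R j) (fun z => u z ord0 i) (- \sum_k B i j k x * u x ord0 k).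
  exact: (parallel_derive hopen cB i j pu).
have mO : measurable (Om : set Rdd) by exact: measurable_open.
have mu i : measurable_fun (Om : set Rdd) (fun x : Rdd => u x ord0 i).
  exact: (measurable_cont hopen (cu i)).
have [r r0 hr] := bounded_domain hbdd.
have lO := lam_bounded_lty hlam mO hr.
have [C C0 hC] := parallel_bounded hopen hbdd hsmooth (ltW M0) hM pu.
split; [exact: mu|split].
  move=> i; apply: (@le_lt_trans _ _ (\int[lam]_(x in (Om : set Rdd)) (cst C%:E x))%E).
    apply: ge0_le_integral => //.
    - by move=> x _; rewrite lee_fin sqr_ge0.
    - by apply/measurable_EFinP; exact: measurable_funX.
    - move=> x Ox; rewrite lee_fin; apply: le_trans (hC x Ox).
      by rewrite /sqr_norm (bigD1 i)//= lerDl sumr_ge0// => k _; exact: sqr_ge0.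
  by rewrite integral_cst// lte_mul_pinfty// ?lee_fin.
move=> phi [sphi [K [cK [KO hK]]]] i j.
pose ui z := u z ord0 i; pose dui z := - \sum_k B i j k z * u z ord0 k.
have cdui x : Om x -> {for x, continuous dui}.
  exact: (@continuous_rhs _ _ _ _ _ cB (fun k x => u x ord0 k) i j (fun k => @cu k)).
have cphi : continuous phi by have [] := sphi [::].
pose dphi := 'D_(evec R j) phi.
have cdphi : continuous dphi by have [] := sphi [:: evec R j].
have hdphi x : ~ K x -> dphi x = 0 by exact: derive_zero_outside.
pose w x := (ui \_ Om) x * phi x.
pose dw x := (dui \_ Om) x * phi x + (ui \_ Om) x * dphi x.
have Cw : Cc w by exact: (restrict_mul_Cc (cu i) cphi cK KO hK).
have Ca : Cc (fun x => (dui \_ Om) x * phi x) by exact: (restrict_mul_Cc cdui cphi cK KO hK).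
have Cb : Cc (fun x => (ui \_ Om) x * dphi x) by exact: (restrict_mul_Cc (cu i) cdphi cK KO hdphi).
have cdw : continuous dw by apply: cont_add; [exact: Ca.1|exact: Cb.1].
have dwP x : is_derive x (evec R j) w (dw x).
  have [Ox|nOx] := pselect (Om x).
    have N : \forall y \near x, ui y * phi y = w y.
      have : \forall y \near x, Om y by exact: open_nbhs_nbhs.
      by apply: filterS => y Oy; rewrite /w patchE ifT// inE.
    apply: (near_eq_is_derive N).
    apply: (is_derive_eq (is_derive_funM (du i j x Ox) (smooth_derive (evec R j) x sphi))).
    by rewrite /dw !patchE !ifT// inE.
  have nK : ~ K x by move=> /KO.
  rewrite /dw hK// hdphi// !mulr0 addr0.
  have oK : open (~` K).
    by apply: closed_openC; apply: compact_closed cK; exact: norm_hausdorff.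
  have N : \forall y \near x, 0 = w y.
    have : \forall y \near x, (~` K) y by apply: open_nbhs_nbhs.
    by apply: filterS => y nKy; rewrite /w hK// mulr0.
  by apply: (near_eq_is_derive N); exact: is_derive_fun_cst.
have I0 : I dw = 0 by exact: (I_derive0 hlam Cw cdw dwP).
pose g (x : V) := - (u x ord0 i * 'D_(evec R j) phi x) + (\sum_k B i j k x * u x ord0 k) * phi x.
have gE : g \_ Om = (fun x => - dw x).
  apply/funext => x; rewrite /dw !patchE; case: ifPn => xO; last by rewrite !mul0r addr0 oppr0.
  by rewrite /g /dui mulNr opprD opprK addrC.
have Ldw : isL1 lam dw by apply: (L1D (L1_Cc' hlam Ca) (L1_Cc' hlam Cb)).
have Lg : isL1 lam (g \_ Om) by rewrite gE -[fun x => _]/(fun x => - dw x); under eq_fun do rewrite -mulN1r; exact: L1Z.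
have int := (L1_restrict lam g mO).1 Lg.
(* Finiteness has to be checked here because [fine] also sends infinite values to 0. *)
rewrite -[LHS]fineK; last exact: integrable_fin_num int.
have := I_restrict lam Om g; rewrite gE IN// I0 oppr0 => <-.
by [].
Qed.

End ParallelKernel.

(** * Dimension of the kernel *)

Section KernelDimension.
Variables (R : realType) (d n : nat).
Local Notation V := 'rV[R]_d.
Local Notation Rdd := (Rd R d).
Variable lam : {measure set Rdd -> \bar R}.
Hypothesis hlam : is_lebesgue lam.
Variables (Om : set V) (B : tensor R n d).
Hypotheses (hopen : open Om) (hbdd : bounded_set Om) (hconn : connected Om).
Hypothesis hsmooth : smooth_boundary Om.
Hypothesis hB : forall i j k, {within closure Om, continuous (B i j k)}.
Implicit Types (u : V -> 'rV[R]_n) (mu : 'I_n -> Rdd -> R).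

Local Notation aeq := (Defs.ae_eq lam Om).

Let cB := tensor_continuous hopen hB.

Lemma parallel_combination (k : nat) (c : 'I_k -> R) (u : 'I_k -> V -> 'rV[R]_n) :
  (forall l, parallel Om B (u l)) -> parallel Om B (fun x => \sum_l c l *: u l x).
Proof.
move=> pu x y g pg; elim: (index_enum _) => [|l s IH].
  by rewrite !big_nil; exact: transport0.
by rewrite !big_cons; apply: transport_linear IH; exact: pu.
Qed.

(** By uniqueness the transport of 0 is 0, and every point of Omega is joined to x by a path. *)
Lemma parallel_vanish u x : Om x -> parallel Om B u -> u x = 0 -> forall y, Om y -> u y = 0.
Proof.
move=> Ox pu ux y Oy; have [g pg] := path_connected hopen hconn Ox Oy.
by have := pu _ _ _ pg; rewrite ux => h; apply: (transport_unique cB pg h); exact: transport0.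
Qed.

Lemma parallel_entry_continuous u i x : parallel Om B u -> Om x ->
  {for x, continuous (fun z => u z ord0 i)}.
Proof.
have [M M0 hM] := tensor_bounded hbdd hB.
move=> pu Ox; apply: (parallel_continuous hopen (ltW M0) _ pu Ox) => *.
by apply: hM; exact: subset_closure.
Qed.

Lemma parallel_ae_eq u u' : parallel Om B u -> parallel Om B u' ->
  aeq (fun i x => u x ord0 i) (fun i x => u' x ord0 i) ->
  forall x, Om x -> u x = u' x.
Proof.
move=> pu pu' h x Ox; apply/rowP => i.
by apply: (continuous_ae_eq hlam hopen _ _ (h i) Ox) => y; exact: parallel_entry_continuous.
Qed.

Lemma kernel_parallel mu : in_kernel lam Om B mu ->
  exists u, parallel Om B u /\ aeq mu (fun i x => u x ord0 i).
Proof.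
move=> hmu; have [u [cu du ae]] := kernel_regularity hlam hopen hbdd hB hmu.
exists (fun x => \row_m u m x); split; first exact: partials_parallel.
by move=> i; apply: filterS (ae i) => x h /h ->; rewrite mxE.
Qed.

Lemma aeq_combination (k : nat) (c : 'I_k -> R) (e e' : 'I_k -> 'I_n -> Rdd -> R) :
  (forall l, aeq (e l) (e' l)) ->
  aeq (fun i x => \sum_l c l * e l i x) (fun i x => \sum_l c l * e' l i x).
Proof.
move=> h i; elim: (index_enum _) => [|l s IH].
  by apply: aeW => x _; rewrite !big_nil.
by apply: filterS2 (h l i) IH => x h1 h2 Ox; rewrite !big_cons h1// h2.
Qed.

Lemma aeq_trans (mu nu xi : 'I_n -> Rdd -> R) : aeq mu nu -> aeq nu xi -> aeq mu xi.
Proof. by move=> h1 h2 i; apply: filterS2 (h1 i) (h2 i) => x e1 e2 Ox; rewrite e1// e2. Qed.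

Lemma combination_entry (k : nat) (c : 'I_k -> R) (u : 'I_k -> V -> 'rV[R]_n) i x :
  (\sum_l c l *: u l x) ord0 i = \sum_l c l * u l x ord0 i.
Proof. by rewrite summxE; apply: eq_bigr => l _; rewrite mxE. Qed.

Lemma mul_row_entries (k : nat) (c : 'rV[R]_k) (u : 'I_k -> V -> 'rV[R]_n) x :
  c *m (\matrix_(l, i) u l x ord0 i) = \sum_l c ord0 l *: u l x.
Proof.
apply/rowP => i; rewrite combination_entry mxE.
by apply: eq_bigr => l _; rewrite mxE.
Qed.

(** The rows of the matrix are the values at x of the transported representatives of the basis. A
    relation between the rows propagates from x to all of Omega, so it is a relation almost
    everywhere; a vector of E^x extends to a kernel element and is expanded in the basis. *)
Lemma dim_kernel_conservative k : dim_kernel_eq lam Om B k -> k_conservative Om B k.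
Proof.
move=> [e [eN [eind espan]]] x Ox.
have hU l : {u | parallel Om B u /\ aeq (e l) (fun i x => u x ord0 i)}.
  by apply/cid; exact: kernel_parallel.
pose U l := sval (hU l).
have pU l : parallel Om B (U l) by case: (svalP (hU l)).
have eU l : aeq (e l) (fun i x => U l x ord0 i) by case: (svalP (hU l)).
exists (\matrix_(l, i) U l x ord0 i); split.
  apply: inj_row_free => c; rewrite mul_row_entries => c0.
  have z := parallel_vanish Ox (parallel_combination (fun l => c ord0 l) pU) c0.
  apply/rowP => l; rewrite mxE; apply: (eind (fun l => c ord0 l)).
  apply: aeq_trans (aeq_combination _ eU) _ => i.
  by apply: aeW => y Oy; rewrite -combination_entry z// mxE.
move=> v; split => [Ev|/submxP[c ->]].
  have [u [pu <-]] := parallel_extension hopen cB hconn Ox Ev.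
  have [c hc] := espan _ (parallel_in_kernel hlam hopen hbdd hsmooth hB pu).
  apply/submxP; exists (\row_l c l); rewrite mul_row_entries.
  under eq_bigr do rewrite mxE.
  apply: (parallel_ae_eq pu (parallel_combination c pU)) => //.
  apply: aeq_trans hc _; apply: aeq_trans (aeq_combination _ eU) _ => i.
  by apply: aeW => y Oy; rewrite combination_entry.
rewrite mul_row_entries.
exact: (parallel_Ex cB Ox (parallel_combination (fun l => c ord0 l) pU)).
Qed.

(** A basis of E^x at a single point x extends to transported fields; they are independent since
    equality almost everywhere is equality at x, and they span since two transported fields that
    agree at x agree on Omega. *)
Lemma conservative_dim_kernel k : Om !=set0 -> k_conservative Om B k -> dim_kernel_eq lam Om B k.
Proof.
move=> [x Ox] /(_ x Ox) [A [freeA EA]].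
have hU l : {u | parallel Om B u /\ u x = row l A}.
  by apply/cid; apply: parallel_extension => //; apply/EA; exact: row_sub.
pose U l := sval (hU l).
have pU l : parallel Om B (U l) by case: (svalP (hU l)).
have Ux l : U l x = row l A by case: (svalP (hU l)).
have Uc (c : 'I_k -> R) : \sum_l c l *: U l x = (\row_l c l) *m A.
  by rewrite mulmx_sum_row; apply: eq_bigr => l _; rewrite Ux mxE.
exists (fun l i y => U l y ord0 i); split; [|split].
- by move=> l; exact: (parallel_in_kernel hlam hopen hbdd hsmooth hB (pU l)).
- move=> c hc.
  have p0 : parallel Om B (fun=> 0) by move=> *; exact: transport0.
  have := parallel_ae_eq (parallel_combination c pU) p0 _ Ox; rewrite Uc => h l.
  have /rowP/(_ l) : \row_l c l = 0.
    apply: (row_free_inj freeA); rewrite mul0mx; apply: h => i; apply: filterS (hc i) => y E /E.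
    by rewrite combination_entry mxE.
  by rewrite !mxE.
move=> mu hmu; have [u [pu muE]] := kernel_parallel hmu.
have /EA/submxP[c cE] := parallel_Ex cB Ox pu.
exists (fun l => c ord0 l); apply: aeq_trans muE _ => i; apply: aeW => y Oy.
rewrite -combination_entry; congr (fun_of_matrix _ _ i); apply/eqP; rewrite -subr_eq0; apply/eqP.
(* The difference of the two fields is written as a combination over two indices with coefficients 1
   and -1, which is again a transported field and vanishes at x. *)
pose W (b : 'I_2) := if b == ord0 then u else (fun y => \sum_l c ord0 l *: U l y).
pose a (b : 'I_2) : R := if b == ord0 then 1 else -1.
have pW b : parallel Om B (W b).
  by rewrite /W; case: ifP => // _; exact: (parallel_combination (fun l => c ord0 l) pU).
have WE z : \sum_b a b *: W b z = u z - \sum_l c ord0 l *: U l z.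
  by rewrite big_ord_recl big_ord1 /a /W /= scale1r scaleN1r.
rewrite -WE; apply: (parallel_vanish Ox (parallel_combination a pW)) => //.
rewrite WE Uc cE (_ : \row_l c ord0 l = c) ?subrr//.
by apply/rowP => l; rewrite mxE.
Qed.

End KernelDimension.

Theorem theorem4p1 (R : realType) (d n : nat) (hd : (2 <= d)%N)
  (lam : {measure set (Rd R d) -> \bar R}) (hlam : is_lebesgue lam)
  (Om : set 'rV[R]_d) (hopen : open Om) (hbdd : bounded_set Om)
  (hne : Om !=set0) (hconn : connected Om) (hsmooth : smooth_boundary Om)
  (B : tensor R n d)
  (hB : forall i j k, {within closure Om, continuous (B i j k)})
  (k : nat) (hk : (k <= n)%N) :
  dim_kernel_eq lam Om B k <-> k_conservative Om B k.
Proof.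
split; first exact: (dim_kernel_conservative hlam hopen hbdd hconn hsmooth hB).
exact: (conservative_dim_kernel hlam hopen hbdd hconn hsmooth hB hne).
Qed.
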